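(* For every $\tau\in\mathbb H_n$ the differential $n$-form $\theta(\tau,Z)$ on $M=\Gamma\backslash B$ extends to a smooth differential form on the Borel–Serre compactification $\overline M$. Moreover, for each boundary torus $\mathbb T_j$ of $\overline M$, the coefficients (with respect to the forms $db_{i_1}\wedge\cdots\wedge db_{i_n}$, where $b_1,\dots,b_{p-1}$ are linear coordinates on $W(\mathbb R)$) of the restriction of $\theta(\tau,Z)$ to $\mathbb T_j$ are, as functions of $\tau$, given by linear combinations of holomorphic Siegel cusp forms of weight $m/2$ coming from the orthogonal group $O(p-1)$, i.e. they are elements of $\Theta^{(n)}(p-1)$.
   Context: Setting. Let $V$ be a $\mathbb Q$-vector space of dimension $m=p+1$ with a non-degenerate symmetric bilinear form $(\,,)$ of signature $(p,1)$; fix an orientation of $V(\mathbb R)$. Let $L\subset V$ be a $\mathbb Z$-lattice of full rank with $L\subset L^{\#}$ (dual lattice). Let $G=SO(V)$, $G_0(\mathbb R)$ the identity component of $G(\mathbb R)$, and $\Gamma$ a neat subgroup of finite index in the stabilizer of $L$ in $G_0(\mathbb R)$, acting trivially on $L^{\#}/L$. Let $B$ be one component of $\{Z\in V(\mathbb R):(Z,Z)=-1\}$ (hyperbolic $p$-space), with $T_Z(B)=Z^\perp$, oriented so that $(w_1,\dots,w_p)$ is positive in $Z^\perp$ iff $(w_1,\dots,w_p,Z)$ is positive in $V(\mathbb R)$. Let $M=\Gamma\backslash B$; it has finite volume and is assumed non-compact (equivalently $V$ contains a nonzero rational isotropic vector). Fix $1\le n\le p$ and $h\in(L^{\#})^n$.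 Compactification. Let $\ell_0,\dots,\ell_r$ represent the $\Gamma$-orbits of rational isotropic lines (cusps), $u_j$ the primitive generator of $\ell_j\cap L$ with $(u_j,Z)<0$ for $Z\in B$, $g_j\in G(\mathbb Q)\cap G_0(\mathbb R)$ with $g_ju_0=u_j$, $g_0=1$. Choose a rational isotropic $u_0'$ with $(u_0,u_0')=-\frac12$ and put $W=\{u_0,u_0'\}^\perp$ (positive definite of dimension $p-1$). For $t>0$, $b\in W(\mathbb R)$ put $Z(t,b)=(t+t^{-1}(b,b))u_0+t^{-1}b+t^{-1}u_0'\in B$. The stabilizer $\Gamma_j$ of $\ell_j$ in $\Gamma$ acts in the coordinates $(t,b)\mapsto g_jZ(t,b)$ through translations $b\mapsto b+\lambda$, $\lambda$ in a lattice $\Lambda_j\subset W$. $\overline M$ is the compact manifold with boundary obtained by adding for each $j$ the torus $\mathbb T_j=\Lambda_j\backslash W(\mathbb R)$ at $t=\infty$, with smooth collar coordinates $(s,b)$, $s=1/t\ge0$. Theta function. For $Z\in B$ let $(\,,)_Z$ be the positive definite form equal to $(\,,)$ on $Z^\perp$ and to $-(\,,)$ on $\mathbb RZ$ (with $Z^\perp$ and $\mathbb R Z$ orthogonal). For $X=(x_1,\dots,x_n)\in V(\mathbb R)^n$, $(X,X)$ is the matrix $((x_i,x_j))$; similarly $(X,X)_Z$. For $\tau=u+iv\in\mathbb H_n$ (Siegel upper half space) and $w=(w_1,\dots,w_n)\in T_Z(B)^n$, $$\varphi_n(\tau,X,Z)(w)=2^{n/2}\det(v)^{1/2}\det\big((x_i,w_j)\big)\,e^{\pi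 i\,\mathrm{tr}(u(X,X)+iv(X,X)_Z)},$$ and $\theta(\tau,Z)=\sum_{X\in h+L^n}\varphi_n(\tau,X,Z)$, a $\Gamma$-invariant closed $n$-form on $B$, i.e. a form on $M$. Unstable cusp forms. $\Theta^{(n)}(p-1)$ is the complex span of the series $\sum_{X\in h'+(L')^n}P(X)e^{\pi i\,\mathrm{tr}((X,X)\tau)}$, where $L'$ is a lattice in a positive definite rational quadratic space $W'$ of dimension $p-1$, $h'\in W'^n$, and $P(X)$ is an $n\times n$ minor of the matrix of coordinates of $X\in W'(\mathbb R)^n$ with respect to an orthonormal basis of $W'(\mathbb R)$ ($\Theta^{(n)}(p-1)=0$ if $n=p$). These are holomorphic Siegel cusp forms of weight $m/2=\frac{p-1}2+1$ for suitable congruence subgroups of $Sp(n,\mathbb Z)$. *)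

(* Defs.v *)
From HB Require Import structures.
From mathcomp Require Export all_boot all_order all_algebra all_field.
From mathcomp Require Export complex.
From mathcomp Require Export all_classical all_reals all_analysis.

Set Implicit Arguments.
Unset Strict Implicit.
Unset Printing Implicit Defensive.

Export Order.TTheory GRing.Theory Num.Theory.
Export numFieldNormedType.Exports.

#[global] Open Scope classical_set_scope.
#[global] Open Scope ring_scope.
#[global] Open Scope complex_scope.

(* Vectors are rows and matrices act on the right: g sends x to x *m g. *)

Section QuadraticSpace.

Definition bil (F : pzRingType) k (Q : 'M[F]_k) (x y : 'rV[F]_k) : F :=
  (x *m Q *m y^T) 0 0.

Definition pos_def (F : numDomainType) k (Q : 'M[F]_k) : Prop :=
  forall x : 'rV[F]_k, x != 0 -> 0 < bil Q x x.

Definition toR (R : realType) k l (A : 'M[rat]_(k, l)) : 'M[R]_(k, l) :=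
  map_mx ratr A.

(* Signature (p,1): congruent over R to diag(1,...,1,-1). *)
Definition signature_p1 (R : realType) p (Q : 'M[rat]_p.+1) : Prop :=
  exists2 P : 'M[R]_p.+1, P \in unitmx &
    P *m toR R Q *m P^T = diag_mx (\row_i (if i == ord_max then -1 else 1)).

Definition is_lattice k (L : set 'rV[rat]_k) : Prop :=
  exists2 E : 'M[rat]_k, E \in unitmx &
    L = [set map_mx intr z *m E | z in [set: 'rV[int]_k]].

Definition dual_lattice k (Q : 'M[rat]_k) (L : set 'rV[rat]_k) :
  set 'rV[rat]_k := [set x | forall y, L y -> bil Q x y \is a Num.int].

End QuadraticSpace.

Section ArithmeticGroup.
Variables (R : realType) (p : nat) (Q : 'M[rat]_p.+1) (L : set 'rV[rat]_p.+1).

Definition SO_real : set 'M[R]_p.+1 :=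
  [set g | g *m toR R Q *m g^T = toR R Q /\ \det g = 1].

Definition SO_id_component : set 'M[R]_p.+1 :=
  connected_component SO_real 1%:M.

(* An element of SO(V)(R) stabilizing L is rational, so this is the whole
   stabilizer of L in the identity component. *)
Definition lattice_stabilizer : set 'M[rat]_p.+1 :=
  [set g | SO_id_component (toR R g) /\ [set x *m g | x in L] = L].

(* Borel's neatness: the subgroup of C^* generated by the eigenvalues is
   torsion free.  Eigenvalues of a rational matrix lie in algC. *)
Definition neat_mx k (g : 'M[rat]_k) : Prop :=
  forall (s : seq algC) (e : nat -> int) (N : nat),
    {in s, forall a, eigenvalue (map_mx ratr g : 'M[algC]_k) a} ->
    let z := \prod_(i < size s) s`_i ^ e i in
    (0 < N)%N -> z ^+ N = 1 -> z = 1.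

Record admissible_group (Gamma : set 'M[rat]_p.+1) : Prop := {
  ag_sub : Gamma `<=` lattice_stabilizer;
  ag_one : Gamma 1%:M;
  ag_mul : forall g g', Gamma g -> Gamma g' -> Gamma (g *m g');
  ag_inv : forall g, Gamma g -> Gamma (invmx g);
  ag_finite_index : exists s : seq 'M[rat]_p.+1,
    forall g, lattice_stabilizer g ->
      exists2 c : 'M[rat]_p.+1, c \in s & Gamma (g *m invmx c);
  ag_neat : forall g, Gamma g -> neat_mx g;
  ag_discriminant : forall g x, Gamma g -> dual_lattice Q L x ->
    L (x *m g - x)
}.

Definition hyperboloid : set 'rV[R]_p.+1 := [set Z | bil (toR R Q) Z Z = -1].

Definition hyperbolic_space (B : set 'rV[R]_p.+1) : Prop :=
  exists2 Z0, hyperboloid Z0 & B = connected_component hyperboloid Z0.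

(* T_Z(B) = Z^perp *)
Definition tangent (Z : 'rV[R]_p.+1) : set 'rV[R]_p.+1 :=
  [set w | bil (toR R Q) Z w = 0].

(* The cusp l_j is the line spanned by u j.  Every rational isotropic line is
   Gamma-equivalent to exactly one l_j; in particular V is isotropic, i.e.
   Gamma\B is not compact. *)
Record cusp_representatives (Gamma : set 'M[rat]_p.+1) (B : set 'rV[R]_p.+1)
    r (u : 'I_r.+1 -> 'rV[rat]_p.+1) : Prop := {
  cr_neq0 : forall j, u j != 0;
  cr_isotropic : forall j, bil Q (u j) (u j) = 0;
  cr_in_L : forall j, L (u j);
  cr_primitive : forall j (c : rat), L (c *: u j) -> c \is a Num.int;
  cr_sign : forall j Z, B Z -> bil (toR R Q) (toR R (u j)) Z < 0;
  cr_orbits : forall x : 'rV[rat]_p.+1, x != 0 -> bil Q x x = 0 ->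
    exists! j, exists2 g, Gamma g & exists c : rat, x *m g = c *: u j
}.

End ArithmeticGroup.

Section SmoothForms.
Variable R : realType.

Section Functions.
Variable E : normedModType R.

Fixpoint iter_derive (vs : seq E) (f : E -> R) : E -> R :=
  if vs is v :: vs' then 'D_v (iter_derive vs' f) else f.

Definition smooth_open (U : set E) (f : E -> R) : Prop :=
  forall (vs : seq E) x, U x ->
    {for x, continuous (iter_derive vs f)} /\
    forall v, derivable (iter_derive vs f) x v.

(* Smoothness on an arbitrary subset, e.g. a closed half space: local
   existence of smooth extensions. *)
Definition smooth_on (A : set E) (f : E -> R) : Prop :=
  forall x, A x -> exists U (F : E -> R),
    [/\ open U, U x, smooth_open U F & forall y, U y -> A y -> f y = F y].

End Functions.

(* Complex-valued n-forms on (a subset of) E. *)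
Definition nform n (E : normedModType R) := E -> ('I_n -> E) -> R[i].

Definition replace_at n (E : Type) (w : 'I_n -> E) i x : 'I_n -> E :=
  fun k => if k == i then x else w k.

Definition alt_multilinear n (E : normedModType R) (T : set E)
    (f : ('I_n -> E) -> R[i]) : Prop :=
  (forall w i a x y, (forall k, T (w k)) -> T x -> T y ->
     f (replace_at w i (a *: x + y)) =
       a%:C * f (replace_at w i x) + f (replace_at w i y)) /\
  (forall w i k, (forall l, T (w l)) -> i != k -> w i = w k -> f w = 0).

(* A smooth n-form on a subset A with non-empty interior of the vector space
   E: smoothness is tested on constant vector fields. *)
Definition smooth_nform n (E : normedModType R) (A : set E) (om : nform n E) :
    Prop :=
  (forall x, A x -> alt_multilinear [set: E] (om x)) /\
  (forall w, smooth_on A (fun x => complex.Re (om x w)) /\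
             smooth_on A (fun x => complex.Im (om x w))).

Definition pullback n (E E' : normedModType R) (k : E -> E')
    (om : nform n E') : nform n E :=
  fun x w => om (k x) (fun i => 'D_(w i) k x).

End SmoothForms.

Section Compactification.
Variables (R : realType) (p : nat) (Q : 'M[rat]_p.+1).

(* Z(t,b) *)
Definition horo_point (u0 u0' : 'rV[rat]_p.+1) (t : R) (b : 'rV[R]_p.+1) :
    'rV[R]_p.+1 :=
  (t + t^-1 * bil (toR R Q) b b) *: toR R u0 + t^-1 *: b + t^-1 *: toR R u0'.

(* The rows of e are a basis of W(R), W = {u0,u0'}^perp; the associated linear
   coordinates (b_1,...,b_{p-1}) of b are the row y with b = y *m e. *)
Definition basis_of_W (u0 u0' : 'rV[rat]_p.+1) (e : 'M[R]_(p.-1, p.+1)) :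
    Prop :=
  row_free e /\
  forall x : 'rV[R]_p.+1, (x <= e)%MS <->
    bil (toR R Q) x (toR R u0) = 0 /\ bil (toR R Q) x (toR R u0') = 0.

(* Collar coordinates (s,b), b given by its linear coordinates. *)
Definition collar : normedModType R := (R * 'rV[R]_p.-1)%type.

Definition collar_domain : set collar := [set x | 0 <= x.1].

Section Charts.
Variables (Gamma : set 'M[rat]_p.+1) (r : nat).
Variables (u : 'I_r.+1 -> 'rV[rat]_p.+1) (g : 'I_r.+1 -> 'M[rat]_p.+1).
Variables (u0' : 'rV[rat]_p.+1) (e : 'M[R]_(p.-1, p.+1)).

(* (s,b) |-> g_j Z(1/s,b); only used for s > 0. *)
Definition collar_chart (j : 'I_r.+1) (x : collar) : 'rV[R]_p.+1 :=
  horo_point (u ord0) u0' x.1^-1 (x.2 *m e) *m toR R (g j).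

(* Lambda_j in coordinates: the translations of b induced by the stabilizer
   Gamma_j of the line l_j. *)
Definition cusp_translations (j : 'I_r.+1) : set 'rV[R]_p.-1 :=
  [set lam | exists gam : 'M[rat]_p.+1,
    [/\ Gamma gam, exists c : rat, u j *m gam = c *: u j &
        forall (s : R) y, 0 < s ->
          collar_chart j (s, y) *m toR R gam = collar_chart j (s, y + lam)]].

(* A smooth n-form on Mbar, described by its lifts along the local
   diffeomorphisms B -> M and [0,oo) x W(R) -> Mbar (one for each j, extending
   (s,b) |-> class of g_j Z(1/s,b) to the boundary s = 0), which together cover
   Mbar.  The lifts om and eta j are invariant under the deck groups Gamma and
   Lambda_j and agree on the overlaps {s > 0}; different collars only meet
   inside M.  Smoothness of om on B is implied by that of eta j, because
   collar_chart j maps {s > 0} diffeomorphically onto B. *)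
Record smooth_form_on_Mbar n (B : set 'rV[R]_p.+1)
    (om : nform n 'rV[R]_p.+1) (eta : 'I_r.+1 -> nform n collar) : Prop := {
  sf_alt : forall Z, B Z -> alt_multilinear (tangent Q Z) (om Z);
  sf_Gamma : forall gam Z w, Gamma gam -> B Z ->
    (forall k, tangent Q Z (w k)) ->
    om (Z *m toR R gam) (fun k => w k *m toR R gam) = om Z w;
  sf_smooth : forall j, smooth_nform collar_domain (eta j);
  sf_Lambda : forall j lam (x : collar) w, cusp_translations j lam -> collar_domain x ->
    eta j (x.1, x.2 + lam) w = eta j x w;
  sf_glue : forall j (x : collar) w, 0 < (x.1 : R) ->
    eta j x w = pullback (collar_chart j) om x w
}.

End Charts.

(* Restriction to the boundary torus s = 0, as a form on W(R). *)
Definition boundary_restriction n (eta : nform n collar) :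
    nform n 'rV[R]_p.-1 :=
  fun y w => eta (0, y) (fun k => (0, w k)).

End Compactification.

Definition increasing n d (I : 'I_n -> 'I_d) : Prop :=
  forall i k : 'I_n, (i < k)%N -> (I i < I k)%N.

(* The coefficient of dx_{I 0} /\ ... /\ dx_{I (n-1)} (I increasing) is the
   value on the corresponding coordinate vectors. *)
Definition form_coef (R : realType) n d (I : 'I_n -> 'I_d)
    (om : nform n 'rV[R]_d) (y : 'rV[R]_d) : R[i] :=
  om y (fun k => delta_mx 0 (I k)).

Section Theta.
Variable R : realType.

Definition cexp (z : R[i]) : R[i] :=
  (expR (complex.Re z) * cos (complex.Im z)) +i*
  (expR (complex.Re z) * sin (complex.Im z)).

(* Sum of an absolutely convergent family. *)
Definition rsum (T : choiceType) (S : set T) (f : T -> R) : R :=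
  fine (\esum_(x in S) (Num.max (f x) 0)%:E) -
  fine (\esum_(x in S) (Num.max (- f x) 0)%:E).

Definition csum (T : choiceType) (S : set T) (f : T -> R[i]) : R[i] :=
  rsum S (fun x => complex.Re (f x)) +i* rsum S (fun x => complex.Im (f x)).

Definition siegel_upper_half n : set 'M[R[i]]_n :=
  [set tau | tau^T = tau /\ pos_def (map_mx (@complex.Im R) tau)].

(* h + L^n *)
Definition coset_pow n k (L : set 'rV[rat]_k) (h : 'M[rat]_(n, k)) :
  set 'M[rat]_(n, k) := [set X | forall i, L (row i (X - h))].

Section ThetaForm.
Variables (p n : nat) (Q : 'M[rat]_p.+1).

(* (x,y)_Z, through the orthogonal decomposition Z^perp + R Z. *)
Definition majorant (Z x y : 'rV[R]_p.+1) : R :=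
  let b := bil (toR R Q) in
  let pr x := (b x Z / b Z Z) *: Z in
  b (x - pr x) (y - pr y) - b (pr x) (pr y).

Definition phi_form (tau : 'M[R[i]]_n) (X : 'M[R]_(n, p.+1)) :
    nform n 'rV[R]_p.+1 :=
  fun Z w =>
  let u := map_mx (@complex.Re R) tau in
  let v := map_mx (@complex.Im R) tau in
  let XX := \matrix_(i, j) bil (toR R Q) (row i X) (row j X) in
  let XXZ := \matrix_(i, j) majorant Z (row i X) (row j X) in
  (2 `^ (n%:R / 2) * \det v `^ (1 / 2) *
   \det (\matrix_(i, j) bil (toR R Q) (row i X) (w j)))%:C *
  cexp (pi%:C * 'i%C * (\tr (u *m XX) +i* \tr (v *m XXZ))).

Definition theta_form (L : set 'rV[rat]_p.+1) (h : 'M[rat]_(n, p.+1))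
    (tau : 'M[R[i]]_n) : nform n 'rV[R]_p.+1 :=
  fun Z w => csum (coset_pow L h) (fun X => phi_form tau (toR R X) Z w).

End ThetaForm.

(* o: the rows are an orthonormal basis of W'(R), so that X *m invmx o is the
   matrix of coordinates of X; I: the increasing choice of columns of the
   minor. *)
Definition theta_series n d (Q' : 'M[rat]_d) (L' : set 'rV[rat]_d)
    (h' : 'M[rat]_(n, d)) (o : 'M[R]_d) (I : 'I_n -> 'I_d)
    (tau : 'M[R[i]]_n) : R[i] :=
  csum (coset_pow L' h') (fun X =>
    (\det (colsub I (toR R X *m invmx o)))%:C *
    cexp (pi%:C * 'i%C *
          \tr (map_mx (real_complex R) (toR R (X *m Q' *m X^T)) *m tau))).

Definition is_theta_generator n d (f : 'M[R[i]]_n -> R[i]) : Prop :=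
  exists Q' L' h' o (I : 'I_n -> 'I_d),
    [/\ Q'^T = Q' /\ pos_def Q', is_lattice L',
        o *m toR R Q' *m o^T = 1%:M,
        increasing I &
        f = @theta_series n d Q' L' h' o I].

(* Theta^(n)(d), as functions on the Siegel upper half space. *)
Definition Theta_space n d (f : 'M[R[i]]_n -> R[i]) : Prop :=
  exists k (c : 'I_k -> R[i]) (F : 'I_k -> 'M[R[i]]_n -> R[i]),
    (forall i, is_theta_generator d (F i)) /\
    (forall tau, siegel_upper_half tau -> f tau = \sum_(i < k) c i * F i tau).

End Theta.

(* Main.v *)
Require Import Defs.
From mathcomp Require Import perm.
From mathcomp Require Import ring lra zify.

Set Implicit Arguments.
Unset Strict Implicit.
Unset Printing Implicit Defensive.

(** Write X = a u0 + a' u0' + c in coordinates at a cusp, Z = Z(1/s, b).  Then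
    (x, x)_Z = (c - a' b, c - a' b) + (a'^2 / s^2 + s^2 A^2) / 2 with
    A = a - 2 (b, c) + a' (b, b), and (x, dZ) is affine in a, a', c with
    coefficients polynomial in s, 1/s, b.  The terms with a' <> 0 are bounded by
    exp (- const / s^2), so their sum and all its derivatives vanish to infinite
    order at s = 0.  In the terms with a' = 0 the sum over a is a Gaussian sum of
    mesh s: it equals s^-n times a constant up to an error O(s^k) for every k, and
    becomes O(s^k) when weighted by a linear factor.  Hence theta is, up to a flat
    function, the constant obtained from the leading term, which is a
    theta series of the positive definite lattice formed by the c's; a function
    that is flat and whose derivatives have at most polynomial poles in s extends
    smoothly by 0.  Finally the determinant of ((c_i, e_j)) expands into
    n x n minors of the coordinates of the c's in an orthonormal basis. *)

(** * Absolutely convergent real sums *)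

Section Summation.
Variable R : realType.

(** Smoothness at s = 0 asks for all mixed derivatives, while each differentiation of a Gaussian sum
    in s and b creates new poles and weights. Asymptotics are therefore proved for theta alone; of
    the derivatives only crude polynomial bounds are asked, and flatness passes to them by
    interpolation. Poisson summation is replaced by an elementary fact: the sum over a lattice of
    translates of a total derivative is small to every order in the mesh. The pole s^-n of the
    Gaussian sum is cancelled by the determinant: for a' = 0 the matrix ((x_i, dZ)) is s times a
    matrix depending on c plus a matrix of rank one linear in A, so its determinant is s^n times a
    constant plus a term linear in A, and no other Gaussian weights occur. Since L need not split
    along u0, u0' and W, a common denominator breaks the coset h + L^n into finitely many pieces
    indexed by residues, each a product over the coordinates. *)

Definition asum (T : choiceType) (f : T -> R) : Prop :=
  (\esum_(x in [set: T]) `|f x|%:E < +oo)%E.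


Section OneType.
Variable T : choiceType.
Implicit Types f g : T -> R.

Lemma asum_le f g : (forall x, `|f x| <= `|g x|) -> asum g -> asum f.
Proof.
by move=> fg; apply: le_lt_trans; apply: le_esum => x _; rewrite lee_fin.
Qed.

Lemma esum_ge0_fin f : (forall x, 0 <= f x) -> asum f ->
  (\esum_(x in [set: T]) (f x)%:E = (fine (\esum_(x in [set: T]) (f x)%:E))%:E)%E.
Proof.
move=> f0 sf; rewrite fineK // ge0_fin_numE; last by apply: esum_ge0 => x _; rewrite lee_fin.
by apply: le_lt_trans sf; apply: le_esum => x _; rewrite lee_fin ler_norm.
Qed.

Lemma rsum_ge0E f : (forall x, 0 <= f x) ->
  rsum [set: T] f = fine (\esum_(x in [set: T]) (f x)%:E).
Proof.
move=> f0; rewrite /rsum.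
under eq_esum => x _ do rewrite (max_idPl (f0 x)).
under [X in _ - fine X]eq_esum => x _.
  rewrite (_ : Num.max (- f x) 0 = 0); last by apply/max_idPr; rewrite oppr_le0.
  over.
by rewrite [X in _ - fine X]esum1 // subr0.
Qed.

Lemma asumP f : (forall x, 0 <= f x) -> asum f ->
  (\esum_(x in [set: T]) (f x)%:E = (rsum [set: T] f)%:E)%E.
Proof. by move=> f0 sf; rewrite rsum_ge0E // -esum_ge0_fin. Qed.

Lemma asum_pos f : asum f -> asum (fun x => Num.max (f x) 0).
Proof.
by apply: asum_le => x; rewrite /Num.max; case: ifP => // _; rewrite normr0.
Qed.

Lemma asumN f : asum f -> asum (fun x => - f x).
Proof. by apply: asum_le => x; rewrite normrN. Qed.

Lemma asum_neg f : asum f -> asum (fun x => Num.max (- f x) 0).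
Proof. by move=> /asumN /asum_pos. Qed.

Lemma asum_norm f : asum f -> asum (fun x => `|f x|).
Proof. by apply: asum_le => x; rewrite normr_id. Qed.

Lemma asumD f g : asum f -> asum g -> asum (fun x => f x + g x).
Proof.
move=> sf sg; have : (\esum_(x in [set: T]) (`|f x|%:E + `|g x|%:E) < +oo)%E.
  by rewrite esumD; [exact: lte_add_pinfty|move=> *; rewrite lee_fin..].
by apply: le_lt_trans; apply: le_esum => x _; rewrite -EFinD lee_fin ler_normD.
Qed.

Lemma esumZ (c : R) f : 0 <= c -> (forall x, 0 <= f x) ->
  (\esum_(x in [set: T]) (c * f x)%:E = c%:E * \esum_(x in [set: T]) (f x)%:E)%E.
Proof.
move=> c0 f0; rewrite /esum -ereal_supZl //; last first.
  by apply/set0P; exists 0%E; exists set0; [exact: fsets_set0|rewrite fsbig_set0].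
congr (ereal_sup _); apply/seteqP; split=> [_ [A [fA _] <-]|_ [_ [A [fA _] <-] <-]].
  exists (\sum_(x \in A) (f x)%:E)%E; first by exists A.
  by rewrite ge0_mule_fsumr; [apply: eq_fsbigr|move=> x; rewrite lee_fin].
by exists A => //; rewrite ge0_mule_fsumr; [apply: eq_fsbigr|move=> x; rewrite lee_fin].
Qed.

Lemma asumZ (c : R) f : asum f -> asum (fun x => c * f x).
Proof.
move=> sf; rewrite /asum.
under eq_esum => x _ do rewrite normrM.
rewrite esumZ //; have := @esum_ge0_fin (fun x => `|f x|).
by move=> -> //; [rewrite -EFinM ltry|exact: asum_norm].
Qed.

Lemma asumZr (c : R) f : asum f -> asum (fun x => f x * c).
Proof. by move=> /(asumZ c); apply: asum_le => x; rewrite mulrC. Qed.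

Lemma asumB f g : asum f -> asum g -> asum (fun x => f x - g x).
Proof. by move=> sf /asumN sg; exact: asumD. Qed.

Lemma asum0 : asum (fun _ : T => 0).
Proof. by rewrite /asum esum1 // => x _; rewrite normr0. Qed.

Lemma eq_rsum (S : set T) f g : (forall x, S x -> f x = g x) -> rsum S f = rsum S g.
Proof.
by move=> fg; rewrite /rsum; congr (fine _ - fine _); apply: eq_esum => x Sx; rewrite fg.
Qed.

(** Positive and negative parts are not additive, but max(f - g, 0) + g = max(g - f, 0) + f
    pointwise; this turns the claim into one about sums of nonnegative families. *)
Lemma rsum_sub_ge0 f g : (forall x, 0 <= f x) -> (forall x, 0 <= g x) ->
  asum f -> asum g -> rsum [set: T] (fun x => f x - g x) =
  rsum [set: T] f - rsum [set: T] g.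
Proof.
move=> f0 g0 sf sg; have sd := asumB sf sg.
rewrite {1}/rsum; set a := (X in fine X - _); set b := (X in _ - fine X).
have ea : a = (rsum [set: T] (fun x => Num.max (f x - g x) 0))%:E.
  by apply: asumP; [move=> x; rewrite le_max lexx orbT|exact: asum_pos].
have eb : b = (rsum [set: T] (fun x => Num.max (- (f x - g x)) 0))%:E.
  by apply: asumP; [move=> x; rewrite le_max lexx orbT|exact: asum_neg].
have : (a + \esum_(x in [set: T]) (g x)%:E = b + \esum_(x in [set: T]) (f x)%:E)%E.
  rewrite -!esumD; do ?by move=> x _; rewrite lee_fin ?le_max ?lexx ?orbT.
  apply: eq_esum => x _; rewrite -!EFinD; congr (_%:E).
  by rewrite /Num.max; do 2 case: ifPn; rewrite -?leNgt; lra.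
rewrite ea eb !asumP // -!EFinD => -[] /=; lra.
Qed.

Lemma rsumE f : rsum [set: T] f =
  rsum [set: T] (fun x => Num.max (f x) 0) - rsum [set: T] (fun x => Num.max (- f x) 0).
Proof.
have m0 (h : T -> R) x : 0 <= Num.max (h x) 0 by rewrite le_max lexx orbT.
by rewrite (rsum_ge0E (m0 f)) (rsum_ge0E (m0 (fun x => - f x))).
Qed.

Lemma rsumD_ge0 f g : (forall x, 0 <= f x) -> (forall x, 0 <= g x) ->
  asum f -> asum g -> rsum [set: T] (fun x => f x + g x) =
  rsum [set: T] f + rsum [set: T] g.
Proof.
move=> f0 g0 sf sg; rewrite [LHS]rsum_ge0E; last by move=> x; rewrite addr_ge0.
under eq_esum do rewrite EFinD.
by rewrite esumD; [rewrite !asumP|move=> x _; rewrite lee_fin..].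
Qed.

Lemma rsumD f g : asum f -> asum g ->
  rsum [set: T] (fun x => f x + g x) = rsum [set: T] f + rsum [set: T] g.
Proof.
move=> sf sg.
have m0 h x : 0 <= Num.max (h x) 0 :> R by rewrite le_max lexx orbT.
have -> : (fun x => f x + g x) = (fun x => (Num.max (f x) 0 + Num.max (g x) 0) -
    (Num.max (- f x) 0 + Num.max (- g x) 0)).
  by apply/funext => x; rewrite /Num.max; do 4 case: ifPn; rewrite -?leNgt; lra.
have [sf1 sf2] := (asum_pos sf, asum_neg sf); have [sg1 sg2] := (asum_pos sg, asum_neg sg).
rewrite rsum_sub_ge0; do ?by [move=> x; apply: addr_ge0|apply: asumD].
by rewrite !rsumD_ge0 // (rsumE f) (rsumE g); lra.
Qed.

Lemma rsumN f : rsum [set: T] (fun x => - f x) = - rsum [set: T] f.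
Proof.
rewrite /rsum opprB; congr (_ - fine _).
by apply: eq_esum => x _; rewrite opprK.
Qed.

Lemma rsumB f g : asum f -> asum g ->
  rsum [set: T] (fun x => f x - g x) = rsum [set: T] f - rsum [set: T] g.
Proof. by move=> sf sg; rewrite rsumD ?rsumN //; exact: asumN. Qed.

Lemma rsumZ (c : R) f : rsum [set: T] (fun x => c * f x) = c * rsum [set: T] f.
Proof.
wlog c0 : c f / 0 <= c => [hw|].
  have [/hw//|/ltW c0] := leP 0 c.
  have := hw (- c) (fun x => - f x); rewrite oppr_ge0 rsumN mulrNN => <- //.
  by apply: eq_rsum => x _; rewrite mulrNN.
have mZ (h : T -> R) x : Num.max (c * h x) 0 = c * Num.max (h x) 0.
  by rewrite maxr_pMr // mulr0.
rewrite /rsum mulrBr.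
under eq_esum do rewrite mZ.
under [X in _ - fine X]eq_esum do rewrite -mulrN (mZ (fun x => - f x)).
have esZ (h : T -> R) : (forall x, 0 <= h x) -> fine (\esum_(x in [set: T]) (c * h x)%:E) =
   c * fine (\esum_(x in [set: T]) (h x)%:E).
  move=> h0; rewrite esumZ //.
  have [->|cn0] := eqVneq c 0; first by rewrite mul0e mul0r.
  have cp : (0 < c%:E)%E by rewrite lte_fin lt_def cn0.
  (* An infinite sum stays infinite under multiplication by c > 0, and [fine] sends it to 0 on both
     sides; divergent families thus satisfy the identity as well. *)
  move: (esum _ _) => [r||]; first by [].
    by rewrite (gt0_muley cp) mulr0.
  by rewrite (gt0_muleNy cp) mulr0.
have m0 (h : T -> R) x : 0 <= Num.max (h x) 0 by rewrite le_max lexx orbT.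
by rewrite (esZ _ (m0 f)) (esZ _ (m0 (fun x => - f x))).
Qed.

Lemma rsumZr (c : R) f : rsum [set: T] (fun x => f x * c) = rsum [set: T] f * c.
Proof. by rewrite mulrC -rsumZ; apply: eq_rsum => x _; rewrite mulrC. Qed.

Lemma rsum0 : rsum [set: T] (fun _ => 0 : R) = 0.
Proof. by rewrite rsum_ge0E // esum1. Qed.

Lemma rsum_ge0 f : (forall x, 0 <= f x) -> 0 <= rsum [set: T] f.
Proof.
by move=> f0; rewrite rsum_ge0E // fine_ge0 // esum_ge0 // => x _; rewrite lee_fin.
Qed.

Lemma ler_rsum f g : asum f -> asum g -> (forall x, f x <= g x) ->
  rsum [set: T] f <= rsum [set: T] g.
Proof.
move=> sf sg fg; rewrite -subr_ge0 -rsumB // rsum_ge0 // => x.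
by rewrite subr_ge0.
Qed.

Lemma ler_norm_rsum f g : asum g -> (forall x, `|f x| <= g x) ->
  `|rsum [set: T] f| <= rsum [set: T] g.
Proof.
move=> sg fg; have g0 x : 0 <= g x by apply: le_trans (fg x).
have sf : asum f by apply: asum_le sg => x; rewrite (ger0_norm (g0 x)).
by rewrite ler_norml -rsumN !ler_rsum //;
  [move=> x; have := fg x; rewrite ler_norml => /andP[]|exact: asumN|
   move=> x; have := fg x; rewrite ler_norml => /andP[]].
Qed.

Lemma asum_bound f g : asum g -> (forall x, `|f x| <= g x) -> asum f.
Proof. by move=> sg fg; apply: asum_le sg => x; rewrite (le_trans (fg x)) ?ler_norm. Qed.

Lemma rsum_mkcond (S : set T) f :
  rsum S f = rsum [set: T] (fun x => if x \in S then f x else 0).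
Proof.
rewrite /rsum; congr (fine _ - fine _); rewrite esum_mkcond; apply: eq_esum => x _;
  by case: ifP => // _; rewrite ?oppr0 maxxx.
Qed.

Lemma asum_sum (I : Type) (r : seq I) (P : pred I) (F : I -> T -> R) :
  (forall i, P i -> asum (F i)) -> asum (fun x => \sum_(i <- r | P i) F i x).
Proof.
move=> sF; elim: r => [|i r IH].
  by apply: asum_le asum0 => x; rewrite big_nil.
case Pi : (P i); last by apply: asum_le IH => x; rewrite big_cons Pi.
by apply: asum_le (asumD (sF i Pi) IH) => x; rewrite big_cons Pi.
Qed.

Lemma rsum_sum (I : Type) (r : seq I) (P : pred I) (F : I -> T -> R) :
  (forall i, P i -> asum (F i)) ->
  rsum [set: T] (fun x => \sum_(i <- r | P i) F i x) =
  \sum_(i <- r | P i) rsum [set: T] (F i).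
Proof.
move=> sF; elim: r => [|i r IH].
  by rewrite big_nil -[RHS]rsum0; apply: eq_rsum => x _; rewrite big_nil.
rewrite big_cons -IH; case: ifP => Pi.
  rewrite -rsumD; [|exact: sF|exact: asum_sum].
  by apply: eq_rsum => x _; rewrite big_cons Pi.
by apply: eq_rsum => x _; rewrite big_cons Pi.
Qed.

End OneType.

Lemma reindex_rsum (T T' : choiceType) (S : set T) (S' : set T') (e : T -> T') (f : T' -> R) :
  set_bij S S' e -> rsum S' f = rsum S (fun x => f (e x)).
Proof. by move=> be; rewrite /rsum !(reindex_esum _ _ _ _ be). Qed.

Lemma reindex_asum (T T' : choiceType) (e : T -> T') (f : T' -> R) :
  set_bij [set: T] [set: T'] e -> asum f <-> asum (fun x => f (e x)).
Proof. by move=> be; rewrite /asum !(reindex_esum _ _ _ _ be). Qed.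

Lemma asum_inj (T T' : choiceType) (e : T -> T') (f : T' -> R) :
  injective e -> asum f -> asum (fun x => f (e x)).
Proof.
move=> ie; apply: le_lt_trans.
have be : set_bij [set: T] (range e) e by apply: inj_bij => x y _ _ /ie.
rewrite -(reindex_esum _ _ _ (fun t => `|f t|%:E) be) esum_mkcond; apply: le_esum => t _.
by case: ifP => // _; rewrite lee_fin.
Qed.

Lemma bij_setT (T T' : Type) (e : T -> T') : bijective e -> set_bij [set: T] [set: T'] e.
Proof.
move=> [e' k k']; split => [//|x y _ _ /(can_inj k)//|y _ /=].
by exists (e' y).
Qed.

Section Fubini.
Variables T1 T2 : choiceType.
Implicit Types F : T1 * T2 -> R.

Lemma esum_prod F : (forall t, 0 <= F t) ->
  (\esum_(t in [set: T1 * T2]) (F t)%:E =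
   \esum_(t1 in [set: T1]) \esum_(t2 in [set: T2]) (F (t1, t2))%:E)%E.
Proof.
move=> F0; rewrite (@esum_esum R T1 T2 setT (fun=> setT) (fun t1 t2 => (F (t1, t2))%:E)).
  have -> : [set: T1] `*`` (fun=> [set: T2]) = [set: T1 * T2] by apply/seteqP; split.
  by apply: eq_esum => -[].
by move=> *; rewrite lee_fin.
Qed.

Lemma asum_slice F t1 : asum F -> asum (fun t2 => F (t1, t2)).
Proof. by apply: asum_inj => x y []. Qed.

Lemma rsum_prod_ge0 F : (forall t, 0 <= F t) -> asum F ->
  asum (fun t1 => rsum [set: T2] (fun t2 => F (t1, t2))) /\
  rsum [set: T1 * T2] F = rsum [set: T1] (fun t1 => rsum [set: T2] (fun t2 => F (t1, t2))).
Proof.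
move=> F0 sF; have s2 t1 := asum_slice t1 sF.
have r0 t1 : 0 <= rsum [set: T2] (fun t2 => F (t1, t2)) by exact: rsum_ge0.
have E : (\esum_(t in [set: T1 * T2]) (F t)%:E =
   \esum_(t1 in [set: T1]) (rsum [set: T2] (fun t2 => F (t1, t2)))%:E)%E.
  by rewrite esum_prod //; apply: eq_esum => t1 _; rewrite asumP.
split; last by rewrite (rsum_ge0E F0) (rsum_ge0E r0) E.
rewrite /asum; under eq_esum => t _ do rewrite (ger0_norm (r0 t)).
by rewrite -E asumP // ltry.
Qed.

Lemma rsum_prod F : asum F ->
  asum (fun t1 => rsum [set: T2] (fun t2 => F (t1, t2))) /\
  rsum [set: T1 * T2] F = rsum [set: T1] (fun t1 => rsum [set: T2] (fun t2 => F (t1, t2))).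
Proof.
move=> sF.
have m0 (h : T1 * T2 -> R) t : 0 <= Num.max (h t) 0 by rewrite le_max lexx orbT.
have [a1 e1] := rsum_prod_ge0 (m0 F) (asum_pos sF).
have [a2 e2] := rsum_prod_ge0 (m0 (fun t => - F t)) (asum_neg sF).
have E : (fun t1 => rsum [set: T2] (fun t2 => F (t1, t2))) =
   (fun t1 => rsum [set: T2] (fun t2 => Num.max (F (t1, t2)) 0) -
              rsum [set: T2] (fun t2 => Num.max (- F (t1, t2)) 0)).
  by apply/funext => t1; rewrite [LHS]rsumE.
split; first by rewrite E; exact: asumB.
by rewrite E rsumB // -e1 -e2 -rsumE.
Qed.

Lemma asum_prod (f : T1 -> R) (g : T2 -> R) : asum f -> asum g ->
  asum (fun t => f t.1 * g t.2).
Proof.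
move=> sf sg; rewrite /asum.
rewrite (@esum_prod (fun t => `|f t.1 * g t.2|)) //=.
under eq_esum => t1 _.
  under eq_esum => t2 _ do rewrite normrM.
  rewrite esumZ // asumP //; last exact: asum_norm.
  rewrite -EFinM mulrC; over.
rewrite esumZ //; last by apply: rsum_ge0.
by rewrite asumP; [rewrite -EFinM ltry| |exact: asum_norm].
Qed.

End Fubini.

Lemma asum_finite (T : finType) (f : T -> R) : asum f.
Proof.
rewrite /asum esum_fset //; first by rewrite fsbig_finite //= sumEFin ltry.
exact: finite_finset.
Qed.

Lemma rsum_finite (T : finType) (f : T -> R) : rsum [set: T] f = \sum_t f t.
Proof.
have E (h : T -> R) : (forall t, 0 <= h t) -> rsum [set: T] h = \sum_t h t.
  move=> h0; rewrite rsum_ge0E // esum_fset; [|exact: finite_finset|by move=> i _; rewrite lee_fin].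
  rewrite (fsbigE (index_enum T)) ?index_enum_uniq //; last by move=> i; rewrite mem_index_enum.
  by rewrite (eq_bigl xpredT) ?sumEFin // => i; rewrite in_setT.
rewrite rsumE !E; do ?by move=> t; rewrite le_max lexx orbT.
rewrite -sumrB; apply: eq_bigr => t _.
by rewrite /Num.max; do 2 case: ifPn; rewrite -?leNgt; lra.
Qed.

End Summation.

(** * Summable weights on integer vectors and matrices *)

Section IntegerWeights.
Variable R : realType.

(** Weights of vectors and matrices will be products of these rather than norms: summability of
    inverse squares then reduces to one dimension, and a product of factors that are at least 1
    still dominates each single coordinate. *)
Definition wint (z : int) : R := 1 + `|z%:~R|.

Lemma wint_ge1 z : 1 <= wint z.
Proof. by rewrite lerDl. Qed.

Lemma wint_gt0 z : 0 < wint z.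
Proof. exact: lt_le_trans (wint_ge1 z). Qed.

Lemma prodr_ge1 (I : Type) (r : seq I) (F : I -> R) :
  (forall i, 1 <= F i) -> 1 <= \prod_(i <- r) F i.
Proof.
by move=> F1; elim/big_rec: _ => // i x _ x1; rewrite -[1]mulr1 ler_pM.
Qed.

Lemma asum_nat_inv_sq : asum (fun k : nat => ((1 + k%:R) ^+ 2)^-1 : R).
Proof.
rewrite /asum -nneseries_esumT; last by [].
(* Telescoping bound: it is an equality for n = 0 and n = 1, and the induction step is 1/x^2 <= 2/x
   - 2/(x+1), valid for x = n + 1 >= 1. *)
suff H : forall n, \sum_(0 <= k < n) ((1 + k%:R) ^+ 2)^-1 <= 2 - 2 / n.+1%:R :> R.
  apply: (@le_lt_trans _ _ 2%:E); last exact: ltry.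
  apply: lime_le; first by apply: is_cvg_nneseries.
  near=> n; rewrite sumEFin lee_fin.
  under eq_bigr do rewrite ger0_norm ?invr_ge0 ?exprn_ge0 ?addr_ge0 //.
  by apply: le_trans (H n) _; rewrite gerBl divr_ge0.
elim=> [|n IH]; first by rewrite big_geq // invr1; lra.
rewrite big_nat_recr //=; apply: le_trans (lerD IH (lexx _)) _.
have n1 : 1 <= n.+1%:R :> R by rewrite ler1n.
rewrite nat1r -[n.+2%:R]natr1; move: (n.+1%:R) n1 => x x1.
have x0 : 0 < x by lra.
rewrite -subr_ge0.
have -> : 2 - 2 / (x + 1) - (2 - 2 / x + (x ^+ 2)^-1) = (x - 1) / (x ^+ 2 * (x + 1)).
  by field; rewrite !gt_eqF ?addr_gt0.
by rewrite divr_ge0 ?mulr_ge0 ?exprn_ge0 //; lra.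
Unshelve. all: by end_near. Qed.

Lemma asum_wint : asum (fun z => (wint z ^+ 2)^-1).
Proof.
pose e (t : bool * nat) := if t.1 then Posz t.2 else Negz t.2.
have be : bijective e.
  exists (fun z => match z with Posz k => (true, k) | Negz k => (false, k) end).
    by move=> [[] k].
  by case.
apply/(reindex_asum _ (bij_setT be)).
apply: asum_bound (asum_prod (asum_finite (fun _ : bool => 1)) asum_nat_inv_sq) _.
move=> [b k] /=; rewrite mul1r ger0_norm ?invr_ge0 ?exprn_ge0 ?(ltW (wint_gt0 _)) //.
rewrite lef_pV2 ?posrE ?exprn_gt0 ?wint_gt0 // ?ltr_pwDl //.
rewrite lerXn2r ?nnegrE ?addr_ge0 ?(ltW (wint_gt0 _)) // lerD2l /e /=; case: b.
  by rewrite ger0_norm.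
by rewrite NegzE rmorphN /= normrN ger0_norm ?ler_nat.
Qed.

Definition wrow n (z : 'rV[int]_n) : R := \prod_i wint (z 0 i).

Lemma wrow_ge1 n (z : 'rV_n) : 1 <= wrow z.
Proof. by apply: prodr_ge1 => i; exact: wint_ge1. Qed.

Lemma consr_bij n :
  bijective (fun t : int * 'rV[int]_n => row_mx (t.1%:M : 'rV_1) t.2 : 'rV_(1 + n)).
Proof.
exists (fun z : 'rV[int]_(1 + n) => (lsubmx z 0 0, rsubmx z)) => [[a z]|z] /=.
  by rewrite row_mxKr row_mxKl mxE eqxx mulr1n.
by rewrite -[RHS]hsubmxK -mx11_scalar.
Qed.

Lemma wrow_cons n (t : int * 'rV[int]_n) :
  wrow (row_mx (t.1%:M : 'rV_1) t.2 : 'rV_(1 + n)) = wint t.1 * wrow t.2.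
Proof.
rewrite /wrow big_split_ord big_ord1 /=; congr (wint _ * _).
  by rewrite row_mxEl mxE eqxx.
by apply: eq_bigr => i _; rewrite row_mxEr.
Qed.

Lemma asum_wrow n : asum (fun z : 'rV[int]_n => (wrow z ^+ 2)^-1).
Proof.
elim: n => [|n IH].
  have be : bijective (fun _ : unit => 0 : 'rV[int]_0).
    by exists (fun=> tt) => [[]//|z]; apply/rowP => -[].
  by apply/(reindex_asum _ (bij_setT be)); exact: asum_finite.
apply/(reindex_asum _ (bij_setT (consr_bij n))).
apply: asum_le (asum_prod asum_wint IH) => -[a z] /=.
by rewrite (wrow_cons (a, z)) exprMn invfM.
Qed.

Definition wmx m n (Z : 'M[int]_(m, n)) : R := \prod_i \prod_j wint (Z i j).

Lemma wmx_ge1 m n (Z : 'M[int]_(m, n)) : 1 <= wmx Z.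
Proof. by apply: prodr_ge1 => i; apply: prodr_ge1 => j; exact: wint_ge1. Qed.

Lemma asum_wmx m n : asum (fun Z : 'M[int]_(m, n) => (wmx Z ^+ 2)^-1).
Proof.
have be : bijective (@vec_mx int m n) by exists mxvec; [exact: vec_mxK|exact: mxvecK].
apply/(reindex_asum _ (bij_setT be)); apply: asum_le (asum_wrow (m * n)) => z /=.
rewrite /wmx /wrow pair_big /= (reindex _ (curry_mxvec_bij m n)) /=.
rewrite (eq_bigr (fun j => wint (z 0 (uncurry (@mxvec_index m n) j)))) // => -[i j] _.
by rewrite mxE.
Qed.

End IntegerWeights.

(** * Termwise differentiation *)

Section Calculus.
Variable R : realType.

(** A quadratic remainder yields differentiability and the value of the derivative at once. Series,
    extensions by 0 across the boundary and the quadratic form in the chart are all differentiated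
    in this way. *)
Lemma is_derive_quadratic (E : normedModType R) (F : E -> R) (x v : E) (l C r : R) :
  0 < r -> (forall h, `|h| <= r -> `|F (h *: v + x) - F x - h * l| <= C * h ^+ 2) ->
  is_derive x v F l.
Proof.
move=> r0 H.
have cv : h^-1 *: ((F \o shift x) (h *: v) - F x) @[h --> (0 : R)^'] --> l.
  apply/cvgrPdist_le => eps e0; near=> h.
  have h0 : h != 0 by near: h; exact: nbhs_dnbhs_neq.
  have hr : `|h| <= r.
    by near: h; apply: (@dnbhs0_le R R).
  have hC : `|h| <= eps / (1 + `|C|).
    by near: h; apply: (@dnbhs0_le R R); rewrite divr_gt0 // ltr_pwDl.
  have -> : l - h^-1 *: ((F \o shift x) (h *: v) - F x) =
            - (h^-1 * (F (h *: v + x) - F x - h * l)).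
    by rewrite /= /GRing.scale /=; field.
  rewrite normrN normrM normfV ler_pdivrMl ?normr_gt0 //.
  apply: le_trans (H h hr) _; rewrite -real_normK ?num_real //.
  have C1 : C <= 1 + `|C| by rewrite (le_trans (ler_norm _)) // lerDr.
  apply: le_trans (ler_wpM2r (exprn_ge0 2 (normr_ge0 h)) C1) _.
  rewrite expr2 mulrCA ler_wpM2l //.
  by rewrite -ler_pdivlMl ?ltr_pwDl // mulrC.
split; first by apply/cvg_ex; exists l.
exact: cvg_lim cv.
Unshelve. all: by end_near. Qed.

(** Restricts directional derivatives to lines, where the mean value theorem of one variable
    applies. *)
Lemma is_derive_lineP (E : normedModType R) (F : E -> R) (x v : E) (t d : R) :
  is_derive (t *: v + x) v F d <-> is_derive t 1 (fun t => F (t *: v + x)) d.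
Proof.
have E1 : (fun h : R => h^-1 *: (((fun t => F (t *: v + x)) \o shift t) (h *: 1) - F (t *: v + x)))
   = (fun h : R => h^-1 *: ((F \o shift (t *: v + x)) (h *: v) - F (t *: v + x))).
  apply/funext => h /=; rewrite addrA -scalerDl; congr (_ *: (F (_ *: _ + _) - _)).
  by rewrite /GRing.scale /= mulr1.
by split; case=> d1 d2; split; move: d1 d2; rewrite /derivable /derive E1.
Qed.

Section PointwiseDerivatives.
Variables (E : normedModType R) (x v : E).
Implicit Types f g : E -> R.

Lemma is_derive_mul f g df dg : is_derive x v f df -> is_derive x v g dg ->
  is_derive x v (fun y => f y * g y) (df * g x + f x * dg).
Proof.
move=> Df Dg; apply: (is_derive_eq (is_deriveM Df Dg)).
by rewrite /GRing.scale /=; ring.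
Qed.

Lemma is_derive_add f g df dg : is_derive x v f df -> is_derive x v g dg ->
  is_derive x v (fun y => f y + g y) (df + dg).
Proof. exact: is_deriveD. Qed.

Lemma is_derive_const (c : R) : is_derive x v (fun _ => c) 0.
Proof. exact: is_derive_cst. Qed.

Lemma is_derive_mulc f df (c : R) : is_derive x v f df ->
  is_derive x v (fun y => f y * c) (df * c).
Proof.
by move=> Df; apply: (is_derive_eq (is_derive_mul Df (is_derive_const c))); rewrite mulr0 addr0.
Qed.

Lemma is_derive_comp1 (g : R -> R) f dg df : is_derive (f x) 1 g dg -> is_derive x v f df ->
  is_derive x v (fun y => g (f y)) (df * dg).
Proof.
have e0 : x = (0 : R) *: v + x by rewrite scale0r add0r.
rewrite {1 2}e0 => Dg /is_derive_lineP Df; rewrite e0; apply/is_derive_lineP.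
by apply: (is_derive_eq (@is_derive1_comp _ g (fun t => f (t *: v + x)) _ _ _ Dg Df)); rewrite /GRing.scale /= mulrC.
Qed.

Lemma is_derive_exp f df : is_derive x v f df ->
  is_derive x v (fun y => expR (f y)) (df * expR (f x)).
Proof. by move=> Df; apply: is_derive_comp1. Qed.

End PointwiseDerivatives.

Lemma MVT_abs (f df : R -> R) (a b M : R) :
  (forall t, `|t - a| <= `|b - a| -> is_derive t 1 f (df t)) ->
  (forall t, `|t - a| <= `|b - a| -> `|df t| <= M) ->
  `|f b - f a| <= M * `|b - a|.
Proof.
move=> H1 H2.
have cont t : `|t - a| <= `|b - a| -> {for t, continuous f}.
  move=> /H1 [/derivable1_diffP d _]; exact: differentiable_continuous.
have inab c (ab : a <= b) : c \in `[a, b] -> `|c - a| <= `|b - a|.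
  rewrite in_itv /= => /andP[c1 c2]; rewrite !ger0_norm ?subr_ge0 // lerD2r //.
have inba c (ba : b <= a) : c \in `[b, a] -> `|c - a| <= `|b - a|.
  by rewrite in_itv /= => /andP[c1 c2]; rewrite !ler0_norm ?subr_le0 // lerN2 lerD2r.
have [ab|/ltW ba] := leP a b.
  have [||c ci ->] := @MVT_segment R f df a b ab.
  - by move=> x /subset_itv_oo_cc xi; apply: H1; exact: inab.
  - by apply: continuous_in_subspaceT => x /set_mem /= xi; apply: cont; exact: inab.
  - by rewrite normrM ler_wpM2r //; apply: H2; exact: inab.
have [||c ci e] := @MVT_segment R f df b a ba.
- by move=> x /subset_itv_oo_cc xi; apply: H1; exact: inba.
- by apply: continuous_in_subspaceT => x /set_mem /= xi; apply: cont; exact: inba.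
- by rewrite distrC e normrM (distrC a) ler_wpM2r //; apply: H2; exact: inba.
Qed.

Lemma taylor1_abs (f f1 f2 : R -> R) (a b M : R) :
  (forall t, `|t - a| <= `|b - a| ->
     [/\ is_derive t 1 f (f1 t), is_derive t 1 f1 (f2 t) & `|f2 t| <= M]) ->
  `|f b - f a - (b - a) * f1 a| <= M * (b - a) ^+ 2.
Proof.
move=> H.
(* The mean value inequality is applied to t -> f t - t f1(a), whose derivative f1 t - f1 a is in
   turn at most M |t - a|; this is why the constant is M and not M/2. *)
have -> : f b - f a - (b - a) * f1 a = (f b - b * f1 a) - (f a - a * f1 a) by ring.
rewrite -real_normK ?num_real // expr2 mulrA.
apply: (@MVT_abs (fun t => f t - t * f1 a) (fun t => f1 t - f1 a)) => t tab.
  have [d1 _ _] := H t tab.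
  apply: is_deriveB.
  by apply: is_derive_eq (is_derive_mulc _ (is_derive_id _ _)) _; rewrite mul1r.
have M0 : 0 <= M by have [_ _ /(le_trans (normr_ge0 _))] := H _ tab.
apply: le_trans (_ : M * `|t - a| <= _); last exact: ler_wpM2l.
by apply: MVT_abs (f2) _ _ _ _ _ => u /le_trans /(_ tab) /H[].
Qed.

(** A summable bound on the second derivatives takes the place of uniform convergence: the Taylor
    remainders of the terms add up to a quadratic remainder of the sum. *)
Lemma is_derive_rsum (T : choiceType) (f f1 f2 : T -> R -> R) (M : T -> R) (a r : R) :
  0 < r -> asum M -> asum (fun X => f X a) -> asum (fun X => f1 X a) ->
  (forall X t, `|t - a| <= r ->
     [/\ is_derive t 1 (f X) (f1 X t), is_derive t 1 (f1 X) (f2 X t) & `|f2 X t| <= M X]) ->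
  is_derive a 1 (fun t => rsum [set: T] (f ^~ t)) (rsum [set: T] (f1 ^~ a)).
Proof.
move=> r0 sM sf sf1 H.
have Q X h : `|h| <= r -> `|f X (h + a) - f X a - h * f1 X a| <= M X * h ^+ 2.
  move=> hr; have := @taylor1_abs (f X) (f1 X) (f2 X) a (h + a) (M X).
  by rewrite addrK; apply => t th; apply: H; exact: le_trans th hr.
apply: (@is_derive_quadratic _ _ _ _ _ (rsum [set: T] M) r) => // h hr.
have sd : asum (fun X => f X (h + a) - f X a - h * f1 X a).
  by apply: asum_bound (asumZr (h ^+ 2) sM) _ => X; exact: Q.
have sh : asum (fun X => f X (h + a)).
  apply: asum_le (asumD sd (asumD sf (asumZ h sf1))) => X.
  by rewrite le_eqVlt; apply/orP; left; apply/eqP; congr `|_|; ring.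
rewrite /GRing.scale /= mulr1 -rsumB // -rsumZ -rsumB; [|exact: asumB|exact: asumZ].
by rewrite -rsumZr; apply: ler_norm_rsum; [exact: asumZr|move=> X; exact: Q].
Qed.

End Calculus.

Section TermwiseSeries.
Variables (R : realType) (d : nat) (T : choiceType) (N : T -> R).
Hypothesis N_ge1 : forall X, 1 <= N X.
Hypothesis N_asum : asum (fun X => (N X ^+ 2)^-1).

Let E : normedModType R := (R * 'rV[R]_d)%type.

Lemma is_derive_linear (V : normedModType R) (F : V -> R) (x v : V) :
  (forall a y z, F (a *: y + z) = a * F y + F z) -> is_derive x v F (F v).
Proof.
move=> FL; apply: (@is_derive_quadratic _ _ _ _ _ _ 0 1) => // h _.
by rewrite FL mul0r addrK subrr normr0.
Qed.

Lemma norm_fst_le (v : E) : `|v.1| <= `|v|.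
Proof. by rewrite prod_normE le_max lexx. Qed.

Lemma norm_snd_le (v : E) i : `|v.2 0 i| <= `|v|.
Proof.
rewrite prod_normE le_max; apply/orP; right; rewrite [leRHS]/Num.norm /= mx_normrE.
by apply/bigmax_geP; right => /=; exists (0, i).
Qed.

(** Measures the order of a pole at s = 0; adding 1 to 1/s keeps the base at least 1, so that its
    powers increase with the exponent. *)
Definition tpole (x : E) : R := 1 + x.1^-1.

Lemma tpole_ge1 x : 0 < x.1 -> 1 <= tpole x.
Proof. by move=> x0; rewrite lerDl invr_ge0 ltW. Qed.

(** The index makes a bound uniform over a family. With [I] the space of directions and [m] the norm
    it says that a directional derivative is bounded linearly in the direction, the form required by
    [tame_class]. *)
Definition grows (I : Type) (m : I -> R) (F : I -> T -> E -> R) : Prop :=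
  forall r : R, exists C, exists K : nat, 0 <= C /\ forall i X x, 0 < x.1 -> `|x| <= r ->
    `|F i X x| <= m i * (C * (tpole x * N X) ^+ K).

Lemma tN_ge1 x X : 0 < x.1 -> 1 <= tpole x * N X.
Proof. by move=> x0; rewrite -[1]mulr1 ler_pM // tpole_ge1. Qed.

Lemma growsD I (m : I -> R) F G : (forall i, 0 <= m i) -> grows m F -> grows m G ->
  grows m (fun i X x => F i X x + G i X x).
Proof.
move=> m0 HF HG r; have [C [K [C0 hF]]] := HF r; have [C' [K' [C'0 hG]]] := HG r.
exists (C + C'), (K + K')%N; split; first exact: addr_ge0.
move=> i X x x0 xr; apply: le_trans (ler_normD _ _) _.
rewrite mulrDl mulrDr; apply: lerD.
  apply: le_trans (hF _ _ _ x0 xr) _; rewrite !ler_wpM2l //.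
  by rewrite ler_weXn2l ?tN_ge1 // leq_addr.
apply: le_trans (hG _ _ _ x0 xr) _; rewrite !ler_wpM2l //.
by rewrite ler_weXn2l ?tN_ge1 // leq_addl.
Qed.

Lemma growsM I (m : I -> R) F G : (forall i, 0 <= m i) -> grows m F ->
  grows (fun _ : unit => 1) (fun _ => G) -> grows m (fun i X x => F i X x * G X x).
Proof.
move=> m0 HF HG r; have [C [K [C0 hF]]] := HF r; have [C' [K' [C'0 hG]]] := HG r.
exists (C * C'), (K + K')%N; split; first exact: mulr_ge0.
move=> i X x x0 xr; rewrite normrM.
have := hG tt X x x0 xr; rewrite mul1r => h1.
apply: le_trans (ler_pM _ _ (hF _ _ _ x0 xr) h1) _ => //.
by rewrite exprD le_eqVlt; apply/orP; left; apply/eqP; ring.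
Qed.

(* Polynomials in s, 1/s, y whose coefficients are functions of the summation
   index dominated by the weight N. *)
Inductive pol : (T -> E -> R) -> Prop :=
| pol_idx a C : (forall X, `|a X| <= C * N X) -> pol (fun X _ => a X)
| pol_s : pol (fun _ x => x.1)
| pol_sV : pol (fun _ x => x.1^-1)
| pol_y i : pol (fun _ x => x.2 0 i)
| pol_add P Q : pol P -> pol Q -> pol (fun X x => P X x + Q X x)
| pol_mul P Q : pol P -> pol Q -> pol (fun X x => P X x * Q X x).

Lemma pol_const c : pol (fun _ _ => c).
Proof. by apply: (@pol_idx _ `|c|) => X; rewrite ler_peMr. Qed.

Lemma pol_opp P : pol P -> pol (fun X x => - P X x).
Proof.
move=> pP; have := pol_mul (pol_const (-1)) pP; congr pol.
by apply/funext => X; apply/funext => x; rewrite mulN1r.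
Qed.

Lemma pol_sum I (r : seq I) (p : pred I) (F : I -> T -> E -> R) :
  (forall i, pol (F i)) -> pol (fun X x => \sum_(i <- r | p i) F i X x).
Proof.
move=> pF; elim: r => [|i r IH].
  by have := pol_const 0; congr pol; apply/funext => X; apply/funext => x; rewrite big_nil.
have [pi|npi] := boolP (p i).
  have := pol_add (pF i) IH; congr pol.
  by apply/funext => X; apply/funext => x; rewrite big_cons pi.
by move: IH; congr pol; apply/funext => X; apply/funext => x; rewrite big_cons (negbTE npi).
Qed.

Lemma pol_prod I (r : seq I) (F : I -> T -> E -> R) :
  (forall i, pol (F i)) -> pol (fun X x => \prod_(i <- r) F i X x).
Proof.
move=> pF; elim: r => [|i r IH].
  by have := pol_const 1; congr pol; apply/funext => X; apply/funext => x; rewrite big_nil.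
have := pol_mul (pF i) IH; congr pol.
by apply/funext => X; apply/funext => x; rewrite big_cons.
Qed.

Lemma pol_grows P : pol P -> grows (fun _ : unit => 1) (fun _ => P).
Proof.
have w1 x X : 0 < x.1 -> 1 <= tpole x * N X by exact: tN_ge1.
elim=> {P} [a C aC|||i|P Q _ hP _ hQ|P Q _ hP _ hQ].
- move=> r; exists `|C|, 1%N; split=> // _ X x x0 _; rewrite mul1r expr1.
  apply: le_trans (aC X) _; rewrite (le_trans (ler_wpM2r _ (ler_norm C))) //.
    by rewrite (le_trans _ (N_ge1 X)).
  by rewrite ler_wpM2l // ler_peMl ?tpole_ge1 // (le_trans _ (N_ge1 X)).
- move=> r; exists `|r|, 0%N; split=> // _ X x x0 xr; rewrite mul1r mulr1.
  by rewrite (le_trans (norm_fst_le x)) // (le_trans xr) // ler_norm.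
- move=> r; exists 1, 1%N; split=> // _ X x x0 xr; rewrite !mul1r expr1.
  rewrite ger0_norm ?invr_ge0 ?(ltW x0) //; apply: (@le_trans _ _ (tpole x)).
    by rewrite lerDr.
  by rewrite ler_peMr // (le_trans _ (tpole_ge1 x0)).
- move=> r; exists `|r|, 0%N; split=> // _ X x x0 xr; rewrite mul1r mulr1.
  by rewrite (le_trans (norm_snd_le x i)) // (le_trans xr) // ler_norm.
- exact: growsD.
- exact: growsM.
Qed.

Lemma grows0 : grows (@Num.norm R E) (fun _ _ _ => 0).
Proof. by move=> r; exists 0, 0%N; split=> // *; rewrite normr0 mul0r mulr0. Qed.

Lemma pol_derive P : pol P -> exists P' : E -> T -> E -> R,
  [/\ forall v, pol (P' v),
      forall v X (x : E), 0 < x.1 -> is_derive x v (P X) (P' v X x) & grows (@Num.norm R E) P'].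
Proof.
elim=> {P} [a C aC|||i|P Q pP [P' [h1 h2 h3]] pQ [Q' [k1 k2 k3]]|
   P Q pP [P' [h1 h2 h3]] pQ [Q' [k1 k2 k3]]].
- exists (fun _ _ _ => 0); split; [move=> _; exact: pol_const| |exact: grows0].
  by move=> v X x x0; exact: is_derive_const.
- exists (fun v _ _ => v.1); split=> [v|v X x x0|r]; first exact: pol_const.
    exact: (@is_derive_linear E fst).
  by exists 1, 0%N; split=> // v X x _ _; rewrite !mulr1; exact: norm_fst_le.
- exists (fun v _ x => - (v.1 * x.1^-1 * x.1^-1)); split=> [v|v X x x0|].
  + apply: pol_opp; apply: pol_mul; last exact: pol_sV.
    by apply: pol_mul; [exact: pol_const|exact: pol_sV].
  + have D1 : is_derive x v fst v.1 by exact: (@is_derive_linear E fst).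
    have D2 : is_derive (x.1 : R) 1 (@GRing.inv R) (- x.1 ^- 2).
      split; first by apply: derivableV => //; rewrite gt_eqF.
      have := @deriveV R R id x.1 1; rewrite gt_eqF // => -> //.
      by rewrite derive_id /GRing.scale /= mulr1.
    apply: is_derive_eq (is_derive_comp1 D2 D1) _; rewrite expr2 invfM; ring.
  + move=> r; exists 1, 2%N; split=> // v X x x0 xr; rewrite !mul1r normrN !normrM -mulrA.
    apply: ler_pM => //; first exact: norm_fst_le.
    rewrite expr2; have H : `|x.1^-1| <= tpole x * N X.
      rewrite ger0_norm ?invr_ge0 ?(ltW x0) //; apply: (@le_trans _ _ (tpole x)).
        by rewrite lerDr.
      by rewrite ler_peMr // (le_trans _ (tpole_ge1 x0)).
    exact: ler_pM.
- exists (fun (v : E) _ _ => v.2 0 i); split=> [v|v X x x0|r]; first exact: pol_const.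
    by apply: (@is_derive_linear E (fun x : E => x.2 0 i)) => a y z; rewrite !mxE.
  by exists 1, 0%N; split=> // v X x _ _; rewrite !mulr1; exact: norm_snd_le.
- exists (fun v X x => P' v X x + Q' v X x); split=> [v|v X x x0|].
  + exact: pol_add.
  + by apply: is_derive_add; [exact: h2|exact: k2].
  + exact: growsD.
- exists (fun v X x => P' v X x * Q X x + Q' v X x * P X x); split=> [v|v X x x0|].
  + by apply: pol_add; exact: pol_mul.
  + apply: is_derive_eq (is_derive_mul (h2 v X x x0) (k2 v X x x0)) _.
    by congr (_ + _); rewrite mulrC.
  + by apply: growsD => //; apply: growsM => //; exact: pol_grows.
Qed.

Variable q : T -> E -> R.
Hypothesis q_pol : pol q.
Hypothesis q_decay : forall (r : R) (k : nat), exists C, exists K : nat, 0 <= C /\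
  forall X (x : E), 0 < x.1 -> `|x| <= r -> expR (q X x) <= C * tpole x ^+ K / N X ^+ k.

Definition pterm (P : T -> E -> R) (X : T) (x : E) : R := P X x * expR (q X x).

Definition pseries (P : T -> E -> R) (x : E) : R := rsum [set: T] (fun X => pterm P X x).

Lemma grows_pterm I (m : I -> R) F : (forall i, 0 <= m i) -> grows m F ->
  forall r, exists C, exists K : nat, 0 <= C /\ forall i X x, 0 < x.1 -> `|x| <= r ->
    `|pterm (F i) X x| <= m i * (C * tpole x ^+ K) * (N X ^+ 2)^-1.
Proof.
move=> m0 HF r; have [C [K [C0 hF]]] := HF r.
(* K powers of the weight absorb the growth of [F]; the other two leave a summable majorant. *)
have [C' [K' [C'0 hq]]] := q_decay r (K + 2).
exists (C * C'), (K + K')%N; split; first exact: mulr_ge0.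
move=> i X x x0 xr; rewrite /pterm normrM (ger0_norm (expR_ge0 _)).
apply: le_trans (ler_pM _ _ (hF i X x x0 xr) (hq X x x0 xr)) _; [by []|exact: expR_ge0|].
have NX : N X != 0 by rewrite gt_eqF // (lt_le_trans _ (N_ge1 X)).
rewrite le_eqVlt; apply/orP; left; apply/eqP.
rewrite !exprD exprMn; field.
by rewrite NX expf_neq0.
Qed.

Lemma grows_pseries I (m : I -> R) F : (forall i, 0 <= m i) -> grows m F ->
  forall r, exists C, exists K : nat, 0 <= C /\ forall i x, 0 < x.1 -> `|x| <= r ->
    `|pseries (F i) x| <= m i * (C * tpole x ^+ K).
Proof.
move=> m0 HF r; have [C [K [C0 h]]] := grows_pterm m0 HF r.
set S := rsum [set: T] (fun X => (N X ^+ 2)^-1).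
have S0 : 0 <= S.
  by apply: rsum_ge0 => X; rewrite invr_ge0 exprn_ge0 // (le_trans _ (N_ge1 X)).
exists (C * S), K; split; first exact: mulr_ge0.
move=> i x x0 xr.
have -> : m i * (C * S * tpole x ^+ K) = (m i * (C * tpole x ^+ K)) * S by ring.
by rewrite /S -rsumZ; apply: ler_norm_rsum; [exact: asumZ|move=> X; exact: h].
Qed.

Lemma asum_pterm P x : pol P -> 0 < x.1 -> asum (fun X => pterm P X x).
Proof.
move=> /pol_grows pP x0.
have [C [K [C0 h]]] := grows_pterm (fun=> ler01) pP `|x|.
by apply: asum_bound (asumZ _ N_asum) _ => X; exact: h tt X x x0 (lexx _).
Qed.

(** The derivative of P exp q is (P' + q' P) exp q, again of this shape. The step is done twice
    because [is_derive_rsum] asks for a bound on second derivatives. *)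
Lemma pseries_derive P : pol P -> exists P' : E -> T -> E -> R,
  [/\ forall v, pol (P' v),
      forall v (x : E), 0 < x.1 -> is_derive x v (pseries P) (pseries (P' v) x) &
      grows (@Num.norm R E) P'].
Proof.
have main Q : pol Q -> exists Q' : E -> T -> E -> R,
  [/\ forall v, pol (Q' v),
      forall v X (x : E), 0 < x.1 -> is_derive x v (pterm Q X) (pterm (Q' v) X x) &
      grows (@Num.norm R E) Q'].
  move=> pQ; have [Q' [h1 h2 h3]] := pol_derive pQ; have [q' [k1 k2 k3]] := pol_derive q_pol.
  exists (fun v X x => Q' v X x + q' v X x * Q X x); split=> [v|v X x x0|].
  - by apply: pol_add => //; exact: pol_mul.
  - apply: is_derive_eq (is_derive_mul (h2 v X x x0) (is_derive_exp (k2 v X x x0))) _.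
    by rewrite /pterm; ring.
  - by apply: growsD => //; apply: growsM => //; exact: pol_grows.
move=> pP; have [P' [h1 h2 h3]] := main P pP; exists P'; split=> // v x x0.
have [P'' [k1 k2 k3]] := main _ (h1 v).
have e0 : x = (0 : R) *: v + x by rewrite scale0r add0r.
rewrite {1}e0; apply/is_derive_lineP.
have v0 : 0 < 1 + `|v| by rewrite ltr_pwDl.
(* Within this radius the first coordinate stays above half of x.1, which bounds [tpole] along the
   whole segment. *)
pose r := x.1 / (2 * (1 + `|v|)).
have r0 : 0 < r by rewrite divr_gt0 // mulr_gt0.
have rv : r * `|v| <= x.1 / 2.
  rewrite /r -mulrA ler_wpM2l ?(ltW x0) // mulrC ler_pdivrMr ?mulr_gt0 //.
  by rewrite mulrA mulVf // mul1r lerDr.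
have near_x t : `|t - 0| <= r -> x.1 / 2 <= (t *: v + x).1 /\ `|t *: v + x| <= x.1 / 2 + `|x|.
  rewrite subr0 => tr; have tv : `|t| * `|v| <= x.1 / 2.
    by apply: le_trans rv; rewrite ler_wpM2r.
  split; last by rewrite (le_trans (ler_normD _ _)) // lerD2r normrZ.
  have : `|(t *: v).1| <= x.1 / 2 by rewrite (le_trans (norm_fst_le _)) // normrZ.
  by rewrite ler_norml /= => /andP[] ? ?; lra.
have [C [K [C0 hC]]] := grows_pterm (fun v : E => normr_ge0 v) k3 (x.1 / 2 + `|x|).
pose M X := `|v| * (C * (1 + (x.1 / 2)^-1) ^+ K) * (N X ^+ 2)^-1.
apply: is_derive_eq (@is_derive_rsum R T (fun X t => pterm P X (t *: v + x))
  (fun X t => pterm (P' v) X (t *: v + x)) (fun X t => pterm (P'' v) X (t *: v + x)) M 0 r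
  r0 _ _ _ _) _.
- exact: asumZ.
- by apply: asum_pterm => //; rewrite -e0.
- by apply: asum_pterm => //; rewrite -e0.
- move=> X t /near_x[t1 t2].
  have y0 : 0 < (t *: v + x).1 by rewrite (lt_le_trans _ t1) // divr_gt0.
  split; [exact: (proj1 (@is_derive_lineP R E (pterm P X) x v t _) (h2 v X _ y0))|
          exact: (proj1 (@is_derive_lineP R E (pterm (P' v) X) x v t _) (k2 v X _ y0))|].
  apply: le_trans (hC v X _ y0 t2) _; rewrite /M ler_wpM2r //.
    by rewrite invr_ge0 exprn_ge0 // (le_trans _ (N_ge1 X)).
  rewrite !ler_wpM2l // lerXn2r ?nnegrE //.
  + by rewrite (le_trans _ (tpole_ge1 y0)).
  + by rewrite addr_ge0 // invr_ge0 divr_ge0 // ltW.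
  + by rewrite lerD2l lef_pV2 // posrE divr_gt0.
- by rewrite -e0.
Qed.

End TermwiseSeries.

(** * Extension of flat functions *)

Section FlatExtension.
Variables (R : realType) (d : nat).
Let E : normedModType R := (R * 'rV[R]_d)%type.
Implicit Types (f : E -> R) (x v : E) (Cl : set (E -> R)).

(** The derivatives may have poles of any order, but stay in the class. Flatness is deliberately not
    part of it: it is checked for one function and inherited by the derivatives through
    [flat_derive]. Linearity of the bound in v gives the Lipschitz estimate behind continuity. *)
Definition tame_class Cl : Prop := forall f, Cl f -> exists f' : E -> E -> R,
  [/\ forall v, Cl (f' v),
      forall v x, 0 < x.1 -> is_derive x v f (f' v x) &
      forall r, exists C, exists K : nat, 0 <= C /\ forall v x, 0 < x.1 -> `|x| <= r ->
        `|f' v x| <= `|v| * (C * tpole x ^+ K)].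

Definition flat f : Prop := forall (r : R) (k : nat), exists C, exists s0, [/\ 0 <= C, 0 < s0 &
  forall x, 0 < x.1 -> x.1 <= s0 -> `|x| <= r -> `|f x| <= C * x.1 ^+ k].

Lemma flatD f g : flat f -> flat g -> flat (fun x => f x + g x).
Proof.
move=> Hf Hg r k; have [C [s [C0 s0 h]]] := Hf r k; have [D [t [D0 t0 h']]] := Hg r k.
exists (C + D), (Num.min s t); split; [exact: addr_ge0|by rewrite lt_min s0|].
move=> x x0; rewrite le_min => /andP[xs xt] xr.
by rewrite (le_trans (ler_normD _ _)) // mulrDl lerD // ?h ?h'.
Qed.

Definition ext0 f x : R := if 0 < x.1 then f x else 0.

(* Interpolation: |f'| <= 2 sup |f| / h + h sup |f''| with h a large power of s. *)
Lemma flat_derive Cl f f1 v : tame_class Cl -> Cl f1 ->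
  (forall x, 0 < x.1 -> is_derive x v f (f1 x)) -> flat f -> flat f1.
Proof.
move=> tC Cf1 Df Ff r k.
have [f1' [_ h2 h3]] := tC _ Cf1.
have [C [K [C0 hC]]] := h3 (r + 1).
(* With h of size s^m, the quotient sup |f| / h loses s^m, so flatness of f is used to order m + k;
   the term h sup |f1'| leaves s^(m-K) = s^(k+1). *)
pose m := (K + k).+1.
have [D [t [D0 t0 hD]]] := Ff (r + 1) (m + k)%N.
pose V := 2 * (1 + `|v|).
have V2 : 2 <= V by rewrite /V; have := normr_ge0 v; lra.
have V0 : 0 < V by lra.
(* For s <= 1 the points of the segment have first coordinate at least s/2, and 1 + 2/s <= 3/s. *)
pose A := `|v| * (C * 3 ^+ K).
have A0 : 0 <= A by rewrite !mulr_ge0 // exprn_ge0.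
exists (V * (D * 2 ^+ (m + k) + D) + A), (Num.min 1 (t / 2)); split.
- by rewrite addr_ge0 // mulr_ge0 ?(ltW V0) // addr_ge0 // mulr_ge0 // exprn_ge0.
- by rewrite lt_min ltr01 divr_gt0.
move=> x s0; rewrite le_min => /andP[s1 st] xr.
set s := x.1 in s0 s1 st *.
pose h := s ^+ m / V.
have sm0 : 0 < s ^+ m by rewrite exprn_gt0.
have h0 : 0 < h by rewrite divr_gt0.
have sms : s ^+ m <= s by rewrite /m exprS ler_piMr ?(ltW s0) // exprn_ile1 // ltW.
have hv : h * `|v| <= s / 2.
  rewrite /h mulrAC ler_pdivrMr // /V.
  apply: le_trans (_ : s * (1 + `|v|) <= _); last by lra.
  apply: ler_pM => //; [exact: ltW|]; lra.
have near_x u : `|u - 0| <= `|h| ->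
    [/\ s / 2 <= (u *: v + x).1, (u *: v + x).1 <= 2 * s & `|u *: v + x| <= r + 1].
  rewrite subr0 (ger0_norm (ltW h0)) => uh.
  have uv : `|u| * `|v| <= s / 2 by apply: le_trans hv; rewrite ler_wpM2r.
  have : `|(u *: v).1| <= s / 2 by rewrite (le_trans (norm_fst_le _)) // normrZ.
  rewrite ler_norml /= => /andP[u1 u2]; split; rewrite -/s; [lra|lra|].
  rewrite (le_trans (ler_normD _ _)) // normrZ; lra.
have T1 : `|f (h *: v + x) - f x - h * f1 x| <= A / s ^+ K * h ^+ 2.
  have := @taylor1_abs R (fun u => f (u *: v + x)) (fun u => f1 (u *: v + x))
    (fun u => f1' v (u *: v + x)) 0 h (A / s ^+ K).
  rewrite !scale0r !add0r !subr0; apply => u /near_x[u1 u2 u3].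
  have y0 : 0 < (u *: v + x).1 by rewrite (lt_le_trans _ u1) // divr_gt0.
  split.
  - exact: (proj1 (@is_derive_lineP R E f x v u _) (Df _ y0)).
  - exact: (proj1 (@is_derive_lineP R E f1 x v u _) (h2 v _ y0)).
  - apply: le_trans (hC v _ y0 u3) _; rewrite /A -!mulrA !ler_wpM2l // -expr_div_n.
    rewrite lerXn2r ?nnegrE ?divr_ge0 ?(ltW s0) // /tpole ?addr_ge0 ?invr_ge0 ?(ltW y0) //.
    have : ((u *: v + x).1)^-1 <= 2 / s.
      by rewrite -[2 / s]invf_div lef_pV2 // posrE ?divr_gt0.
    have : 1 <= s^-1 by rewrite -[1]invr1 lef_pV2 // posrE.
    by lra.
have F0 : `|f x| <= D * s ^+ (m + k).
  by apply: hD => //; [rewrite -/s; lra|lra].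
have Fh : `|f (h *: v + x)| <= D * 2 ^+ (m + k) * s ^+ (m + k).
  have [|u1 u2 u3] := near_x h; first by rewrite subr0.
  have y0 : 0 < (h *: v + x).1 by rewrite (lt_le_trans _ u1) // divr_gt0.
  apply: le_trans (hD _ y0 _ u3) _; first by rewrite (le_trans u2) //; lra.
  rewrite -mulrA ler_wpM2l // -exprMn lerXn2r ?nnegrE ?(ltW y0) //.
  by rewrite mulr_ge0 // ltW.
have : `|h * f1 x| <= (D * 2 ^+ (m + k) + D) * s ^+ (m + k) + A / s ^+ K * h ^+ 2.
  have -> : h * f1 x = f (h *: v + x) - f x - (f (h *: v + x) - f x - h * f1 x) by ring.
  apply: le_trans (ler_normB _ _) _; apply: lerD => //.
  by apply: le_trans (ler_normB _ _) _; rewrite mulrDl; apply: lerD.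
rewrite normrM (ger0_norm (ltW h0)) -ler_pdivlMl // => /le_trans; apply.
have -> : h^-1 * ((D * 2 ^+ (m + k) + D) * s ^+ (m + k) + A / s ^+ K * h ^+ 2) =
  V * (D * 2 ^+ (m + k) + D) * s ^+ k + A * (s ^+ k * (s / V)).
  move: (D * 2 ^+ (m + k) + D) => W.
  have e2 : s ^+ m = s * (s ^+ K * s ^+ k) by rewrite /m exprS exprD.
  rewrite /h exprD e2; have := exprn_gt0 K s0; have := exprn_gt0 k s0.
  move: (s ^+ K) (s ^+ k) => a b b0 a0; field.
  by rewrite !gt_eqF.
rewrite mulrDl lerD2l ler_wpM2l // ler_piMr ?exprn_ge0 ?(ltW s0) //.
by rewrite ler_pdivrMr //; lra.
Qed.

(** Supplies the continuity half of [smooth_open]. At a boundary point flatness of order 1 is a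
    Lipschitz bound; at an interior point the bound comes from the derivative. *)
Lemma ext0_lipschitz Cl f x : tame_class Cl -> Cl f -> flat f ->
  exists C, exists2 r, 0 < r & forall y, `|y - x| <= r -> `|ext0 f y - ext0 f x| <= C * `|y - x|.
Proof.
move=> tC Cf Ff; rewrite /ext0; case: (ltgtP x.1 0) => [xlt|xgt|x0].
- exists 0, (- x.1); first by lra.
  move=> y yx; have : `|(y - x).1| <= - x.1 by rewrite (le_trans (norm_fst_le _)).
  rewrite ler_norml /= => /andP[_ y1]; rewrite ltNge.
  have -> : y.1 <= 0 by lra.
  by rewrite subrr normr0 mul0r.
- have [f' [_ h2 h3]] := tC _ Cf; have [C [K [C0 hC]]] := h3 (`|x| + x.1 / 2).
  exists (C * (1 + (x.1 / 2)^-1) ^+ K), (x.1 / 2); first by lra.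
  move=> y yx; have near_x u : `|u| <= 1 -> x.1 / 2 <= (u *: (y - x) + x).1 /\
      `|u *: (y - x) + x| <= `|x| + x.1 / 2.
    move=> u1; have uv : `|u *: (y - x)| <= x.1 / 2.
      by rewrite normrZ (le_trans _ yx) // ler_piMl.
    split; last by rewrite (le_trans (ler_normD _ _)) // addrC lerD2l.
    have : `|(u *: (y - x)).1| <= x.1 / 2 by rewrite (le_trans (norm_fst_le _)).
    rewrite ler_norml /= => /andP[? ?]; lra.
  have e1 : y = (1 : R) *: (y - x) + x by rewrite scale1r subrK.
  have [|y1 _] := near_x 1; first by rewrite normr1.
  rewrite -e1 in y1; have -> : 0 < y.1 by lra.
  have := @MVT_abs R (fun u => f (u *: (y - x) + x)) (fun u => f' (y - x) (u *: (y - x) + x)) 0 1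
    (C * (1 + (x.1 / 2)^-1) ^+ K * `|y - x|).
  rewrite -e1 scale0r add0r subr0 normr1 mulr1; apply => u; rewrite subr0 => /near_x[u1 u2].
  + have y0 : 0 < (u *: (y - x) + x).1 by lra.
    exact: (proj1 (@is_derive_lineP R E f x (y - x) u _) (h2 _ _ y0)).
  + have y0 : 0 < (u *: (y - x) + x).1 by lra.
    apply: le_trans (hC _ _ y0 u2) _; rewrite mulrC ler_wpM2r // ler_wpM2l //.
    rewrite lerXn2r ?nnegrE ?addr_ge0 ?invr_ge0 ?(ltW y0) //; [lra|].
    by rewrite lerD2l lef_pV2 // posrE; lra.
- have [C [s0 [C0 s00 hC]]] := Ff (`|x| + 1) 1%N.
  exists C, (Num.min 1 s0); first by rewrite lt_min ltr01.
  move=> y; rewrite le_min => /andP[y1 ys0].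
  have yx : `|y.1| <= `|y - x|.
    by apply: le_trans (norm_fst_le _); rewrite /= x0 subr0.
  rewrite subr0; case: ifPn => [yp|_]; last by rewrite normr0 mulr_ge0.
  rewrite (ger0_norm (ltW yp)) in yx.
  apply: le_trans (hC y yp _ _) _; [exact: le_trans ys0| |by rewrite expr1 ler_wpM2l].
  by rewrite -[y](subrK x) addrC (le_trans (ler_normD _ _)) // lerD2l.
Qed.

Lemma nbhs_fst_gt0 x : 0 < x.1 -> \forall y \near x, 0 < y.1.
Proof.
move=> x0; near=> y; have : `|x - y| < x.1.
  by near: y; apply: cvgr_dist_lt => //; exact: cvg_id.
move=> /(le_lt_trans (norm_fst_le _)) /=; rewrite ltr_norml => /andP[]; lra.
Unshelve. all: by end_near. Qed.

Lemma nbhs_fst_lt0 x : x.1 < 0 -> \forall y \near x, y.1 < 0.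
Proof.
move=> x0; near=> y; have : `|x - y| < - x.1.
  by near: y; apply: cvgr_dist_lt; [exact: cvg_id|rewrite oppr_gt0].
move=> /(le_lt_trans (norm_fst_le _)) /=; rewrite ltr_norml => /andP[]; lra.
Unshelve. all: by end_near. Qed.

Lemma ext0_derive f f1 x v : flat f -> (forall x, 0 < x.1 -> is_derive x v f (f1 x)) ->
  is_derive x v (ext0 f) (ext0 f1 x).
Proof.
move=> Ff Df; rewrite {2}/ext0; case: (ltgtP x.1 0) => [xlt|xgt|x0].
- apply: near_eq_is_derive (is_derive_const x v 0).
  near=> y; rewrite /ext0 ltNge; have -> // : y.1 <= 0.
  by apply: ltW; near: y; exact: nbhs_fst_lt0.
- apply: near_eq_is_derive (Df x xgt); near=> y; rewrite /ext0; have -> // : 0 < y.1.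
  by near: y; exact: nbhs_fst_gt0.
(* At a boundary point flatness of order 2 is precisely a quadratic remainder with derivative 0. *)
- have [C [s0 [C0 s00 hC]]] := Ff (`|x| + 1) 2%N.
  have v0 : 0 < 1 + `|v| by rewrite ltr_pwDl.
  apply: (@is_derive_quadratic _ _ _ _ _ _ (C * `|v| ^+ 2) (Num.min 1 s0 / (1 + `|v|))).
    by rewrite divr_gt0 // lt_min ltr01.
  move=> h; rewrite ler_pdivlMr // le_min => /andP[h1 hs].
  rewrite mulr0 subr0 /ext0 x0 ltxx subr0; case: ifPn => [yp|_]; last first.
    by rewrite normr0 mulr_ge0 ?sqr_ge0 // mulr_ge0 // sqr_ge0.
  have yh : (h *: v + x).1 <= `|h| * `|v|.
    rewrite /= x0 addr0 (le_trans (ler_norm _)) // normrM ler_wpM2l //; exact: norm_fst_le.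
  have hv : `|h| * `|v| <= `|h| * (1 + `|v|) by rewrite ler_wpM2l // lerDr.
  apply: le_trans (hC _ yp _ _) _.
  + by rewrite (le_trans yh) // (le_trans hv).
  + rewrite (le_trans (ler_normD _ _)) // addrC lerD2l normrZ; lra.
  + rewrite -mulrA ler_wpM2l // -[h ^+ 2]real_normK ?num_real // -exprMn mulrC.
    by rewrite lerXn2r ?nnegrE ?mulr_ge0 // ltW.
Unshelve. all: by end_near. Qed.

Lemma ext0_smooth Cl f c : tame_class Cl -> Cl f -> flat f ->
  smooth_open setT (fun x => c + ext0 f x).
Proof.
move=> tC Cf Ff vs.
(* The shape constant plus extended flat function is stable under differentiation; the constant is 0
   from the first derivative on. *)
have [g [c' [Cg Fg ->]]] : exists g, exists c', [/\ Cl g, flat g &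
    iter_derive vs (fun x => c + ext0 f x) = (fun x => c' + ext0 g x)].
  elim: vs => [|v vs [g [c' [Cg Fg e]]]]; first by exists f, c.
  have [g' [h1 h2 _]] := tC _ Cg.
  exists (g' v), 0; split; [exact: h1|exact: (flat_derive tC (h1 v) (h2 v) Fg)|].
  rewrite /= e; apply/funext => x.
  have := is_derive_add (is_derive_const x v c') (ext0_derive x Fg (h2 v)).
  by move=> [_ ->].
move=> x _; split; last first.
  move=> v; have [g' [h1 h2 _]] := tC _ Cg.
  by have [] := is_derive_add (is_derive_const x v c') (ext0_derive x Fg (h2 v)).
have [C [r r0 H]] := ext0_lipschitz x tC Cg Fg.
apply/cvgrPdist_le => eps e0; near=> y.
rewrite opprD addrACA subrr add0r distrC.
have C1 : 0 < 1 + `|C| by rewrite ltr_pwDl.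
have yr : `|y - x| <= r.
  by rewrite distrC; near: y; apply: cvgr_dist_le => //; exact: cvg_id.
have ye : `|y - x| <= eps / (1 + `|C|).
  by rewrite distrC; near: y; apply: cvgr_dist_le; [exact: cvg_id|exact: divr_gt0].
apply: le_trans (H y yr) _.
apply: le_trans (_ : (1 + `|C|) * `|y - x| <= _).
  by rewrite ler_wpM2r // (le_trans (ler_norm _)) // lerDr.
by rewrite mulrC -ler_pdivlMr.
Unshelve. all: by end_near. Qed.

End FlatExtension.

(** * Gaussian sums *)

Section GaussSums1.
Variable R : realType.
Implicit Types (q : {poly R}) (r s t x y : R) (a : int).

(** Write y = m z; then z <= exp z gives z^m <= exp y. *)
Lemma expRN_mul_le (m : nat) y : 0 <= y -> expR (- y) * y ^+ m <= m%:R ^+ m.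
Proof.
move=> y0; case: m => [|m]; first by rewrite !expr0 mulr1 -expR0 ler_expR oppr_le0.
have m0 : 0 < m.+1%:R :> R by [].
rewrite expRN mulrC ler_pdivrMr ?expR_gt0 //.
have -> : y = (y / m.+1%:R) * m.+1%:R by rewrite divfK // gt_eqF.
move: (y / _) (divr_ge0 y0 (ltW m0)) => z z0.
rewrite expRM_natr exprMn mulrC ler_wpM2l ?exprn_ge0 // lerXn2r ?nnegrE ?expR_ge0 //.
by rewrite (le_trans _ (expR_ge1Dx _)) // lerDr.
Qed.

Definition gpol q x : R := q.[x] * expR (- x ^+ 2).

Definition gder q : {poly R} := q^`() - 2 *: ('X * q).

Lemma gpol_derive q x : is_derive x 1 (gpol q) (gpol (gder q) x).
Proof.
have D1 : is_derive x 1 (fun x => - (x * x) : R) (- (x + x)).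
  have := is_deriveN (is_derive_mul (is_derive_id x 1) (is_derive_id x 1)).
  by rewrite mulr1 mul1r.
have e : (fun x => expR (- x ^+ 2)) = (fun x => expR (- (x * x))) by [].
apply: is_derive_eq (is_derive_mul (is_derive_poly q x) (is_derive_exp D1)) _.
by rewrite /gpol /gder hornerD hornerN hornerZ hornerM hornerX expr2; ring.
Qed.

Lemma poly_growth q : exists C, exists k : nat, 0 <= C /\ forall x, `|q.[x]| <= C * (1 + x ^+ 2) ^+ k.
Proof.
have w1 x : 1 <= 1 + x ^+ 2 by rewrite lerDl sqr_ge0.
have xw x : `|x| <= 1 + x ^+ 2.
  by rewrite -[x ^+ 2]real_normK ?num_real //; have := normr_ge0 x; nra.
elim/poly_ind: q => [|q c [C [k [C0 IH]]]].
  by exists 0, 0%N; split=> // x; rewrite horner0 normr0 mul0r.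
exists (C + `|c|), k.+1; split; first exact: addr_ge0.
move=> x; rewrite !hornerE (le_trans (ler_normD _ _)) // mulrDl lerD //.
  by rewrite normrM exprSr mulrA ler_pM.
by rewrite ler_peMr // exprn_ege1.
Qed.

Lemma gpol_bound q : exists2 B, 0 <= B & forall x, `|gpol q x| <= B / (1 + x ^+ 2).
Proof.
have [C [k [C0 H]]] := poly_growth q.
exists (C * (k.+1%:R ^+ k.+1 * expR 1)).
  by rewrite !mulr_ge0 ?exprn_ge0 ?expR_ge0.
move=> x; have w0 : 0 < 1 + x ^+ 2 by rewrite ltr_pwDl // sqr_ge0.
rewrite ler_pdivlMr // normrM (ger0_norm (expR_ge0 _)).
have -> : - x ^+ 2 = - (1 + x ^+ 2) + 1 by ring.
rewrite expRD.
apply: le_trans (_ : C * (1 + x ^+ 2) ^+ k * (expR (- (1 + x ^+ 2)) * expR 1) * (1 + x ^+ 2) <= _).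
  by rewrite ler_wpM2r ?(ltW w0) // ler_wpM2r ?mulr_ge0 ?expR_ge0.
have := @expRN_mul_le k.+1 _ (ltW w0); rewrite [(1 + x ^+ 2) ^+ k.+1]exprSr => h.
have -> : C * (1 + x ^+ 2) ^+ k * (expR (- (1 + x ^+ 2)) * expR 1) * (1 + x ^+ 2) =
   C * ((expR (- (1 + x ^+ 2)) * ((1 + x ^+ 2) ^+ k * (1 + x ^+ 2))) * expR 1) by ring.
by rewrite ler_wpM2l // ler_wpM2r ?expR_ge0.
Qed.

(** Chains 1 + |a| <= (1 + |t|)(1 + |y|), 1 + |y| <= (1 + 1/r)(1 + |r y|) and (1 + z)^2 <= 2 (1 +
    z^2), so that Gaussian decay in r(a + t) can be compared with the fixed weight in a. *)
Lemma shift_weight r t a : 0 < r ->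
  (1 + (r * (a%:~R + t)) ^+ 2)^-1 <= 2 * (1 + r^-1) ^+ 2 * (1 + `|t|) ^+ 2 * (wint R a ^+ 2)^-1.
Proof.
move=> r0; set y := a%:~R + t.
have ri : 0 < r^-1 by rewrite invr_gt0.
have h1 : wint R a <= (1 + `|t|) * (1 + `|y|).
  have : `|a%:~R : R| <= `|y| + `|t|.
    by have -> : a%:~R = y - t by [rewrite /y; ring]; exact: ler_normB.
  have := normr_ge0 t; have := normr_ge0 y; rewrite /wint; nra.
have h2 : 1 + `|y| <= (1 + r^-1) * (1 + `|r * y|).
  rewrite normrM (gtr0_norm r0).
  have -> : (1 + r^-1) * (1 + r * `|y|) = 1 + r^-1 + r * `|y| + `|y| by field; rewrite gt_eqF.
  have := mulr_ge0 (ltW r0) (normr_ge0 y); lra.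
have h3 : (1 + `|r * y|) ^+ 2 <= 2 * (1 + (r * y) ^+ 2).
  rewrite -[(r * y) ^+ 2]real_normK ?num_real //; move: `|r * y| => z.
  rewrite -subr_ge0; have -> : 2 * (1 + z ^+ 2) - (1 + z) ^+ 2 = (1 - z) ^+ 2 by ring.
  exact: sqr_ge0.
have w0 := wint_gt0 R a.
have z0 : 0 < 1 + (r * y) ^+ 2 by rewrite ltr_pwDl // sqr_ge0.
rewrite ler_pdivlMr ?exprn_gt0 // ler_pdivrMl //.
have h4 : wint R a ^+ 2 <= ((1 + `|t|) * ((1 + r^-1) * (1 + `|r * y|))) ^+ 2.
  rewrite lerXn2r ?nnegrE ?(ltW w0) //.
    by rewrite !mulr_ge0 ?addr_ge0 // ltW.
  by rewrite (le_trans h1) // ler_wpM2l // addr_ge0.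
apply: le_trans h4 _; rewrite [leLHS]exprMn [(_ * (1 + `|r * y|)) ^+ 2]exprMn.
have -> : (1 + (r * y) ^+ 2) * (2 * (1 + r^-1) ^+ 2 * (1 + `|t|) ^+ 2) =
   (1 + `|t|) ^+ 2 * ((1 + r^-1) ^+ 2 * (2 * (1 + (r * y) ^+ 2))) by ring.
by rewrite ler_wpM2l ?sqr_ge0 // ler_wpM2l ?sqr_ge0.
Qed.

Definition gsum q r t : R := rsum [set: int] (fun a => gpol q (r * (a%:~R + t))).

Lemma gpol_shift_bound q : exists2 B, 0 <= B & forall r t a, 0 < r ->
  `|gpol q (r * (a%:~R + t))| <= B * ((1 + r^-1) ^+ 2 * (1 + `|t|) ^+ 2) * (wint R a ^+ 2)^-1.
Proof.
have [B B0 H] := gpol_bound q; exists (B * 2); first exact: mulr_ge0.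
move=> r t a r0; apply: le_trans (H _) _.
apply: le_trans (ler_wpM2l B0 (shift_weight t a r0)) _.
by rewrite le_eqVlt; apply/orP; left; apply/eqP; ring.
Qed.

Lemma asum_gpol q r t : 0 < r -> asum (fun a => gpol q (r * (a%:~R + t))).
Proof.
move=> r0; have [B B0 H] := gpol_shift_bound q.
by apply: asum_bound (asumZ _ (asum_wint R)) _ => a; exact: H.
Qed.

Lemma gsum_periodic q r t (z : int) : gsum q r (t + z%:~R) = gsum q r t.
Proof.
have be : bijective (fun a => a + z) by exists (fun a => a - z) => a; rewrite ?addrK ?subrK.
rewrite /gsum [RHS](reindex_rsum _ (bij_setT be)); apply: eq_rsum => a _.
by rewrite rmorphD /= addrA addrAC.
Qed.

Lemma int_part t : exists z : int, 0 <= t - z%:~R /\ t - z%:~R <= 1.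
Proof.
exists (Num.floor t); have /andP[] := Num.Theory.floor_itv t.
by rewrite rmorphD /=; lra.
Qed.

Lemma gsum_bound q : exists2 B, 0 <= B & forall r t, 0 < r -> r <= 1 ->
  `|gsum q r t| <= B * r^-1 ^+ 2.
Proof.
have [B B0 H] := gpol_shift_bound q; pose S := rsum [set: int] (fun a => (wint R a ^+ 2)^-1).
have S0 : 0 <= S by apply: rsum_ge0 => a; rewrite invr_ge0 sqr_ge0.
(* Periodicity moves t into [0, 1], which makes the bound uniform in t; 16 is the product of (1 +
   1/r)^2 <= 4/r^2 and (1 + |t|)^2 <= 4. *)
exists (B * 16 * S); first by rewrite !mulr_ge0.
move=> r t r0 r1; have [z [z1 z2]] := int_part t.
rewrite -(subrK z%:~R t) gsum_periodic.
set u := t - _; have u1 : `|u| <= 1 by rewrite ger0_norm.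
have ri : 1 <= r^-1 by rewrite -[1]invr1 lef_pV2 // posrE.
apply: le_trans (_ : B * 16 * r^-1 ^+ 2 * S <= _); last first.
  by rewrite le_eqVlt; apply/orP; left; apply/eqP; ring.
rewrite -rsumZ; apply: ler_norm_rsum; first exact/asumZ/asum_wint.
move=> a; apply: le_trans (H r u a r0) _.
rewrite ler_wpM2r ?invr_ge0 ?sqr_ge0 // -[leRHS]mulrA ler_wpM2l //.
have -> : 16 * r^-1 ^+ 2 = (2 * r^-1) ^+ 2 * 2 ^+ 2 by ring.
by apply: ler_pM; rewrite ?sqr_ge0 // lerXn2r ?nnegrE ?addr_ge0 ?mulr_ge0 ?invr_ge0 ?(ltW r0) //; lra.
Qed.

Lemma gsum_derive_shift q r t : 0 < r ->
  is_derive t 1 (gsum q r) (r * gsum (gder q) r t).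
Proof.
move=> r0; have [B B0 H] := gpol_shift_bound (gder (gder q)).
pose M a := r ^+ 2 * (B * ((1 + r^-1) ^+ 2 * (1 + (`|t| + 1)) ^+ 2)) * (wint R a ^+ 2)^-1.
have D p a (u : R) : is_derive u 1 (fun u => gpol p (r * (a%:~R + u))) (r * gpol (gder p) (r * (a%:~R + u))).
  have D1 : is_derive u 1 (fun u => (a%:~R + u) * r) r.
    have := is_derive_mulc r (is_derive_add (is_derive_const u 1 (a%:~R)) (is_derive_id u 1)).
    by rewrite add0r mul1r.
  have e : (fun u => gpol p (r * (a%:~R + u))) = (fun u => gpol p ((a%:~R + u) * r)).
    by apply/funext => w; rewrite mulrC.
  rewrite e; apply: is_derive_eq (is_derive_comp1 (gpol_derive p _) D1) _.
  by rewrite [(_ + u) * r]mulrC.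
rewrite -rsumZ.
apply: (@is_derive_rsum R int (fun a u => gpol q (r * (a%:~R + u)))
  (fun a u => r * gpol (gder q) (r * (a%:~R + u)))
  (fun a u => r ^+ 2 * gpol (gder (gder q)) (r * (a%:~R + u))) M t 1) => //.
- exact/asumZ/asum_wint.
- exact: asum_gpol.
- exact/asumZ/asum_gpol.
- move=> a u ut; split; first exact: D.
  + have := is_derive_mulc r (D (gder q) a u); rewrite mulrAC -expr2.
    by under eq_fun do rewrite mulrC.
  + rewrite normrM (ger0_norm (sqr_ge0 _)) /M -[leRHS]mulrA ler_wpM2l ?sqr_ge0 //.
    apply: le_trans (H r u a r0) _; rewrite ler_wpM2r ?invr_ge0 ?sqr_ge0 //.
    rewrite !ler_wpM2l ?sqr_ge0 // lerXn2r ?nnegrE ?addr_ge0 // lerD2l.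
    by have -> : u = (u - t) + t by [ring]; rewrite (le_trans (ler_normD _ _)) // addrC lerD2l.
Qed.

(* t |-> gsum q r t is 1-periodic, so its t-derivative has a zero (Rolle) and is
   bounded by its own derivative; this gains a factor r. *)
Lemma gsum_gder_contract q r M : 0 < r -> (forall t, `|gsum (gder (gder q)) r t| <= M) ->
  forall t, `|gsum (gder q) r t| <= r * M.
Proof.
move=> r0 H t.
have D p u := gsum_derive_shift p u r0.
have cont p u : {for u, continuous (gsum p r)}.
  by have [/derivable1_diffP d _] := D p u; exact: differentiable_continuous.
have t1 : t <= t + 1 by rewrite lerDl.
have [|c ci e] := @MVT_segment R (gsum q r) (fun u => r * gsum (gder q) r u) t (t + 1) t1.
  by apply: continuous_in_subspaceT => x _; exact: cont.
have c0 : gsum (gder q) r c = 0.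
  move: e; rewrite (_ : t + 1 = t + 1%:~R) // gsum_periodic subrr addrC addKr mulr1.
  by move/esym/eqP; rewrite mulf_eq0 gt_eqF //= => /eqP.
have M0 : 0 <= M by rewrite (le_trans _ (H 0)).
have -> : gsum (gder q) r t = gsum (gder q) r t - gsum (gder q) r c by rewrite c0 subr0.
apply: le_trans (@MVT_abs R _ (fun u => r * gsum (gder (gder q)) r u) c t (r * M) _ _) _.
  by move=> u _; rewrite normrM (gtr0_norm r0) ler_wpM2l ?(ltW r0).
rewrite ler_piMr ?mulr_ge0 ?(ltW r0) //.
by move: ci; rewrite in_itv /= => /andP[? ?]; rewrite ler_norml; lra.
Qed.

(** A summand of the form [gpol (gder q)] is a total derivative, so its integral is 0 and the sum
    has no main term. *)
Lemma gsum_gder_flat q (k : nat) : exists2 B, 0 <= B & forall r t, 0 < r -> r <= 1 ->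
  `|gsum (gder q) r t| <= B * r ^+ k.
Proof.
(* k + 2 contractions gain r^(k+2), two powers of which pay for the r^-2 of the crude bound. *)
have [B B0 H] := gsum_bound (iter k.+2 gder (gder q)).
exists B => // r t r0 r1.
suff main j p : (forall u, `|gsum (iter j gder (gder p)) r u| <= B * r^-1 ^+ 2) ->
    forall u, `|gsum (gder p) r u| <= r ^+ j * (B * r^-1 ^+ 2).
  apply: le_trans (main k.+2 q _ t) _; first by move=> u; exact: H.
  rewrite -addn2 exprD le_eqVlt; apply/orP; left; apply/eqP; field.
  by rewrite gt_eqF.
elim: j p => [|j IH] p h u; first by rewrite mul1r.
rewrite exprS -mulrA; apply: gsum_gder_contract => // w.
by apply: IH => v; rewrite -iterSr.
Qed.

(** Differentiating r exp(-r^2 a^2) in r gives (1 - 2x^2) exp(-x^2) at x = r a, and 1 - 2X^2 is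
    [gder 'X]: the derivative in the mesh is again a sum of total derivatives, hence flat. *)
Lemma gsum_derive_scale r : 0 < r ->
  is_derive r 1 (fun r => r * gsum 1 r 0) (gsum (gder 'X) r 0).
Proof.
move=> r0; have [B B0 H] := gpol_shift_bound ('X * gder (gder 'X)).
pose r2 := r / 2; have r20 : 0 < r2 by rewrite divr_gt0.
pose M a := r2^-1 * (B * ((1 + r2^-1) ^+ 2 * (1 + `|0 : R|) ^+ 2)) * (wint R a ^+ 2)^-1.
have D p (a : int) (u : R) : is_derive u 1 (fun u => gpol p (u * (a%:~R + 0)))
    ((a%:~R + 0) * gpol (gder p) (u * (a%:~R + 0))).
  apply: is_derive_comp1 (gpol_derive p _) _.
  by have := is_derive_mulc (a%:~R + 0) (is_derive_id u 1); rewrite mul1r.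
have e1 : (fun r => r * gsum 1 r 0) =
    (fun r => rsum [set: int] (fun a => r * gpol 1 (r * (a%:~R + 0)))).
  by apply/funext => u; rewrite /gsum rsumZ.
rewrite e1.
apply: (@is_derive_rsum R int (fun a u => u * gpol 1 (u * (a%:~R + 0)))
  (fun a u => gpol (gder 'X) (u * (a%:~R + 0)))
  (fun a u => (a%:~R + 0) * gpol (gder (gder 'X)) (u * (a%:~R + 0))) M r r2) => //.
- exact/asumZ/asum_wint.
- exact/asumZ/asum_gpol.
- exact: asum_gpol.
- move=> a u ur; have u0 : r2 <= u.
    by move: ur; rewrite ler_norml /r2 => /andP[]; lra.
  have up : 0 < u by exact: lt_le_trans u0.
  have ui : u^-1 <= r2^-1 by rewrite lef_pV2.
  split; [|exact: D|].
  + apply: is_derive_eq (is_derive_mul (is_derive_id u 1) (D 1 a u)) _.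
    rewrite /gpol /gder derivX -polyC1 derivC !(hornerD, hornerN, hornerZ, hornerM, hornerX, hornerC).
    ring.
  + have -> : (a%:~R + 0) * gpol (gder (gder 'X)) (u * (a%:~R + 0)) =
      u^-1 * gpol ('X * gder (gder 'X)) (u * (a%:~R + 0)).
      by rewrite /gpol hornerM hornerX; field; rewrite gt_eqF.
    rewrite normrM gtr0_norm ?invr_gt0 // /M -[leRHS]mulrA; apply: ler_pM => //.
      by rewrite invr_ge0 ltW.
    apply: le_trans (H u 0 a up) _.
    rewrite ler_wpM2r ?invr_ge0 ?sqr_ge0 // ler_wpM2l // ler_wpM2r ?sqr_ge0 //.
    by rewrite lerXn2r ?nnegrE ?addr_ge0 ?invr_ge0 ?(ltW up) ?(ltW r20) // lerD2l.
Qed.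

(* The derivatives of r * sum exp (- r^2 (a + t)^2) in r and t are flat; hence a limit
   at r = 0 exists and is approached faster than any power of r.  Its value,
   sqrt pi, is never needed. *)
Lemma gauss_sum1 : exists C, forall k : nat, exists2 B, 0 <= B & forall r t, 0 < r -> r <= 1 ->
  `|r * rsum [set: int] (fun a => expR (- (r * (a%:~R + t)) ^+ 2)) - C| <= B * r ^+ k /\
  `|rsum [set: int] (fun a => (a%:~R + t) * expR (- (r * (a%:~R + t)) ^+ 2))| <= B * r ^+ k.
Proof.
pose T r := r * gsum 1 r 0.
have hT k : exists2 B, 0 <= B & forall r s, 0 < r -> r <= s -> s <= 1 -> `|T r - T s| <= B * s ^+ k.
  have [B B0 H] := gsum_gder_flat 'X k; exists B => // r s r0 rs s1.
  have s0 : 0 < s by exact: lt_le_trans rs.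
  have Bs : 0 <= B * s ^+ k by rewrite mulr_ge0 // exprn_ge0 // ltW.
  have inrs c : c \in `[r, s] -> 0 < c /\ c <= s.
    by rewrite in_itv /= => /andP[c1 c2]; split=> //; exact: lt_le_trans c1.
  have [||c /inrs[c0 cs] e] := @MVT_segment R T (fun u => gsum (gder 'X) u 0) r s rs.
  - by move=> x /subset_itv_oo_cc /inrs[x0 _]; exact: gsum_derive_scale.
  - apply: continuous_in_subspaceT => x /set_mem /= /inrs[x0 _].
    by have [/derivable1_diffP dx _] := gsum_derive_scale x0; exact: differentiable_continuous.
  - rewrite distrC e normrM; apply: le_trans (_ : B * s ^+ k * 1 <= _); last by rewrite mulr1.
    apply: ler_pM => //; last by rewrite ger0_norm; lra.
    apply: le_trans (H c 0 c0 (le_trans cs s1)) _.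
    by rewrite ler_wpM2l // lerXn2r ?nnegrE ?(ltW c0) ?(ltW s0).
have [B1 B10 H1] := hT 1%N.
(* The limit is produced as a supremum: by [hT] every T s - B1 s lies below every T r + B1 r. *)
pose A := [set y | exists2 r, 0 < r <= 1 & y = T r - B1 * r].
have A0 : A !=set0 by exists (T 1 - B1 * 1); exists 1; rewrite // ltr01 lexx.
have ubA r : 0 < r -> r <= 1 -> ubound A (T r + B1 * r).
  move=> r0 r1 _ [s /andP[s0 s1] ->].
  have B1r : 0 <= B1 * r by rewrite mulr_ge0 // ltW.
  have B1s : 0 <= B1 * s by rewrite mulr_ge0 // ltW.
  case: (leP r s) => [rs|/ltW sr].
    by have := H1 r s r0 rs s1; rewrite expr1 ler_norml => /andP[]; lra.
  by have := H1 s r s0 sr r1; rewrite expr1 ler_norml => /andP[]; lra.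
have hsA : has_sup A by split => //; exists (T 1 + B1 * 1); exact: ubA.
pose C := sup A.
have HC r : 0 < r -> r <= 1 -> `|T r - C| <= B1 * r.
  move=> r0 r1.
  have h1 : C <= T r + B1 * r by apply: ge_sup => //; exact: ubA.
  have h2 : T r - B1 * r <= C.
    by apply: sup_upper_bound hsA _ _; exists r; rewrite // r0 r1.
  by rewrite ler_norml; lra.
have e1 r t : 0 < r -> gsum 1 r t = rsum [set: int] (fun a => expR (- (r * (a%:~R + t)) ^+ 2)).
  by move=> r0; apply: eq_rsum => a _; rewrite /gpol hornerC mul1r.
(* Since [gder 1] is -2X, the odd sum is itself a sum of total derivatives; the factor r costs one
   order, which is why flatness is taken to order [k.+1]. *)
have e2 r t : 0 < r -> gsum (gder 1) r t =
    - (2 * r) * rsum [set: int] (fun a => (a%:~R + t) * expR (- (r * (a%:~R + t)) ^+ 2)).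
  move=> r0; rewrite -rsumZ; apply: eq_rsum => a _.
  by rewrite /gpol /gder derivC add0r mulr1 hornerN hornerZ hornerX; ring.
exists C => k; have [B B0 H] := gsum_gder_flat 1 k.+1; have [D D0 HD] := hT k.
exists (B + D); first exact: addr_ge0.
move=> r t r0 r1; have rk : 0 <= r ^+ k by rewrite exprn_ge0 // ltW.
have rk1 : B * r ^+ k.+1 <= B * r ^+ k by rewrite exprS ler_wpM2l // ler_piMl.
split; last first.
  have := H r t r0 r1; rewrite e2 //; set X := rsum _ _ => h.
  have Xk : `|X| <= B * r ^+ k.
    move: h; rewrite normrM normrN (@gtr0_norm _ (2 * r)) ?mulr_gt0 //.
    have -> : 2 * r * `|X| = r * (2 * `|X|) by ring.
    have -> : B * r ^+ k.+1 = r * (B * r ^+ k) by rewrite exprS; ring.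
    by rewrite ler_pM2l // => h; have := normr_ge0 X; lra.
  by have := mulr_ge0 D0 rk; rewrite mulrDl; lra.
(* [HC] gives only order 1. Comparing T r with T s to order k, and T s with C to order 1, and then
   making s small upgrades it to order k. *)
rewrite -e1 //; have TC : `|T r - C| <= D * r ^+ k.
  apply/ler_addgt0Pr => eps e0.
  pose s := Num.min r (eps / (1 + B1)).
  have B11 : 0 < 1 + B1 by rewrite ltr_pwDl.
  have s0 : 0 < s by rewrite lt_min r0 divr_gt0.
  have sr : s <= r by rewrite ge_min lexx.
  have se : B1 * s <= eps.
    apply: le_trans (_ : (1 + B1) * s <= _); first by rewrite ler_wpM2r ?(ltW s0) //; lra.
    by rewrite mulrC -ler_pdivlMr // ge_min lexx orbT.
  have -> : T r - C = (T s - C) - (T s - T r) by ring.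
  apply: le_trans (ler_normB _ _) _; rewrite addrC lerD ?HD //.
  by rewrite (le_trans (HC s s0 (le_trans sr r1))).
(* The dependence on the shift: t is moved into [0, 1] by periodicity, and the derivative in t is
   flat. *)
have osc : `|r * gsum 1 r t - T r| <= B * r ^+ k.
  have [z [z1 z2]] := int_part t.
  rewrite -(subrK z%:~R t) gsum_periodic /T -mulrBr normrM (gtr0_norm r0).
  have : `|gsum 1 r (t - z%:~R) - gsum 1 r 0| <= (r * (B * r ^+ k.+1)) * `|t - z%:~R - 0|.
    apply: (@MVT_abs R (gsum 1 r) (fun u => r * gsum (gder 1) r u)) => u _.
      exact: gsum_derive_shift.
    by rewrite normrM (gtr0_norm r0) ler_wpM2l ?(ltW r0) // H.
  rewrite subr0 (ger0_norm z1) => h; apply: le_trans rk1.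
  have Bk : 0 <= B * r ^+ k.+1 by rewrite mulr_ge0 // exprn_ge0 // ltW.
  apply: le_trans (_ : `|gsum 1 r (t - z%:~R) - gsum 1 r 0| <= _); first by rewrite ler_piMl.
  apply: le_trans h _; apply: le_trans (_ : r * (B * r ^+ k.+1) <= _).
    by rewrite ler_piMr // mulr_ge0 // ltW.
  by rewrite ler_piMl.
have -> : r * gsum 1 r t - C = (r * gsum 1 r t - T r) + (T r - C) by ring.
by rewrite (le_trans (ler_normD _ _)) // mulrDl lerD.
Qed.

End GaussSums1.

(** * Coercivity and Cholesky factorisation *)

Section PositiveDefinite.
Variable R : realType.

Definition nsq n (y : 'rV[R]_n) : R := \sum_j y 0 j ^+ 2.

Lemma nsq_ge0 n (y : 'rV_n) : 0 <= nsq y.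
Proof. by apply: sumr_ge0 => j _; rewrite sqr_ge0. Qed.

Lemma sqr_le_nsq n (y : 'rV_n) j : y 0 j ^+ 2 <= nsq y.
Proof. by rewrite /nsq (bigD1 j) //= lerDl sumr_ge0 // => i _; rewrite sqr_ge0. Qed.

Lemma norm_le_nsq n (y : 'rV_n) j : `|y 0 j| <= Num.sqrt (nsq y).
Proof. by rewrite -sqrtr_sqr ler_wsqrtr // sqr_le_nsq. Qed.

Lemma nsqE n (y : 'rV_n) : nsq y = (y *m y^T) 0 0.
Proof. by rewrite mxE; apply: eq_bigr => j _; rewrite mxE expr2. Qed.

Lemma nsqZ n c (y : 'rV_n) : nsq (c *: y) = c ^+ 2 * nsq y.
Proof. by rewrite /nsq mulr_sumr; apply: eq_bigr => j _; rewrite mxE exprMn. Qed.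

Lemma unit_coercive n (T : 'M[R]_n) : T \in unitmx ->
  exists2 A, 0 < A & forall y : 'rV_n, nsq y <= A * nsq (y *m T).
Proof.
move=> uT; pose c i := \sum_j `|invmx T j i|.
have c0 i : 0 <= c i by apply: sumr_ge0.
exists (1 + \sum_i c i ^+ 2); first by rewrite ltr_pwDl // sumr_ge0 // => i _; rewrite sqr_ge0.
move=> y; rewrite mulrDl mul1r ler_wpDl ?nsq_ge0 // mulr_suml; apply: ler_sum => i _.
have : `|y 0 i| <= c i * Num.sqrt (nsq (y *m T)).
  rewrite -{1}(mulmxK uT y) mxE /c mulr_suml (le_trans (ler_norm_sum _ _ _)) //.
  by apply: ler_sum => j _; rewrite normrM mulrC ler_wpM2l // norm_le_nsq.
move=> h; rewrite -[leRHS](_ : (c i * Num.sqrt (nsq (y *m T))) ^+ 2 = _).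
  by rewrite -[leLHS]real_normK ?num_real // lerXn2r ?nnegrE // mulr_ge0 // sqrtr_ge0.
by rewrite exprMn sqr_sqrtr // nsq_ge0.
Qed.

(** Triangular factors make Gaussian sums iterable: in the row y *m T only the first entry involves
    the first coordinate of y. *)
Definition ltrig n (T : 'M[R]_n) : Prop := is_trig_mx T /\ forall i, 0 < T i i.

Lemma ltrig_block n (T : 'M[R]_(1 + n)) : ltrig T ->
  exists tau w T', [/\ T = block_mx (tau%:M : 'M[R]_1) 0 w T', 0 < tau & ltrig T'].
Proof.
move=> [tT dT]; exists (ulsubmx T 0 0), (dlsubmx T), (drsubmx T); split.
- rewrite -[LHS]submxK; congr block_mx; first by rewrite [LHS]mx11_scalar.
  apply/matrixP => i j; rewrite !mxE; apply: (is_trig_mxP tT).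
  by rewrite (ord1 i).
- by rewrite !mxE; exact: dT.
- split; last by move=> i; rewrite !mxE; exact: dT.
  by apply/is_trig_mxP => i j ij; rewrite !mxE; apply: (is_trig_mxP tT); rewrite /= ltn_add2l.
Qed.

Lemma ltrig_unit n (T : 'M[R]_n) : ltrig T -> 0 < \det T /\ T \in unitmx.
Proof.
move=> [tT dT]; have d0 : 0 < \det T by rewrite det_trig // prodr_gt0.
by rewrite d0 unitmxE unitfE gt_eqF.
Qed.

Lemma ltrigZ n (T : 'M[R]_n) c : 0 < c -> ltrig T -> ltrig (c *: T).
Proof.
move=> c0 [tT dT]; split; last by move=> i; rewrite mxE mulr_gt0.
by apply/is_trig_mxP => i j ij; rewrite mxE (is_trig_mxP tT) // mulr0.
Qed.

Lemma cholesky n (v : 'M[R]_n) : v^T = v -> pos_def v -> exists2 T, ltrig T & v = T *m T^T.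
Proof.
elim: n v => [|n IH] v.
  move=> _ _.
  exists 0; last by apply/matrixP => -[].
  by split; [apply/is_trig_mxP => -[]|case].
move: v; change n.+1 with (1 + n)%N => v vs vp.
pose d := ulsubmx v 0 0; pose w := ursubmx v; pose v' := drsubmx v.
have ve : v = block_mx (d%:M : 'M[R]_1) w w^T v'.
  rewrite -[LHS]submxK; congr block_mx; first by rewrite [LHS]mx11_scalar.
  by rewrite /w trmx_ursub vs.
have v's : v'^T = v' by rewrite /v' trmx_drsub vs.
have bilE (a : R) (y : 'rV_n) : bil v (row_mx a%:M y : 'rV_(1 + n)) (row_mx a%:M y : 'rV_(1 + n)) =
    d * a ^+ 2 + 2 * a * (w *m y^T) 0 0 + bil v' y y.
  have e : (y *m w^T) 0 0 = (w *m y^T) 0 0.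
    by rewrite -[y in LHS]trmxK -trmx_mul mxE.
  rewrite /bil ve mul_row_block tr_row_mx mul_row_col tr_scalar_mx !mulmxDl.
  rewrite !mul_scalar_mx !mul_mx_scalar -scalemxAl.
  move: (y *m w^T) (w *m y^T) (y *m v' *m y^T) e => P Q S e.
  by rewrite !mxE e eqxx mulr1n; ring.
have d0 : 0 < d.
  have := vp (row_mx 1%:M 0 : 'rV_(1 + n)); rewrite bilE /bil mul0mx mul0mx trmx0 mulmx0 !mxE.
  rewrite expr1n !mulr1 mulr0 !addr0; apply.
  apply/eqP => /(congr1 lsubmx); rewrite row_mxKl => /matrixP /(_ 0 0).
  by rewrite !mxE eqxx => /eqP; rewrite oner_eq0.
have [|y y0|T' [tT' dT'] eT'] := IH (v' - d^-1 *: (w^T *m w)).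
- by rewrite linearB linearZ /= trmx_mul trmxK v's.
(* The first coordinate is the one that minimises the form for the given y; the minimum is the Schur
   complement, which is therefore positive definite. *)
- have := vp (row_mx (- (d^-1 * (w *m y^T) 0 0))%:M y : 'rV_(1 + n)).
  rewrite bilE; set c := (w *m y^T) 0 0.
  have -> : bil (v' - d^-1 *: (w^T *m w)) y y = bil v' y y - d^-1 * c ^+ 2.
    have -> : c ^+ 2 = (y *m (w^T *m w) *m y^T) 0 0.
      rewrite mulmxA -mulmxA mxE big_ord1 expr2; congr (_ * _).
      by rewrite -[y in RHS]trmxK -trmx_mul [RHS]mxE.
    rewrite /bil mulmxBr mulmxBl -scalemxAr -scalemxAl.
    by move: (y *m v' *m y^T) (y *m _ *m y^T) => P S; rewrite !mxE.
  have -> : d * (- (d^-1 * c)) ^+ 2 + 2 * - (d^-1 * c) * c + bil v' y y = bil v' y y - d^-1 * c ^+ 2.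
    by field; rewrite gt_eqF.
  by apply; apply: contraNneq y0 => /(congr1 rsubmx); rewrite row_mxKr linear0 => ->.
pose sd := Num.sqrt d; have sd0 : 0 < sd by rewrite sqrtr_gt0.
have sd2 : sd * sd = d by rewrite -expr2 sqr_sqrtr // ltW.
exists (block_mx (sd%:M : 'M[R]_1) 0 (sd^-1 *: w^T) T').
  split.
    by rewrite is_trig_block_mx // scalar_mx_is_trig tT' eqxx.
  move=> i; rewrite -(splitK i); case: (fintype.split i) => j /=.
    by rewrite block_mxEul mxE ord1 eqxx.
  by rewrite block_mxEdr.
rewrite tr_block_mx mulmx_block !trmx0 !mul0mx !mulmx0 !addr0 !tr_scalar_mx linearZ /= trmxK.
rewrite [v]ve; congr block_mx.
- by rewrite -scalar_mxM sd2.
- by rewrite mul_scalar_mx scalerA mulfV ?gt_eqF // scale1r.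
- by rewrite mul_mx_scalar scalerA mulfV ?gt_eqF // scale1r.
- rewrite -eT' -scalemxAl -scalemxAr scalerA -invfM sd2 addrC subrK //.
Qed.

End PositiveDefinite.

(** * Gaussian sums in several variables *)

Section GaussSums.
Variable R : realType.

Definition introw n (z : 'rV[int]_n) : 'rV[R]_n := map_mx intr z.

Lemma ler_prodr (I : Type) (r : seq I) (F G : I -> R) :
  (forall i, 0 <= F i <= G i) -> \prod_(i <- r) F i <= \prod_(i <- r) G i.
Proof. by move=> FG; apply: ler_prod => i _. Qed.

Lemma asum_gauss n (T : 'M[R]_n) s t : T \in unitmx -> 0 < s ->
  asum (fun z => expR (- s ^+ 2 * nsq ((introw z + t) *m T))).
Proof.
move=> uT s0; have [A A0 HA] := unit_coercive uT.
have [B B0 HB] := gpol_shift_bound (1 : {poly R}).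
pose r := Num.sqrt (s ^+ 2 / A).
have r2 : r ^+ 2 = s ^+ 2 / A by rewrite sqr_sqrtr // divr_ge0 ?sqr_ge0 // ltW.
have r0 : 0 < r by rewrite sqrtr_gt0 divr_gt0 // exprn_gt0.
pose c i := B * ((1 + r^-1) ^+ 2 * (1 + `|t 0 i|) ^+ 2).
apply: asum_bound (asumZ (\prod_i c i) (asum_wrow R n)) _ => z.
rewrite ger0_norm ?expR_ge0 //.
apply: le_trans (_ : expR (- r ^+ 2 * nsq (introw z + t)) <= _).
  rewrite ler_expR !mulNr lerN2 r2 -mulrA ler_wpM2l ?sqr_ge0 //.
  by rewrite ler_pdivrMl // HA.
rewrite /nsq mulr_sumr expR_sum /wrow -prodrXl -prodfV -big_split /=.
apply: ler_prodr => i; rewrite expR_ge0 /=.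
have := HB r (t 0 i) (z 0 i) r0; rewrite /gpol hornerC mul1r ger0_norm ?expR_ge0 //.
by rewrite !mxE mulNr exprMn.
Qed.

Lemma norm_expN_le (x y : R) : x ^+ 2 <= y -> `|x| * expR (- y) <= 2 * expR (- (y / 2)).
Proof.
move=> xy; have -> : - y = - (y / 2) - (y / 2) by field.
rewrite expRD mulrA mulrAC ler_wpM2r ?expR_ge0 //.
rewrite expRN ler_pdivrMr ?expR_gt0 //.
apply: le_trans (_ : 2 * (1 + y / 2) <= _); last by rewrite ler_wpM2l ?expR_ge1Dx.
move: xy; rewrite -[x ^+ 2]real_normK ?num_real // => xy.
have e : (`|x| - 1) ^+ 2 = `|x| ^+ 2 - 2 * `|x| + 1 by ring.
by have := sqr_ge0 (`|x| - 1); have := sqr_ge0 `|x|; rewrite e; lra.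
Qed.

(** Half of the exponent pays for the linear factor. The remaining half is written as a Gaussian for
    h T, with h^2 = 1/2, so that the induction hypothesis of [gauss_sum] covers the majorant too. *)
Lemma gauss_lin_bound n (T : 'M[R]_n) s (y : 'rV_n) j h : 0 < s -> h ^+ 2 = 2^-1 ->
  `|(y *m T) 0 j * expR (- s ^+ 2 * nsq (y *m T))| <=
  2 / s * expR (- s ^+ 2 * nsq (y *m (h *: T))).
Proof.
move=> s0 h2; set x := (y *m T) 0 j.
have hx : (s * x) ^+ 2 <= s ^+ 2 * nsq (y *m T).
  by rewrite exprMn ler_wpM2l ?sqr_ge0 // sqr_le_nsq.
have := norm_expN_le hx; rewrite normrM (gtr0_norm s0) => H.
rewrite normrM (ger0_norm (expR_ge0 _)) -scalemxAr nsqZ h2.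
rewrite mulrAC ler_pdivlMr // mulrC mulrA mulNr.
by have -> : - s ^+ 2 * (2^-1 * nsq (y *m T)) = - (s ^+ 2 * nsq (y *m T) / 2) by ring.
Qed.

Lemma row_cons_bij n :
  bijective (fun t : 'rV[int]_n * int => row_mx (t.2%:M : 'rV_1) t.1 : 'rV_(1 + n)).
Proof.
have sb : bijective (fun t : 'rV[int]_n * int => (t.2, t.1)) by exists (fun t => (t.2, t.1)); case.
by have := bij_comp (consr_bij n) sb.
Qed.

(** Bookkeeping for [gauss_sum], whose three estimates consume different ones of four error
    constants. *)
Lemma le_sum4 (a b c d x y : R) : 0 <= y -> 0 <= a -> 0 <= b -> 0 <= c -> 0 <= d ->
  [\/ x <= a * y + b * y, x <= c * y | x <= d * y + b * y] -> x <= (a + b + c + d) * y.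
Proof.
move=> y0 a0 b0 c0 d0; rewrite !mulrDl; have := mulr_ge0 a0 y0; have := mulr_ge0 b0 y0.
have := mulr_ge0 c0 y0; have := mulr_ge0 d0 y0.
move: (a * y) (b * y) (c * y) (d * y) => {a0 b0 c0 d0 y0}a' b' c' d' ? ? ? ?.
by case; lra.
Qed.

Lemma asum_gauss_lin n (T : 'M[R]_n) s t j : T \in unitmx -> 0 < s ->
  asum (fun z => ((introw z + t) *m T) 0 j * expR (- s ^+ 2 * nsq ((introw z + t) *m T))).
Proof.
move=> uT s0; pose h : R := Num.sqrt 2^-1.
have h0 : h != 0 by rewrite gt_eqF // sqrtr_gt0 invr_gt0.
have uhT : h *: T \in unitmx by rewrite unitmxZ // unitfE.
apply: asum_bound (asumZ (2 / s) (asum_gauss t uhT s0)) _ => z.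
by apply: gauss_lin_bound => //; rewrite sqr_sqrtr.
Qed.

(* The linear Gaussian sums have no main term because the summand is odd. *)
Definition gauss_const (C : R) : Prop := forall n (T : 'M[R]_n) (k : nat), ltrig T ->
  exists B, exists s0, [/\ 0 <= B, 0 < s0 <= 1 & forall s t, 0 < s <= s0 ->
  let g z := expR (- s ^+ 2 * nsq ((introw z + t) *m T)) in
  `|s ^+ n * rsum [set: 'rV[int]_n] g - C ^+ n / \det T| <= B * s ^+ k /\
  forall j, `|rsum [set: 'rV[int]_n] (fun z => ((introw z + t) *m T) 0 j * g z)| <= B * s ^+ k].

(** Induction by Fubini: for fixed remaining coordinates the sum over the first one is a
    one-dimensional sum of mesh s tau, with a shift depending on them. Uniformity in the shift in
    [gauss_sum1] is what permits summing its errors. *)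
Lemma gauss_sum : exists C, gauss_const C.
Proof.
have [C HC] := gauss_sum1 R; exists C => n.
elim: n => [|n IH] T k tT.
  exists 0, 1; split=> // [|s t /andP[s0 s1] g]; first by rewrite ltr01 lexx.
  split=> [|[]//].
  have be : bijective (fun _ : unit => 0 : 'rV[int]_0).
    by exists (fun=> tt) => [[]//|z]; apply/rowP => -[].
  rewrite (reindex_rsum _ (bij_setT be)) rsum_finite (big_pred1 tt) ?big_enum; last by case.
  by rewrite det_mx00 /g /nsq big_ord0 mulr0 expR0 !expr0 mul1r divr1 subrr normr0 mul0r.
move: T tT; change n.+1 with (1 + n)%N => T tT.
have [tau [w [T' [eT tau0 tT']]]] := ltrig_block tT.
have [dT' uT'] := ltrig_unit tT'; have [dT uT] := ltrig_unit tT.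
pose h : R := Num.sqrt 2^-1.
have h0 : 0 < h by rewrite sqrtr_gt0 invr_gt0.
have h2 : h ^+ 2 = 2^-1 by rewrite sqr_sqrtr.
(* n powers of s are absorbed by the sums over the remaining coordinates, two more by the factor 1/s
   of [splitI] and the factor 2/s of [gauss_lin_bound]. *)
have [B1 B10 H1] := HC (k + n).+2.
(* One order more than k, again for the factor 1/s of [splitI]; for h T, below, only boundedness of
   the normalised sum is used, hence order 0. *)
have [B2 [s2 [B20 /andP[s20 s21] H2]]] := IH T' k.+1 tT'.
have [B3 [s3 [B30 /andP[s30 s31] H3]]] := IH (h *: T') 0%N (ltrigZ h0 tT').
pose k1 := (k + n).+2.
pose b1 := B1 * tau ^+ k1.
have b10 : 0 <= b1 by rewrite mulr_ge0 // exprn_ge0 // ltW.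
pose D2 := `|C ^+ n / \det T'| + B2.
pose D3 := `|C ^+ n / \det (h *: T')| + B3.
have D20 : 0 <= D2 by rewrite addr_ge0.
have D30 : 0 <= D3 by rewrite addr_ge0.
pose Ct := `|C / tau|.
(* The bound (1 + tau)^-1 on s keeps the one-dimensional mesh s tau below 1. *)
exists (b1 / tau * D2 + Ct * B2 + tau * b1 * D2 + b1 / tau * (2 * D3)),
  (Num.min (Num.min s2 s3) (1 + tau)^-1).
have bt0 : 0 <= b1 / tau by rewrite divr_ge0 // ltW.
have p1 : 0 <= b1 / tau * D2 by exact: mulr_ge0.
have p2 : 0 <= Ct * B2 by apply: mulr_ge0 => //; exact: normr_ge0.
have p3 : 0 <= tau * b1 * D2 by apply: mulr_ge0 => //; rewrite mulr_ge0 // ltW.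
have p4 : 0 <= b1 / tau * (2 * D3) by apply: mulr_ge0 => //; apply: mulr_ge0.
have tau1 : 0 < 1 + tau by rewrite addr_gt0.
split; first by rewrite !addr_ge0.
  by rewrite !lt_min s20 s30 invr_gt0 tau1 /= !ge_min s21.
move=> s t /andP[s0]; rewrite !le_min => /andP[/andP[ss2 ss3] st] g.
have s1 : s <= 1 by exact: le_trans ss2 s21.
have st1 : s * tau <= 1.
  apply: le_trans (_ : s * (1 + tau) <= _); first by rewrite ler_wpM2l ?(ltW s0) //; lra.
  by rewrite -ler_pdivlMr // div1r.
have st0 : 0 < s * tau by rewrite mulr_gt0.
pose t' := rsubmx t; pose y' z := (introw z + t') : 'rV[R]_n.
pose u z := lsubmx t 0 0 + (y' z *m w) 0 0 / tau.
pose g' z := expR (- s ^+ 2 * nsq (y' z *m T')).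
pose g'' z := expR (- s ^+ 2 * nsq (y' z *m (h *: T'))).
pose ga v (a : int) := expR (- (s * tau * (a%:~R + v)) ^+ 2).
pose I v := rsum [set: int] (ga v).
pose J v := rsum [set: int] (fun a => (a%:~R + v) * ga v a).
have HI v : `|s * I v - C / tau| <= b1 / tau * s ^+ k1 /\ `|J v| <= b1 * s ^+ k1.
  have [i1 i2] := H1 (s * tau) v st0 st1.
  have e : B1 * (s * tau) ^+ k1 = b1 * s ^+ k1 by rewrite exprMn /b1; ring.
  rewrite e in i1 i2; split=> //.
  have -> : s * I v - C / tau = tau^-1 * (s * tau * I v - C).
    by field; rewrite gt_eqF.
  have ti : 0 < tau^-1 by rewrite invr_gt0.
  have -> : b1 / tau * s ^+ k1 = tau^-1 * (b1 * s ^+ k1) by ring.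
  by rewrite normrM (gtr0_norm ti) ler_wpM2l // ltW.
have rowE z a : (introw (row_mx a%:M z : 'rV_(1 + n)) + t) *m T =
    row_mx (tau * (a%:~R + u z))%:M (y' z *m T').
  rewrite -[t]hsubmxK /introw map_row_mx add_row_mx eT mul_row_block mulmx0 add0r.
  congr row_mx; rewrite [LHS]mx11_scalar; congr (_%:M).
  rewrite -/t' -/(introw z) -/(y' z) mul_mx_scalar.
  rewrite /u; move: (y' z *m w) (lsubmx t) => yw lt.
  by rewrite !mxE eqxx mulr1n; field; rewrite gt_eqF.
have nsqE2 z a : nsq (row_mx (tau * (a%:~R + u z))%:M (y' z *m T') : 'rV_(1 + n)) =
    (tau * (a%:~R + u z)) ^+ 2 + nsq (y' z *m T').
  rewrite /nsq big_split_ord big_ord1 row_mxEl mxE eqxx mulr1n; congr (_ + _).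
  by apply: eq_bigr => j _; rewrite row_mxEr.
have gE z a : g (row_mx a%:M z : 'rV_(1 + n)) = g' z * ga (u z) a.
  by rewrite /g rowE nsqE2 -expRD; congr expR; ring.
have be := bij_setT (row_cons_bij n).
have asg : asum g by exact: asum_gauss.
have asg' : asum g' by exact: asum_gauss.
have asg'' : asum g''.
  by apply: asum_gauss => //; have [] := ltrig_unit (ltrigZ h0 tT').
have Gsum : rsum [set: 'rV_(1 + n)] g = rsum [set: 'rV_n] (fun z => g' z * I (u z)).
  have asp := proj1 (reindex_asum _ be) asg.
  rewrite (reindex_rsum _ be) (proj2 (rsum_prod asp)); apply: eq_rsum => z _.
  by rewrite /I -rsumZ; apply: eq_rsum => a _; rewrite gE.
have hS (T0 : 'M[R]_n) B0 (j : nat) : 0 <= B0 -> 0 < \det T0 ->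
   `|s ^+ n * rsum [set: 'rV_n] (fun z => expR (- s ^+ 2 * nsq (y' z *m T0))) - C ^+ n / \det T0|
     <= B0 * s ^+ j ->
   s ^+ n * rsum [set: 'rV_n] (fun z => expR (- s ^+ 2 * nsq (y' z *m T0)))
     <= `|C ^+ n / \det T0| + B0.
  move=> B00 dT0; set X := s ^+ n * _; set Y := C ^+ n / _ => HX.
  have : B0 * s ^+ j <= B0 by rewrite ler_piMr // exprn_ile1 // ltW.
  move: HX; rewrite ler_norml => /andP[_]; have := ler_norm Y; lra.
have [K1 K2] := H2 s t' (introT andP (conj s0 ss2)).
have [K3 _] := H3 s t' (introT andP (conj s0 ss3)).
have dh : 0 < \det (h *: T') by have [] := ltrig_unit (ltrigZ h0 tT').
have S2 : s ^+ n * rsum [set: 'rV_n] g' <= D2 by apply: hS K1.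
have S3 : s ^+ n * rsum [set: 'rV_n] g'' <= D3 by apply: hS K3.
have sk0 : 0 <= s ^+ k by rewrite exprn_ge0 // ltW.
have sn0 : 0 < s ^+ n by rewrite exprn_gt0.
have g'0 z : 0 <= g' z by exact: expR_ge0.
have g''0 z : 0 <= g'' z by exact: expR_ge0.
have k1E : s ^+ k1 = s ^+ k * s ^+ n * s * s by rewrite /k1 !exprSr exprD.
have le_ss y : 0 <= y -> y * s * s <= y.
  by move=> y0; rewrite -mulrA ler_piMr // mulr_ile1 // ltW.
pose Cs := C / tau.
have eI z : g' z * I (u z) = s^-1 * (g' z * (s * I (u z) - Cs) + Cs * g' z).
  by field; rewrite !gt_eqF.
have as1 f v : asum f -> (forall z, 0 <= f z) -> (forall z, `|v z| <= f z) ->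
    asum (fun z => v z * (s * I (u z) - Cs)) /\
    `|rsum [set: 'rV_n] (fun z => v z * (s * I (u z) - Cs))| <=
      b1 / tau * s ^+ k1 * rsum [set: 'rV_n] f.
  move=> af f0 vf; have boundary_form z : `|v z * (s * I (u z) - Cs)| <= b1 / tau * s ^+ k1 * f z.
    rewrite normrM mulrC ler_pM //; exact: (HI _).1.
  split; first by apply: asum_bound (asumZ _ af) boundary_form.
  by rewrite -rsumZ; apply: ler_norm_rsum => //; exact: asumZ.
have [asI nI] := as1 g' g' asg' g'0 (fun z => eq_ind_r (fun x => x <= g' z) (lexx _) (ger0_norm (g'0 z))).
have splitI (v : 'rV[int]_n -> R) : asum v -> asum (fun z => v z * (s * I (u z) - Cs)) ->
    rsum [set: 'rV_n] (fun z => v z * I (u z)) =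
    s^-1 * (rsum [set: 'rV_n] (fun z => v z * (s * I (u z) - Cs)) + Cs * rsum [set: 'rV_n] v).
  move=> av avI; rewrite -rsumZ -rsumD -?rsumZ //; last exact: asumZ.
  by apply: eq_rsum => z _; field; rewrite !gt_eqF.
have detE : \det T = tau * \det T' by rewrite eT det_lblock det_scalar1.
have hsk x y z : 0 <= z -> x * s ^+ n <= y -> z * s ^+ k1 * x <= z * y * s ^+ k * s * s.
  move=> z0 xy; rewrite k1E.
  have -> : z * (s ^+ k * s ^+ n * s * s) * x = (z * (x * s ^+ n)) * (s ^+ k * s * s) by ring.
  have -> : z * y * s ^+ k * s * s = (z * y) * (s ^+ k * s * s) by ring.
  by rewrite ler_wpM2r ?ler_wpM2l // !mulr_ge0 // ltW.
have S2' : rsum [set: 'rV_n] g' * s ^+ n <= D2 by rewrite mulrC.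
have S3' : rsum [set: 'rV_n] g'' * s ^+ n <= D3 by rewrite mulrC.
split.
  rewrite Gsum splitI // detE [C ^+ (1 + n)]exprS.
  set X := rsum _ (fun z => g' z * (_ - _)) in nI *; set G := rsum _ g' in S2' nI *.
  have -> : s ^+ (1 + n) * (s^-1 * (X + Cs * G)) - C * C ^+ n / (tau * \det T') =
     s ^+ n * X + Cs * (s ^+ n * G - C ^+ n / \det T').
    by rewrite exprS /Cs; field; rewrite !gt_eqF.
  apply: le_trans (ler_normD _ _) _.
  have x1 : `|s ^+ n * X| <= b1 / tau * D2 * s ^+ k.
    rewrite normrM (gtr0_norm sn0); apply: le_trans (_ : `|X| <= _).
      by rewrite ler_piMl // exprn_ile1 // ltW.
    apply: le_trans nI _; have := hsk _ _ _ bt0 S2'; move=> /le_trans; apply.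
    by apply: le_ss; exact: mulr_ge0.
  have x2 : `|Cs * (s ^+ n * G - C ^+ n / \det T')| <= Ct * B2 * s ^+ k.
    rewrite normrM -mulrA ler_wpM2l //; apply: le_trans K1 _; rewrite exprSr mulrA ler_piMr //.
    exact: mulr_ge0.
  by apply: le_sum4 => //; apply: Or31; exact: lerD.
(* For the first entry the inner sum is the odd sum J, which is already flat. For the other entries
   the inner sum has main term C / (s tau), and smallness comes from the induction hypothesis. *)
move=> j; rewrite -(splitK j); case: (fintype.split j) => i /=.
  rewrite (ord1 i) (reindex_rsum _ be).
  have asF := asum_gauss_lin t (lshift n 0) uT s0.
  rewrite (proj2 (rsum_prod (proj1 (reindex_asum _ be) asF))).
  apply: le_trans (_ : tau * b1 * s ^+ k1 * rsum [set: 'rV_n] g' <= _).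
    rewrite -rsumZ; apply: ler_norm_rsum; first exact: asumZ.
    move=> z; have -> : rsum [set: int] (fun a => ((introw (row_mx a%:M z : 'rV_(1 + n)) + t) *m T)
        0 (lshift n 0) * g (row_mx a%:M z : 'rV_(1 + n))) = g' z * tau * J (u z).
      rewrite /J -rsumZ; apply: eq_rsum => a _; rewrite gE rowE row_mxEl mxE eqxx mulr1n.
      by ring.
    rewrite !normrM (ger0_norm (g'0 z)) (gtr0_norm tau0).
    have -> : tau * b1 * s ^+ k1 * g' z = g' z * tau * (b1 * s ^+ k1) by ring.
    by rewrite ler_wpM2l ?(HI _).2 // mulr_ge0 // ltW.
  have tb0 : 0 <= tau * b1 by rewrite mulr_ge0 // ltW.
  apply: le_trans (hsk _ _ _ tb0 S2') _.
  apply: le_trans (_ : tau * b1 * D2 * s ^+ k <= _).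
    by apply: le_ss; exact: mulr_ge0.
  by apply: le_sum4 => //; exact: Or32.
rewrite (reindex_rsum _ be).
have asF := asum_gauss_lin t (rshift 1 i) uT s0.
rewrite (proj2 (rsum_prod (proj1 (reindex_asum _ be) asF))).
pose v z := (y' z *m T') 0 i * g' z.
have -> : rsum [set: 'rV_n] (fun z => rsum [set: int] (fun a =>
    ((introw (row_mx a%:M z : 'rV_(1 + n)) + t) *m T) 0 (rshift 1 i) *
    g (row_mx a%:M z : 'rV_(1 + n)))) = rsum [set: 'rV_n] (fun z => v z * I (u z)).
  apply: eq_rsum => z _; rewrite /I -rsumZ; apply: eq_rsum => a _.
  by rewrite gE rowE row_mxEr mulrA.
have vb z : `|v z| <= 2 / s * g'' z by exact: gauss_lin_bound.
have asf : asum (fun z => 2 / s * g'' z) by exact: asumZ.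
have f0 z : 0 <= 2 / s * g'' z by rewrite mulr_ge0 // divr_ge0 // ltW.
have asv : asum v by exact: asum_bound vb.
have [avI nvI] := as1 _ _ asf f0 vb; rewrite splitI // mulrDr.
apply: le_trans (ler_normD _ _) _.
have si : 0 < s^-1 by rewrite invr_gt0.
have x1 : `|s^-1 * (Cs * rsum [set: 'rV_n] v)| <= Ct * B2 * s ^+ k.
  rewrite normrM (gtr0_norm si) ler_pdivrMl // normrM.
  have -> : s * (Ct * B2 * s ^+ k) = Ct * (B2 * s ^+ k.+1) by rewrite exprS; ring.
  by rewrite ler_wpM2l ?K2 // normr_ge0.
have x2 : `|s^-1 * rsum [set: 'rV_n] (fun z => v z * (s * I (u z) - Cs))| <=
    b1 / tau * (2 * D3) * s ^+ k.
  rewrite normrM (gtr0_norm si) ler_pdivrMl //; apply: le_trans nvI _.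
  rewrite rsumZ.
  have := hsk _ _ _ bt0 S3'; rewrite -(ler_pM2l (_ : 0 < 2 / s)) ?divr_gt0 //.
  have -> : 2 / s * (b1 / tau * s ^+ k1 * rsum [set: 'rV_n] g'') =
    b1 / tau * s ^+ k1 * (2 / s * rsum [set: 'rV_n] g'') by ring.
  move=> /le_trans; apply; rewrite le_eqVlt; apply/orP; left; apply/eqP.
  by field; rewrite !gt_eqF.
by apply: le_sum4 => //; apply: Or33; exact: lerD.
Qed.

End GaussSums.

Section SupportedSums.
Variable R : realType.

Lemma rsum_inj_supp (T T' : choiceType) (e : T -> T') (f : T' -> R) : injective e ->
  (forall y, f y != 0 -> exists x, e x = y) ->
  rsum [set: T'] f = rsum [set: T] (fun x => f (e x)).
Proof.
move=> ie supp; have be : set_bij [set: T] (range e) e by apply: inj_bij => x y _ _ /ie.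
rewrite -(reindex_rsum f be) [RHS]rsum_mkcond; apply: eq_rsum => y _.
case: ifPn => // /negP h; apply/eqP/negPn/negP => fy0; apply: h.
by have [x xy] := supp y fy0; apply/mem_set; exists x.
Qed.

End SupportedSums.

(** * Determinants of rank-one updates *)

Section Determinants.
Variable R : comNzRingType.

Definition border n (K : 'M[R]_n) (sg : 'rV[R]_n) (A : 'cV[R]_n) : 'M[R]_(1 + n) :=
  block_mx (1%:M : 'M[R]_1) (- sg) A K.

Lemma det_border n (K : 'M[R]_n) sg A : \det (border K sg A) = \det (K + A *m sg).
Proof.
have -> : border K sg A = block_mx (1%:M : 'M[R]_1) 0 A 1%:M *m
   block_mx (1%:M : 'M[R]_1) (- sg) 0 (K + A *m sg).
  by rewrite mulmx_block !mul0mx !mul1mx !mulmx1 !addr0 mulmxN addrCA addNr addr0.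
by rewrite det_mulmx det_lblock det_ublock !det1 !mul1r.
Qed.

Lemma cofactor_border n (K : 'M[R]_n) sg A i :
  cofactor (border K sg A) i (lshift n 0) = cofactor (border K sg 0) i (lshift n 0).
Proof.
rewrite /cofactor; congr (_ * \det _); apply/matrixP => i1 j1; rewrite !mxE.
have -> : lift (lshift n 0) j1 = rshift 1 j1 by apply: val_inj.
by case: fintype.split => k; rewrite !row_mxEr.
Qed.

(** In the bordered matrix A fills a single column, so expansion along it is affine in A with
    cofactors free of A. This is what limits the Gaussian weights to constant and linear ones. *)
Lemma det_rank1 n (K : 'M[R]_n) sg A : \det (K + A *m sg) =
  \det K + \sum_i A i 0 * cofactor (border K sg 0) (rshift 1 i) (lshift n 0).
Proof.
have H B : \det (border K sg B) = cofactor (border K sg 0) (lshift n 0) (lshift n 0) +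
    \sum_i B i 0 * cofactor (border K sg 0) (rshift 1 i) (lshift n 0).
  rewrite (expand_det_col _ (lshift n 0)) big_split_ord big_ord1 /= cofactor_border.
  rewrite {1}/border block_mxEul mxE eqxx mul1r; congr (_ + _); apply: eq_bigr => i _.
  by rewrite cofactor_border {1}/border block_mxEdl.
have := H 0; rewrite det_border mul0mx addr0 big1 ?addr0 => [K0|i _]; last by rewrite mxE mul0r.
by rewrite -det_border H K0.
Qed.

End Determinants.

Section DetBound.
Variable R : realType.

Lemma det_bound n (M : 'M[R]_n) (H : R) : (forall i j, `|M i j| <= H) ->
  `|\det M| <= n`!%:R * H ^+ n.
Proof.
move=> MH; rewrite /determinant (le_trans (ler_norm_sum _ _ _)) //.
rewrite -card_Sn mulr_natl -sumr_const; apply: ler_sum => s _.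
rewrite normrM normrX normrN1 expr1n mul1r normr_prod.
apply: le_trans (_ : \prod_(i < n) H <= _); last by rewrite prodr_const card_ord.
by apply: ler_prod => i _; rewrite normr_ge0 MH.
Qed.

End DetBound.

Section PolMatrices.
Variables (R : realType) (d : nat) (T : choiceType) (N : T -> R).
Hypothesis N_ge1 : forall X, 1 <= N X.
Let E : normedModType R := (R * 'rV[R]_d)%type.

Definition polM m n (F : T -> E -> 'M[R]_(m, n)) : Prop :=
  forall i j, pol N (fun X x => F X x i j).

Lemma pol_ext (P Q : T -> E -> R) : (forall X x, P X x = Q X x) -> pol N P -> pol N Q.
Proof. by move=> PQ; congr pol; apply/funext => X; apply/funext => x. Qed.

Lemma polM_const m n (A : 'M[R]_(m, n)) : polM (fun _ _ => A).
Proof. by move=> i j; exact: pol_const. Qed.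

Lemma polM_mul m n p (F : T -> E -> 'M[R]_(m, n)) (G : T -> E -> 'M[R]_(n, p)) :
  polM F -> polM G -> polM (fun X x => F X x *m G X x).
Proof.
move=> pF pG i j; apply: pol_ext (_ : pol N (fun X x => \sum_k F X x i k * G X x k j)).
  by move=> X x; rewrite mxE.
by apply: pol_sum => // k; exact: pol_mul.
Qed.

Lemma polM_add m n (F G : T -> E -> 'M[R]_(m, n)) :
  polM F -> polM G -> polM (fun X x => F X x + G X x).
Proof.
move=> pF pG i j; apply: pol_ext (pol_add (pF i j) (pG i j)) => X x.
by rewrite mxE.
Qed.

Lemma polM_opp m n (F : T -> E -> 'M[R]_(m, n)) : polM F -> polM (fun X x => - F X x).
Proof. by move=> pF i j; apply: pol_ext (pol_opp N_ge1 (pF i j)) => X x; rewrite mxE. Qed.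

Lemma polM_tr m n (F : T -> E -> 'M[R]_(m, n)) : polM F -> polM (fun X x => (F X x)^T).
Proof. by move=> pF i j; apply: pol_ext (pF j i) => X x; rewrite mxE. Qed.

Lemma polM_scale m n (c : T -> E -> R) (F : T -> E -> 'M[R]_(m, n)) :
  pol N c -> polM F -> polM (fun X x => c X x *: F X x).
Proof.
move=> pc pF i j; apply: pol_ext (pol_mul pc (pF i j)) => X x.
by rewrite mxE.
Qed.

Lemma pol_det n (F : T -> E -> 'M[R]_n) : polM F -> pol N (fun X x => \det (F X x)).
Proof.
move=> pF; apply: pol_sum => // s; apply: pol_mul; first exact: pol_const.
by apply: pol_prod => // i; exact: pF.
Qed.

Lemma pol_sqr (P : T -> E -> R) : pol N P -> pol N (fun X x => P X x ^+ 2).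
Proof. by move=> pP; apply: pol_ext (pol_mul pP pP) => X x; rewrite expr2. Qed.

End PolMatrices.

(** * Residues, quotients and decay in the coordinates *)

Section Coordinates.
Variables (R : realType) (L : nat) (nu : R).
Hypothesis nu0 : 0 < nu.

(* Numbers in nu * Z split into residue and quotient modulo L.+1. *)
Definition crd (rho : 'I_L.+1) (z : int) : R := nu * (rho%:R + L.+1%:R * z%:~R).

Lemma crd_le rho z : `|crd rho z| <= nu * L.+1%:R * wint R z.
Proof.
rewrite normrM (gtr0_norm nu0) -mulrA ler_wpM2l ?(ltW nu0) // /wint mulrDr mulr1.
rewrite (le_trans (ler_normD _ _)) // lerD //.
  by rewrite ger0_norm // ler_nat ltnW.
by rewrite normrM ger0_norm.
Qed.

Lemma crd_eq0 rho z : crd rho z = 0 -> rho = ord0 /\ z = 0.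
Proof.
move/eqP; rewrite mulf_eq0 gt_eqF //= => /eqP h.
have : (rho : nat)%:Z + L.+1%:Z * z = 0.
  apply: (@intr_inj R); rewrite rmorphD rmorphM /=; exact: h.
have := ltn_ord rho; case: z {h} => [[|z]|z].
- by rewrite mulr0 addr0 => _ /eqP; rewrite eqz_nat => /eqP h; split=> //; apply: val_inj.
- by move=> h; rewrite -PoszM -PoszD => /eqP; rewrite eqz_nat addn_eq0 andbC.
- rewrite NegzE mulrN => h /eqP; rewrite subr_eq0 -PoszM eqz_nat => /eqP e.
  by move: h; rewrite e ltnNge leq_pmulr.
Qed.

Lemma crd_ge rho z : crd rho z != 0 -> nu <= `|crd rho z|.
Proof.
rewrite mulf_eq0 gt_eqF //= => h; rewrite normrM (gtr0_norm nu0) ler_peMr ?(ltW nu0) //.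
have e : rho%:R + L.+1%:R * z%:~R = ((rho : nat)%:Z + L.+1%:Z * z)%:~R :> R.
  by rewrite rmorphD rmorphM.
move: h; rewrite e intr_eq0 => h; rewrite -intr_norm -[1]/(1%:~R) ler_int.
by rewrite -gtz0_ge1 normr_gt0.
Qed.

Lemma crd_shift rho z : crd rho z = nu * L.+1%:R * (z%:~R + rho%:R / L.+1%:R).
Proof. by rewrite /crd mulrDr [RHS]mulrDr; field. Qed.

(** Trades the exponential for any power of the weight. The rate of decay degenerates like 1/tau, so
    the loss is a power of tau. *)
Lemma exp_decay_int (k : nat) (A : R) : 0 < A -> exists C, exists K : nat, 0 <= C /\
  forall rho z (tau Q : R), 1 <= tau -> crd rho z ^+ 2 <= A * tau ^+ 2 * Q ->
    expR (- Q) <= C * tau ^+ K / wint R z ^+ k.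
Proof.
move=> A0; set m := nu * L.+1%:R; have m0 : 0 < m by rewrite mulr_gt0.
pose B := 1 + Num.sqrt A / m.
have B0 : 1 <= B by rewrite lerDl divr_ge0 ?sqrtr_ge0 // ltW.
exists (expR 1 * k%:R ^+ k * (8 * B ^+ 2) ^+ k), (2 * k)%N; split.
  have B8 : 0 <= 8 * B ^+ 2 by apply: mulr_ge0 => //; exact: sqr_ge0.
  by apply: mulr_ge0 (exprn_ge0 _ B8); apply: mulr_ge0; rewrite ?expR_ge0 ?exprn_ge0.
move=> rho z tau Q tau1 h.
have tau0 : 0 < tau by lra.
have sA : 0 < Num.sqrt A by rewrite sqrtr_gt0.
(* Chosen so that (r (z + t))^2 is crd^2 / (A tau^2), hence at most Q. *)
pose r := m / (Num.sqrt A * tau).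
have r0 : 0 < r by rewrite divr_gt0 // mulr_gt0.
pose t : R := rho%:R / L.+1%:R.
have t0 : 0 <= t by rewrite divr_ge0.
have t1 : t <= 1 by rewrite ler_pdivrMr // mul1r ler_nat ltnW.
have hQ : (r * (z%:~R + t)) ^+ 2 <= Q.
  have -> : r * (z%:~R + t) = crd rho z / (Num.sqrt A * tau).
    by rewrite crd_shift -/m -/t /r mulrAC.
  rewrite expr_div_n [(Num.sqrt A * tau) ^+ 2]exprMn sqr_sqrtr ?(ltW A0) // ler_pdivrMr ?mulr_gt0 ?exprn_gt0 //.
  by rewrite mulrC.
set Y := (r * (z%:~R + t)) ^+ 2 in hQ.
have Y0 : 0 < 1 + Y by rewrite ltr_pwDl // sqr_ge0.
apply: le_trans (_ : expR (- (1 + Y)) * expR 1 <= _).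
  by rewrite -expRD ler_expR; lra.
have W := shift_weight t z r0.
have w1 := wint_ge1 R z; have w0 := wint_gt0 R z.
have rB : 1 + r^-1 <= B * tau.
  rewrite /r invf_div /B mulrDl mul1r lerD // mulrAC //.
apply: le_trans (_ : k%:R ^+ k * ((1 + Y)^-1) ^+ k * expR 1 <= _).
  rewrite ler_wpM2r ?expR_ge0 // exprVn ler_pdivlMr ?exprn_gt0 //.
  exact: expRN_mul_le (ltW Y0).
have {}W : (1 + Y)^-1 <= 8 * B ^+ 2 * tau ^+ 2 * (wint R z ^+ 2)^-1.
  apply: le_trans W _; rewrite ler_wpM2r ?invr_ge0 ?sqr_ge0 //.
  have -> : 8 * B ^+ 2 * tau ^+ 2 = 2 * (B * tau) ^+ 2 * 2 ^+ 2 by ring.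
  have ri : 0 <= 1 + r^-1 by rewrite addr_ge0 // invr_ge0 ltW.
  have h1 : (1 + r^-1) ^+ 2 <= (B * tau) ^+ 2.
    by rewrite lerXn2r ?nnegrE // (le_trans ri).
  have h2 : (1 + `|t|) ^+ 2 <= 2 ^+ 2.
    by rewrite lerXn2r ?nnegrE ?addr_ge0 // ger0_norm //; lra.
  apply: ler_pM h2; rewrite ?sqr_ge0 //; first by apply: mulr_ge0; rewrite ?sqr_ge0.
  by rewrite ler_wpM2l.
have -> : expR 1 * k%:R ^+ k * (8 * B ^+ 2) ^+ k * tau ^+ (2 * k) / wint R z ^+ k =
   k%:R ^+ k * ((8 * B ^+ 2 * tau ^+ 2) ^+ k / wint R z ^+ k) * expR 1.
  by rewrite exprM [in RHS]exprMn; ring.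
rewrite ler_wpM2r ?expR_ge0 // ler_wpM2l ?exprn_ge0 //.
apply: le_trans (_ : (8 * B ^+ 2 * tau ^+ 2 * (wint R z ^+ 2)^-1) ^+ k <= _).
  rewrite lerXn2r ?nnegrE ?invr_ge0 ?(ltW Y0) //.
  by apply: le_trans W; rewrite invr_ge0 ltW.
have bt : 0 <= 8 * B ^+ 2 * tau ^+ 2.
  by apply: mulr_ge0; rewrite ?sqr_ge0 //; apply: mulr_ge0; rewrite ?sqr_ge0.
rewrite exprMn ler_wpM2l ?(exprn_ge0 _ bt) //.
rewrite exprVn lef_pV2 ?posrE ?exprn_gt0 // lerXn2r ?nnegrE ?sqr_ge0 ?(ltW w0) //.
by rewrite expr2 ler_peMr // ltW.
Qed.

Lemma exp_decay_block (I : finType) (k : nat) (A : R) : 0 < A -> exists C, exists K : nat, 0 <= C /\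
  forall (rho : I -> 'I_L.+1) (z : I -> int) (tau Q : R), 1 <= tau -> 0 <= Q ->
    (forall i, crd (rho i) (z i) ^+ 2 <= A * tau ^+ 2 * Q) ->
    expR (- Q) <= C * tau ^+ K / (\prod_i wint R (z i)) ^+ k.
Proof.
(* Q is shared equally among the coordinates; the successor keeps the divisor positive when [I] is
   empty. *)
move=> A0; pose D : R := #|I|.+1%:R.
have D0 : 0 < D by [].
have [C [K [C0 H]]] := @exp_decay_int k (A * D) (mulr_gt0 A0 D0).
exists (C ^+ #|I|), (K * #|I|)%N; split; first exact: exprn_ge0.
move=> rho z tau Q tau1 Q0 h.
have -> : C ^+ #|I| * tau ^+ (K * #|I|) / (\prod_i wint R (z i)) ^+ k =
   \prod_i (C * tau ^+ K / wint R (z i) ^+ k).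
  by rewrite !big_split /= !prodr_const -prodrXl -prodfV exprM !cardT.
apply: le_trans (_ : \prod_(i : I) expR (- (Q / D)) <= _).
  rewrite prodr_const cardT -cardE -expRM_natr ler_expR mulNr lerN2 mulrAC.
  by rewrite ler_pdivrMr // ler_wpM2l // ler_nat.
apply: ler_prod => i _; rewrite expR_ge0 /=; apply: H (tau1) _.
apply: le_trans (h i) _; rewrite le_eqVlt; apply/orP; left; apply/eqP.
by field; rewrite gt_eqF.
Qed.

End Coordinates.

(** * The theta series in cusp coordinates *)

Section Frobenius.
Variable R : realType.

Definition fsq m n (A : 'M[R]_(m, n)) : R := \sum_i \sum_j A i j ^+ 2.

Lemma fsq_ge0 m n (A : 'M[R]_(m, n)) : 0 <= fsq A.
Proof. by apply: sumr_ge0 => i _; apply: sumr_ge0 => j _; rewrite sqr_ge0. Qed.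

Lemma sqr_le_fsq m n (A : 'M[R]_(m, n)) i j : A i j ^+ 2 <= fsq A.
Proof.
rewrite /fsq (bigD1 i) //= (bigD1 j) //= -addrA lerDl addr_ge0 //.
  by apply: sumr_ge0 => l _; rewrite sqr_ge0.
by apply: sumr_ge0 => k _; apply: sumr_ge0 => l _; rewrite sqr_ge0.
Qed.

Lemma fsq_rows m n (A : 'M[R]_(m, n)) : fsq A = \sum_i nsq (row i A).
Proof. by apply: eq_bigr => i _; apply: eq_bigr => j _; rewrite mxE. Qed.

Lemma fsq_tr m n (A : 'M[R]_(m, n)) : fsq A^T = fsq A.
Proof.
by rewrite /fsq exchange_big /=; apply: eq_bigr => i _; apply: eq_bigr => j _; rewrite mxE.
Qed.

Lemma fsq_coercive m n (Tv : 'M[R]_m) (TG : 'M[R]_n) : Tv \in unitmx -> TG \in unitmx ->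
  exists2 A, 0 < A & forall X : 'M[R]_(m, n), fsq X <= A * fsq (Tv^T *m X *m TG).
Proof.
move=> uv uG; have [A A0 HA] := unit_coercive uv; have [B B0 HB] := unit_coercive uG.
have hr p q (T : 'M[R]_q) D (Y : 'M[R]_(p, q)) : (forall y : 'rV_q, nsq y <= D * nsq (y *m T)) ->
    fsq Y <= D * fsq (Y *m T).
  by move=> H; rewrite !fsq_rows mulr_sumr; apply: ler_sum => i _; rewrite row_mul.
exists (A * B); first exact: mulr_gt0.
move=> X; rewrite -fsq_tr; apply: le_trans (hr _ _ _ _ _ HA) _.
rewrite -mulrA ler_wpM2l ?(ltW A0) // -fsq_tr trmx_mul trmxK.
exact: hr.
Qed.

Lemma fsq_trace m n (Tv : 'M[R]_m) (TG : 'M[R]_n) (X : 'M[R]_(m, n)) :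
  \tr (Tv *m Tv^T *m (X *m (TG *m TG^T) *m X^T)) = fsq (Tv^T *m X *m TG).
Proof.
have trE p q (Y : 'M[R]_(p, q)) : \tr (Y *m Y^T) = fsq Y.
  by apply: eq_bigr => i _; rewrite mxE; apply: eq_bigr => j _; rewrite mxE expr2.
by rewrite -trE !trmx_mul trmxK -mulmxA mxtrace_mulC !mulmxA.
Qed.

Lemma half_sq_le (y q X : R) : 0 < y -> y^-1 ^+ 2 / 2 * X <= q -> X <= 2 * (y ^+ 2 * q).
Proof.
move=> y0 h; have y2 : 0 < 2 * y ^+ 2 by rewrite mulr_gt0 // exprn_gt0.
have := ler_wpM2l (ltW y2) h.
have -> : 2 * y ^+ 2 * (y^-1 ^+ 2 / 2 * X) = X by field; rewrite gt_eqF.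
by rewrite mulrA.
Qed.

End Frobenius.

Section Model.
Variables (R : realType) (n d L : nat) (nu : R).
Hypothesis nu0 : 0 < nu.
Variables (Tv : 'M[R]_n) (TG M : 'M[R]_d).
Hypotheses (tTv : ltrig Tv) (uTG : TG \in unitmx).

Let E : normedModType R := (R * 'rV[R]_d)%type.

(* An index encodes a vector of V^n: ca, cb, cc are its coordinates along u0, u0'
   and W, with v = Tv Tv^T and Gm = TG TG^T the Gram matrix of W.  A point
   x = (s, y) stands for Z(1/s, b) with b = beta x. *)
Definition resid : finType :=
  (('rV['I_L.+1]_n * 'rV['I_L.+1]_n) * 'M['I_L.+1]_(n, d))%type.
Definition ints : choiceType := (('rV[int]_n * 'rV[int]_n) * 'M[int]_(n, d))%type.
Definition idx : choiceType := (resid * ints)%type.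

Definition ca (k : idx) : 'rV[R]_n := \row_i crd nu (k.1.1.1 0 i) (k.2.1.1 0 i).
Definition cb (k : idx) : 'rV[R]_n := \row_i crd nu (k.1.1.2 0 i) (k.2.1.2 0 i).
Definition cc (k : idx) : 'M[R]_(n, d) := \matrix_(i, j) crd nu (k.1.2 i j) (k.2.2 i j).

Definition widx (k : idx) : R := wrow R k.2.1.1 * wrow R k.2.1.2 * wmx R k.2.2.

Let w1 (k : idx) := wrow_ge1 R k.2.1.1.
Let w2 (k : idx) := wrow_ge1 R k.2.1.2.
Let w3 (k : idx) := wmx_ge1 R k.2.2.

Lemma widx_ge1 k : 1 <= widx k.
Proof. by rewrite /widx -[1]mulr1 ler_pM // ?mulr_ege1. Qed.

Lemma asum_widx : asum (fun k => (widx k ^+ 2)^-1).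
Proof.
apply: asum_le (asum_prod (asum_finite (fun _ : resid => 1))
  (asum_prod (asum_prod (asum_wrow R n) (asum_wrow R n)) (asum_wmx R n d))) => k /=.
by rewrite mul1r /widx !exprMn !invfM.
Qed.

Lemma le_prod1 (I : finType) (F : I -> R) i : (forall i, 1 <= F i) -> F i <= \prod_i F i.
Proof.
move=> F1; rewrite (bigD1 i) //= ler_peMr ?(le_trans _ (F1 i)) //.
by elim/big_rec: _ => // j x _ x1; rewrite -[1]mulr1 ler_pM.
Qed.

Let C0 := nu * L.+1%:R.
Let C00 : 0 <= C0. Proof. by rewrite mulr_ge0 // ltW. Qed.

Lemma ca_le k i : `|ca k 0 i| <= C0 * widx k.
Proof.
rewrite mxE (le_trans (crd_le nu0 _ _)) // ler_wpM2l // /widx -mulrA.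
apply: le_trans (@le_prod1 _ (fun i => wint R (k.2.1.1 0 i)) i (fun=> wint_ge1 _ _)) _.
by rewrite ler_peMr ?mulr_ege1 // (le_trans _ (w1 k)).
Qed.

Lemma cb_le k i : `|cb k 0 i| <= C0 * widx k.
Proof.
rewrite mxE (le_trans (crd_le nu0 _ _)) // ler_wpM2l // /widx mulrAC mulrC.
apply: le_trans (@le_prod1 _ (fun i => wint R (k.2.1.2 0 i)) i (fun=> wint_ge1 _ _)) _.
by rewrite ler_peMr ?mulr_ege1 // (le_trans _ (w2 k)).
Qed.

Lemma cc_le k i j : `|cc k i j| <= C0 * widx k.
Proof.
rewrite mxE (le_trans (crd_le nu0 _ _)) // ler_wpM2l // /widx mulrC.
apply: le_trans (_ : wmx R k.2.2 <= _); last first.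
  by rewrite ler_peMr ?mulr_ege1 // (le_trans _ (w3 k)).
apply: le_trans (@le_prod1 _ (fun j => wint R (k.2.2 i j)) j (fun=> wint_ge1 _ _)) _.
apply: (@le_prod1 _ (fun i => \prod_j wint R (k.2.2 i j)) i) => l.
by apply: prodr_ge1 => ?; exact: wint_ge1.
Qed.

Definition Gm : 'M[R]_d := TG *m TG^T.
Definition beta (x : E) : 'rV[R]_d := x.2 *m M.
Definition bb (x : E) : R := (beta x *m Gm *m (beta x)^T) 0 0.
Definition gb (k : idx) (x : E) : 'rV[R]_n := beta x *m Gm *m (cc k)^T.
Definition aA (k : idx) (x : E) : 'rV[R]_n := ca k - 2 *: gb k x + bb x *: cb k.
Definition Xi (k : idx) (x : E) : 'M[R]_(n, d) := cc k - (cb k)^T *m beta x.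

(* tr (v (X, X)_Z) *)
Definition QQ (k : idx) (x : E) : R := fsq (Tv^T *m Xi k x *m TG) +
  (x.1^-1 ^+ 2 / 2 * nsq (cb k *m Tv) + x.1 ^+ 2 / 2 * nsq (aA k x *m Tv)).

Lemma QQ_ge0 k x : 0 <= QQ k x.
Proof.
by rewrite /QQ addr_ge0 ?fsq_ge0 // addr_ge0 // mulr_ge0 ?nsq_ge0 // divr_ge0 // sqr_ge0.
Qed.

(** The coordinates are recovered one after the other from the three squares in [QQ]: a' from the
    second, then c from [Xi] and a', then a from [aA], c and a'. Only the last costs a factor
    1/s. *)
Lemma coord_bound (r : R) : exists2 A, 0 < A & forall k (x : E), 0 < x.1 -> `|x| <= r ->
  [/\ forall i, ca k 0 i ^+ 2 <= A * tpole x ^+ 2 * QQ k x,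
      forall i, cb k 0 i ^+ 2 <= A * tpole x ^+ 2 * QQ k x &
      forall i j, cc k i j ^+ 2 <= A * tpole x ^+ 2 * QQ k x].
Proof.
have [dTv uTv] := ltrig_unit tTv.
have [Av Av0 HAv] := unit_coercive uTv; have [Ag Ag0 HAg] := fsq_coercive uTv uTG.
pose av := Num.sqrt (2 * Av); pose ag := Num.sqrt Ag.
have av0 : 0 <= av by exact: sqrtr_ge0. have ag0 : 0 <= ag by exact: sqrtr_ge0.
pose Br := `|r| * \sum_i \sum_j `|M i j|.
pose gam := \sum_i \sum_j Br * `|Gm i j|.
have Br0 : 0 <= Br by rewrite mulr_ge0 // sumr_ge0 // => i _; rewrite sumr_ge0.
have gam0 : 0 <= gam.
  by apply: sumr_ge0 => i _; apply: sumr_ge0 => j _; exact: mulr_ge0.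
pose a1 := av * `|r|; pose a4 := ag + a1 * Br; pose a5 := av + 2 * (a4 * gam) + gam * Br * a1.
have a10 : 0 <= a1 by exact: mulr_ge0.
have a40 : 0 <= a4 by rewrite addr_ge0 // mulr_ge0.
have ag4 : 0 <= a4 * gam by exact: mulr_ge0.
have gB : 0 <= gam * Br by exact: mulr_ge0.
have gBa : 0 <= gam * Br * a1 by exact: mulr_ge0.
have a50 : 0 <= a5 by apply: addr_ge0 => //; apply: addr_ge0 => //; exact: mulr_ge0.
have asum0 : 0 <= a1 + a4 + a5 by apply: addr_ge0 => //; exact: addr_ge0.
exists (1 + (a1 + a4 + a5) ^+ 2); first by rewrite ltr_pwDl // sqr_ge0.
move=> k x x0 xr; set S := Num.sqrt (QQ k x).
have S0 : 0 <= S by exact: sqrtr_ge0.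
have t1 : 1 <= tpole x by exact: tpole_ge1.
have Q0 := QQ_ge0 k x.
have fin y a : 0 <= a -> a <= a1 + a4 + a5 -> `|y| <= a * tpole x * S ->
    y ^+ 2 <= (1 + (a1 + a4 + a5) ^+ 2) * tpole x ^+ 2 * QQ k x.
  move=> a0 aa ya; rewrite -[y ^+ 2]real_normK ?num_real //.
  apply: le_trans (_ : (a * tpole x * S) ^+ 2 <= _).
    by rewrite lerXn2r ?nnegrE // (le_trans _ ya).
  rewrite !exprMn sqr_sqrtr // ler_wpM2r // ler_wpM2r ?sqr_ge0 //.
  by rewrite (le_trans (_ : _ <= (a1 + a4 + a5) ^+ 2)) ?lerDr // lerXn2r ?nnegrE.
have q1 : fsq (Tv^T *m Xi k x *m TG) <= QQ k x.
  by rewrite lerDl addr_ge0 // mulr_ge0 ?nsq_ge0 // divr_ge0 // sqr_ge0.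
have q2 : x.1^-1 ^+ 2 / 2 * nsq (cb k *m Tv) <= QQ k x.
  by rewrite /QQ addrCA lerDl addr_ge0 ?fsq_ge0 // mulr_ge0 ?nsq_ge0 // divr_ge0 // sqr_ge0.
have q3 : x.1 ^+ 2 / 2 * nsq (aA k x *m Tv) <= QQ k x.
  by rewrite /QQ addrA lerDr addr_ge0 ?fsq_ge0 // mulr_ge0 ?nsq_ge0 // divr_ge0 // sqr_ge0.
have sle (y z : R) : y ^+ 2 <= z -> `|y| <= Num.sqrt z.
  by move=> yz; rewrite -sqrtr_sqr ler_wsqrtr.
have x1r : x.1 <= `|r|.
  by rewrite (le_trans (ler_norm _)) // (le_trans (norm_fst_le x)) // (le_trans xr) // ler_norm.
have xi : 0 < x.1^-1 by rewrite invr_gt0.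
have Av2 : 0 <= 2 * Av by rewrite mulr_ge0 // ltW.
have sq3 y : Num.sqrt (2 * Av * (y ^+ 2 * QQ k x)) = av * (`|y| * S).
  by rewrite (sqrtrM _ Av2) (sqrtrM _ (sqr_ge0 y)) sqrtr_sqr.
have hb i : `|cb k 0 i| <= a1 * S.
  have : cb k 0 i ^+ 2 <= 2 * Av * (x.1 ^+ 2 * QQ k x).
    apply: le_trans (sqr_le_nsq _ _) _; apply: le_trans (HAv _) _.
    rewrite [2 * Av]mulrC -mulrA ler_wpM2l ?(ltW Av0) //.
    exact: half_sq_le.
  move=> /sle; rewrite sq3 => /le_trans; apply.
  by rewrite /a1 -mulrA ler_wpM2l // ler_wpM2r // ger0_norm // ltW.
have hbeta j : `|beta x 0 j| <= Br.
  rewrite mxE (le_trans (ler_norm_sum _ _ _)) // /Br mulr_sumr; apply: ler_sum => i _.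
  rewrite normrM ler_pM //.
    by rewrite (le_trans (norm_snd_le x i)) // (le_trans xr) // ler_norm.
  by rewrite (bigD1 j) //= lerDl sumr_ge0.
have hc i j : `|cc k i j| <= a4 * S.
  have -> : cc k i j = Xi k x i j + cb k 0 i * beta x 0 j.
    rewrite /Xi; move: (cc k) (cb k) (beta x) => c b be; rewrite !mxE big_ord1 !mxE; ring.
  rewrite (le_trans (ler_normD _ _)) // mulrDl lerD //.
    apply: le_trans (_ : Num.sqrt (Ag * QQ k x) <= _); last by rewrite sqrtrM // ltW.
    apply: sle; apply: le_trans (sqr_le_fsq _ _ _) _; apply: le_trans (HAg _) _.
    by rewrite ler_wpM2l // ltW.
  by rewrite normrM mulrAC ler_pM.
have hbG j : `|(beta x *m Gm) 0 j| <= \sum_i Br * `|Gm i j|.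
  rewrite mxE (le_trans (ler_norm_sum _ _ _)) //; apply: ler_sum => i _.
  by rewrite normrM ler_wpM2r.
have gamE : \sum_j \sum_i Br * `|Gm i j| = gam by rewrite exchange_big.
have hg i : `|gb k x 0 i| <= a4 * gam * S.
  rewrite /gb mxE (le_trans (ler_norm_sum _ _ _)) // -gamE mulrAC mulr_sumr.
  apply: ler_sum => j _; rewrite normrM mulrC ler_pM // mxE; exact: hc.
have hbb : `|bb x| <= gam * Br.
  rewrite /bb mxE (le_trans (ler_norm_sum _ _ _)) // -gamE mulr_suml.
  by apply: ler_sum => j _; rewrite normrM ler_pM // mxE.
have ha i : `|ca k 0 i| <= a5 * tpole x * S.
  have -> : ca k 0 i = aA k x 0 i + 2 * gb k x 0 i - bb x * cb k 0 i.
    rewrite /aA; move: (ca k) (cb k) (gb k x) (bb x) => a b g0 b0; rewrite !mxE; ring.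
  have g1 : `|aA k x 0 i| <= av * tpole x * S.
    have : aA k x 0 i ^+ 2 <= 2 * Av * (x.1^-1 ^+ 2 * QQ k x).
      apply: le_trans (sqr_le_nsq _ _) _; apply: le_trans (HAv _) _.
      rewrite [2 * Av]mulrC -mulrA ler_wpM2l ?(ltW Av0) //.
      by apply: half_sq_le => //; rewrite invrK.
    move=> /sle; rewrite sq3 => /le_trans; apply.
    rewrite -mulrA ler_wpM2l // ler_wpM2r // ger0_norm ?(ltW xi) //.
    by rewrite /tpole lerDr.
  have g2 : `|2 * gb k x 0 i| <= 2 * (a4 * gam) * tpole x * S.
    rewrite normrM ger0_norm // -!mulrA ler_wpM2l // mulrA.
    apply: le_trans (hg i) _; by rewrite !mulrA ler_wpM2r // ler_peMr.
  have g3 : `|bb x * cb k 0 i| <= gam * Br * a1 * tpole x * S.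
    rewrite normrM; apply: le_trans (ler_pM _ _ hbb (hb i)) _ => //.
    by rewrite [leLHS]mulrA ler_wpM2r // ler_peMr.
  rewrite (le_trans (ler_normB _ _)) // (le_trans (lerD (ler_normD _ _) (lexx _))) //.
  have -> : a5 * tpole x * S = av * tpole x * S + 2 * (a4 * gam) * tpole x * S +
      gam * Br * a1 * tpole x * S by rewrite /a5 -!mulrDl.
  by apply: lerD => //; exact: lerD.
split=> [i|i|i j].
- by apply: (fin _ a5) (ha i) => //; rewrite lerDr addr_ge0.
- apply: (fin _ a1) => //; first by rewrite -addrA lerDl addr_ge0.
  by apply: le_trans (hb i) _; rewrite ler_wpM2r // ler_peMr.
- apply: (fin _ a4) => //; first by rewrite addrAC lerDr addr_ge0.
  by apply: le_trans (hc i j) _; rewrite ler_wpM2r // ler_peMr.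
Qed.

Lemma QQ_decay (r : R) (k : nat) : exists C, exists K : nat, 0 <= C /\
  forall X (x : E), 0 < x.1 -> `|x| <= r -> expR (- QQ X x) <= C * tpole x ^+ K / widx X ^+ k.
Proof.
have [A A0 HA] := coord_bound r.
have A3 : 0 < A * 3 by rewrite mulr_gt0.
have [Ca [Ka [Ca0 Ha]]] := @exp_decay_block R L nu nu0 'I_n k _ A3.
have [Cc [Kc [Cc0 Hc]]] := @exp_decay_block R L nu nu0 ('I_n * 'I_d)%type k _ A3.
exists (Ca * Ca * Cc), (Ka + Ka + Kc)%N; split; first by rewrite !mulr_ge0.
move=> X x x0 xr; have [h1 h2 h3] := HA X x x0 xr.
have t1 := tpole_ge1 x0; have Q0 := QQ_ge0 X x.
have Q3 : 0 <= QQ X x / 3 by rewrite divr_ge0.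
have e3 : A * 3 * tpole x ^+ 2 * (QQ X x / 3) = A * tpole x ^+ 2 * QQ X x by field.
(* One third of the exponent for each of the blocks a, a' and c. *)
have -> : - QQ X x = - (QQ X x / 3) + - (QQ X x / 3) + - (QQ X x / 3) by field.
rewrite !expRD.
have k1 := Ha (fun i => X.1.1.1 0 i) (fun i => X.2.1.1 0 i) _ _ t1 Q3.
have k2 := Ha (fun i => X.1.1.2 0 i) (fun i => X.2.1.2 0 i) _ _ t1 Q3.
have k3 := Hc (fun i => X.1.2 i.1 i.2) (fun i => X.2.2 i.1 i.2) _ _ t1 Q3.
have -> : Ca * Ca * Cc * tpole x ^+ (Ka + Ka + Kc) / widx X ^+ k =
  (Ca * tpole x ^+ Ka / wrow R X.2.1.1 ^+ k) * (Ca * tpole x ^+ Ka / wrow R X.2.1.2 ^+ k) *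
  (Cc * tpole x ^+ Kc / wmx R X.2.2 ^+ k).
  by rewrite /widx !exprD !exprMn !invfM; ring.
rewrite !ler_pM ?mulr_ge0 ?expR_ge0 //.
- by apply: k1 => i; rewrite e3; have := h1 i; rewrite mxE.
- by apply: k2 => i; rewrite e3; have := h2 i; rewrite mxE.
- have -> : wmx R X.2.2 = \prod_i wint R (X.2.2 i.1 i.2) by rewrite /wmx pair_big.
  by apply: k3 => i; rewrite e3; have := h3 i.1 i.2; rewrite mxE.
Qed.

Let N1 := widx_ge1.

Lemma polM_ca : polM widx (fun k (_ : E) => ca k).
Proof.
move=> i j; rewrite (ord1 i); apply: (@pol_idx _ _ _ _ (fun k => ca k 0 j) C0) => k; exact: ca_le.
Qed.

Lemma polM_cb : polM widx (fun k (_ : E) => cb k).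
Proof.
move=> i j; rewrite (ord1 i); apply: (@pol_idx _ _ _ _ (fun k => cb k 0 j) C0) => k; exact: cb_le.
Qed.

Lemma polM_cc : polM widx (fun k (_ : E) => cc k).
Proof. move=> i j; apply: (@pol_idx _ _ _ _ (fun k => cc k i j) C0) => k; exact: cc_le. Qed.

Lemma polM_beta : polM widx (fun (_ : idx) x => beta x).
Proof.
apply: polM_mul; [exact: N1| |exact: polM_const].
by move=> i j; rewrite (ord1 i); exact: pol_y.
Qed.

Lemma polM_betaG : polM widx (fun (_ : idx) x => beta x *m Gm).
Proof. by apply: polM_mul; [exact: N1|exact: polM_beta|exact: polM_const]. Qed.

Lemma pol_bb : pol widx (fun (_ : idx) x => bb x).
Proof.
by apply: (polM_mul N1 polM_betaG) => i j; apply: polM_tr; exact: polM_beta.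
Qed.

Lemma polM_gb : polM widx gb.
Proof. by apply: (polM_mul N1 polM_betaG); apply: polM_tr; exact: polM_cc. Qed.

Lemma polM_aA : polM widx aA.
Proof.
apply: polM_add; last by apply: polM_scale; [exact: pol_bb|exact: polM_cb].
apply: polM_add; first exact: polM_ca.
by apply: polM_opp; [exact: N1|]; apply: polM_scale; [exact: pol_const|exact: polM_gb].
Qed.

Lemma polM_Xi : polM widx Xi.
Proof.
apply: polM_add; first exact: polM_cc.
apply: polM_opp; [exact: N1|]; apply: polM_mul; [exact: N1| |exact: polM_beta].
by apply: polM_tr; exact: polM_cb.
Qed.

Lemma pol_QQ : pol widx QQ.
Proof.
have sq (c : idx -> E -> R) (F : idx -> E -> 'rV[R]_n) : pol widx c -> polM widx F ->
    pol widx (fun k x => c k x * nsq (F k x *m Tv)).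
  move=> pc pF; apply: pol_mul => //; apply: pol_sum => [|j]; first exact: N1.
  by apply: pol_sqr; apply: (polM_mul N1 pF); exact: polM_const.
apply: pol_add.
  apply: pol_sum => [|i]; first exact: N1.
  apply: pol_sum => [|j]; first exact: N1.
  apply: pol_sqr; apply: (polM_mul N1); last exact: polM_const.
  by apply: (polM_mul N1); [exact: polM_const|exact: polM_Xi].
apply: pol_add.
  apply: (sq (fun _ x => x.1^-1 ^+ 2 / 2)); last exact: polM_cb.
  by apply: pol_mul; [apply: pol_sqr; exact: pol_sV|exact: pol_const].
apply: (sq (fun _ x => x.1 ^+ 2 / 2)); last exact: polM_aA.
by apply: pol_mul; [apply: pol_sqr; exact: pol_s|exact: pol_const].
Qed.

Definition qpi (k : idx) (x : E) : R := - pi * QQ k x.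

Lemma pol_qpi : pol widx qpi.
Proof. by apply: pol_mul; [exact: pol_const|exact: pol_QQ]. Qed.

(** From pi >= 2. In [flat_nz] one copy of the exponential makes the series summable and the other
    gives flatness. *)
Lemma qpi_le k x : expR (qpi k x) <= expR (- QQ k x) * expR (- QQ k x).
Proof.
rewrite -expRD ler_expR /qpi mulNr -opprD lerN2 -mulr2n -mulr_natl ler_wpM2r ?QQ_ge0 //.
exact: pi_ge2.
Qed.

Lemma qpi_decay (r : R) (k : nat) : exists C, exists K : nat, 0 <= C /\
  forall X (x : E), 0 < x.1 -> `|x| <= r -> expR (qpi X x) <= C * tpole x ^+ K / widx X ^+ k.
Proof.
have [C [K [C1 H]]] := QQ_decay r k; exists C, K; split=> // X x x0 xr.
apply: le_trans (H X x x0 xr); rewrite ler_expR /qpi mulNr lerN2 ler_peMl ?QQ_ge0 //.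
by rewrite (le_trans _ (pi_ge2 R)) // ler1n.
Qed.

(** [ph] stands for the factors of a summand that do not depend on the point: coset indicator,
    normalisation, and cosine or sine of the phase. *)
Variables (w : 'I_n -> E) (ph : idx -> R) (Ph : R).
Hypothesis ph_le : forall k, `|ph k| <= Ph.

(* pairing_mx k x is the matrix ((x_i, dZ(w_j))). *)
Definition sg : 'rV[R]_n := \row_j (w j).1.
Definition Wm : 'M[R]_(n, d) := \matrix_j ((w j).2 *m M).
Definition rw (x : E) : 'rV[R]_n :=
  - 2^-1 *: ((bb x - x.1^-1 ^+ 2) *: sg + (2 * x.1) *: (beta x *m Gm *m Wm^T)).
Definition pairing_mx (k : idx) (x : E) : 'M[R]_n :=
  (cb k)^T *m rw x + (gb k x - 2^-1 *: ca k)^T *m sg + x.1 *: (cc k *m Gm *m Wm^T).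

Definition pw (k : idx) (x : E) : R := ph k * \det (pairing_mx k x).

Lemma pol_pw : pol widx pw.
Proof.
apply: pol_mul.
  by apply: (@pol_idx _ _ _ _ ph Ph) => k; rewrite (le_trans (ph_le k)) // ler_peMr ?N1 //
    (le_trans _ (ph_le k)).
apply: pol_det; first exact: N1.
apply: polM_add.
  apply: polM_add; apply: (polM_mul N1); do ?exact: polM_const.
  - by apply: polM_tr; exact: polM_cb.
  - apply: polM_scale; first exact: pol_const.
    apply: polM_add; apply: polM_scale; do ?exact: polM_const.
    + apply: pol_add; first exact: pol_bb.
      by apply: pol_opp; [exact: N1|apply: pol_sqr; exact: pol_sV].
    + by apply: pol_mul; [exact: pol_const|exact: pol_s].
    + by apply: (polM_mul N1 polM_betaG); exact: polM_const.
  - apply: polM_tr; apply: polM_add; first exact: polM_gb.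
    by apply: polM_opp; [exact: N1|]; apply: polM_scale; [exact: pol_const|exact: polM_ca].
apply: polM_scale; first exact: pol_s.
apply: (polM_mul N1); last exact: polM_const.
by apply: (polM_mul N1 polM_cc); exact: polM_const.
Qed.

(** Discreteness: a nonzero coordinate has modulus at least nu, so the square carrying s^-2 cannot
    be small. *)
Lemma QQ_ge_of_cb_neq0 k (x : E) : cb k != 0 -> 0 < x.1 ->
  forall A, 0 < A -> (forall y : 'rV_n, nsq y <= A * nsq (y *m Tv)) ->
  nu ^+ 2 / (2 * A) * x.1^-1 ^+ 2 <= QQ k x.
Proof.
move=> cb0 x0 A A0 HA.
have [i ci] : exists i, cb k 0 i != 0.
  apply/existsP; apply: contraNT cb0; rewrite negb_exists => /forallP h.
  by apply/eqP/rowP => i; rewrite [RHS]mxE; apply/eqP; move: (h i); rewrite negbK.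
have h1 : nu ^+ 2 <= nsq (cb k).
  apply: le_trans (sqr_le_nsq _ i); rewrite -[leRHS]real_normK ?num_real //.
  by rewrite lerXn2r ?nnegrE ?(ltW nu0) //; move: ci; rewrite mxE; exact: crd_ge.
apply: le_trans (_ : x.1^-1 ^+ 2 / 2 * nsq (cb k *m Tv) <= _); last first.
  by rewrite /QQ addrCA lerDl addr_ge0 ?fsq_ge0 // mulr_ge0 ?nsq_ge0 // divr_ge0 // sqr_ge0.
have h2 : nu ^+ 2 / A <= nsq (cb k *m Tv).
  by rewrite ler_pdivrMr // mulrC (le_trans h1).
have -> : nu ^+ 2 / (2 * A) * x.1^-1 ^+ 2 = x.1^-1 ^+ 2 / 2 * (nu ^+ 2 / A).
  by field; rewrite !gt_eqF.
by rewrite ler_wpM2l // divr_ge0 // sqr_ge0.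
Qed.

(* The sum over the indices with a' <> 0. *)
Definition Fnz (x : E) : R :=
  rsum [set: idx] (fun k => if cb k != 0 then pterm qpi pw k x else 0).

Lemma flat_nz : flat Fnz.
Proof.
move=> r m; have [_ uTv] := ltrig_unit tTv; have [A A0 HA] := unit_coercive uTv.
have [C [K [C1 H]]] := @grows_pterm _ _ _ _ N1 _ QQ_decay _ _ _ (fun=> ler01) (pol_grows N1 pol_pw) r.
pose kap := nu ^+ 2 / (2 * A).
have kap0 : 0 < kap by rewrite divr_gt0 ?mulr_gt0 // exprn_gt0.
(* The factor exp(-kap/s^2) is bounded by a multiple of s^(2m'); with m' = K + m this outweighs the
   pole s^-K and leaves s^m. *)
pose m' := (K + m)%N.
pose D := C * 2 ^+ K * (m'%:R ^+ m' / kap ^+ m').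
have D0 : 0 <= D.
  by rewrite mulr_ge0 ?mulr_ge0 ?exprn_ge0 // invr_ge0 exprn_ge0 // ltW.
pose S := rsum [set: idx] (fun k => (widx k ^+ 2)^-1).
have S0 : 0 <= S by apply: rsum_ge0 => k; rewrite invr_ge0 sqr_ge0.
exists (D * S), 1; split=> //; first exact: mulr_ge0.
move=> x x0 x1 xr; rewrite mulrAC -rsumZ.
apply: ler_norm_rsum; first exact/asumZ/asum_widx.
move=> k; have wk : 0 <= (widx k ^+ 2)^-1 by rewrite invr_ge0 sqr_ge0.
case: ifPn => [cbk|_]; last first.
  by rewrite normr0 mulr_ge0 // mulr_ge0 // exprn_ge0 // ltW.
have Hk := H tt k x x0 xr; rewrite mul1r in Hk.
rewrite /pterm normrM (ger0_norm (expR_ge0 _)).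
apply: le_trans (ler_wpM2l (normr_ge0 _) (qpi_le k x)) _; rewrite mulrA.
apply: le_trans (_ : C * tpole x ^+ K * (widx k ^+ 2)^-1 * expR (- QQ k x) <= _).
  rewrite ler_wpM2r ?expR_ge0 //; apply: le_trans Hk.
  by rewrite /pterm [leRHS]normrM (ger0_norm (expR_ge0 _)).
rewrite mulrAC ler_wpM2r //.
have e1 : expR (- QQ k x) <= m'%:R ^+ m' / kap ^+ m' * (x.1 ^+ m' * x.1 ^+ m').
  apply: le_trans (_ : expR (- (kap * x.1^-1 ^+ 2)) <= _).
    by rewrite ler_expR lerN2; exact: QQ_ge_of_cb_neq0.
  have y0 : 0 < kap * x.1^-1 ^+ 2 by rewrite mulr_gt0 // exprn_gt0 // invr_gt0.
  have := expRN_mul_le m' (ltW y0).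
  rewrite -ler_pdivlMr ?exprn_gt0 // => /le_trans; apply.
  rewrite exprMn -exprM mulnC exprM le_eqVlt; apply/orP; left; apply/eqP.
  by rewrite exprVn; field; rewrite !expf_neq0 // gt_eqF.
have e2 : tpole x ^+ K <= 2 ^+ K * x.1 ^- K.
  rewrite -exprVn -exprMn lerXn2r ?nnegrE ?mulr_ge0 ?invr_ge0 ?(ltW x0) //.
    by rewrite (le_trans _ (tpole_ge1 x0)).
  have : 1 <= x.1^-1 by rewrite -[1]invr1 lef_pV2 ?posrE.
  by rewrite /tpole; lra.
have xK : 0 < x.1 ^+ K by rewrite exprn_gt0.
apply: le_trans (ler_pM _ _ (ler_wpM2l C1 e2) e1) _.
- by rewrite mulr_ge0 // exprn_ge0 // (le_trans _ (tpole_ge1 x0)).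
- exact: expR_ge0.
have -> : C * (2 ^+ K * x.1 ^- K) * (m'%:R ^+ m' / kap ^+ m' * (x.1 ^+ m' * x.1 ^+ m')) =
   D * x.1 ^+ m * x.1 ^+ m'.
  have -> : x.1 ^+ m' = x.1 ^+ K * x.1 ^+ m by rewrite exprD.
  by rewrite /D; field; rewrite !expf_neq0 // gt_eqF.
apply: ler_piMr; last by rewrite exprn_ile1 // ltW.
by apply: mulr_ge0 => //; rewrite exprn_ge0 // ltW.
Qed.

(* The indices with a' = 0: idx0 keeps the residue of a and the coordinate c; the
   remaining integer vector of emb0 is the variable of the Gaussian sum. *)
Definition resid0 : finType := ('rV['I_L.+1]_n * 'M['I_L.+1]_(n, d))%type.
Definition idx0 : choiceType := (resid0 * 'M[int]_(n, d))%type.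

Definition emb0 (t : idx0 * 'rV[int]_n) : idx :=
  (((t.1.1.1, const_mx ord0), t.1.1.2), ((t.2, 0), t.1.2)).

Lemma emb0_inj : injective emb0.
Proof. by move=> [[[a b] c] e] [[[a' b'] c'] e'] [-> -> -> ->]. Qed.

Lemma cb_emb0 t : cb (emb0 t) = 0.
Proof. by apply/rowP => i; rewrite !mxE /crd mulr0 addr0 mulr0. Qed.

Lemma cb_eq0 k : cb k = 0 -> exists t, emb0 t = k.
Proof.
case: k => [[[ra rb] rc] [[za zb] zc]] h.
have h' i : rb 0 i = ord0 /\ zb 0 i = 0.
  by apply: (crd_eq0 nu0); move/rowP: h => /(_ i); rewrite !mxE.
exists (((ra, rc), zc), za); rewrite /emb0 /=; congr (((_, _), _), ((_, _), _)).
  by apply/rowP => i; have [<- _] := h' i; rewrite mxE.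
by apply/rowP => i; rewrite mxE; have [_ ->] := h' i.
Qed.

Definition cc0 (t : idx0) : 'M[R]_(n, d) := \matrix_(i, j) crd nu (t.1.2 i j) (t.2 i j).

Lemma cc_emb0 t z : cc (emb0 (t, z)) = cc0 t.
Proof. by []. Qed.

Definition K0 (t : idx0) : 'M[R]_n := cc0 t *m Gm *m Wm^T.

Variable ph0 : idx0 -> R.
Hypothesis ph_emb0 : forall t z, ph (emb0 (t, z)) = ph0 t.

Let L1 : R := L.+1%:R.
Let nL : R := nu * L1.
Let nL0 : 0 < nL. Proof. by rewrite mulr_gt0. Qed.

Definition sh (t : idx0) (x : E) : 'rV[R]_n :=
  \row_i ((t.1.1 0 i)%:R / L1) - (2 / nL) *: (beta x *m Gm *m (cc0 t)^T).

Lemma aA_emb0 t z x : aA (emb0 (t, z)) x = nL *: (introw R z + sh t x).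
Proof.
rewrite /aA cb_emb0 scaler0 addr0 /gb cc_emb0 /sh addrA scalerDr scalerN scalerA.
congr (_ - _ *: _); last by field; rewrite gt_eqF.
by apply/rowP => i; rewrite !mxE crd_shift -/L1 -/nL.
Qed.

(** Normalised so that the exponent pi s^2/2 |A Tv|^2 of the a' = 0 terms becomes s^2 |(z + sh)
    Tg|^2, as in [gauss_const]. *)
Definition Tg : 'M[R]_n := (Num.sqrt (pi / 2) * nL) *: Tv.

Lemma Tg_ltrig : ltrig Tg.
Proof. by apply: ltrigZ => //; rewrite mulr_gt0 // sqrtr_gt0 divr_gt0 // pi_gt0. Qed.

Definition g0 (t : idx0) : R := expR (- pi * fsq (Tv^T *m cc0 t *m TG)).

Lemma qpi_emb0 t z x : expR (qpi (emb0 (t, z)) x) =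
  g0 t * expR (- x.1 ^+ 2 * nsq ((introw R z + sh t x) *m Tg)).
Proof.
rewrite -expRD; congr expR; rewrite /qpi /QQ cb_emb0 mul0mx [nsq 0]big1; last first.
  by move=> i _; rewrite mxE expr0n.
rewrite mulr0 add0r /Xi cb_emb0 trmx0 mul0mx subr0 cc_emb0 mulrDr; congr (_ + _).
rewrite aA_emb0 /Tg -scalemxAl -scalemxAr !nsqZ [(_ * nL) ^+ 2]exprMn sqr_sqrtr; last by rewrite divr_ge0 ?pi_ge0.
by field.
Qed.

(** The first term carries exactly the s^n that cancels the pole of the Gaussian sum; all others are
    linear in the summation variable and contribute flat functions. *)
Lemma det_emb0 t z x : \det (pairing_mx (emb0 (t, z)) x) = x.1 ^+ n * \det (K0 t) +
  \sum_i (- (nL / 2) * (introw R z + sh t x) 0 i) *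
    cofactor (border (x.1 *: K0 t) sg 0) (rshift 1 i) (lshift n 0).
Proof.
rewrite /pairing_mx cb_emb0 trmx0 mul0mx add0r cc_emb0 -/(K0 t) addrC det_rank1 detZ; congr (_ + _).
apply: eq_bigr => i _; congr (_ * _).
have -> : gb (emb0 (t, z)) x - 2^-1 *: ca (emb0 (t, z)) = - 2^-1 *: aA (emb0 (t, z)) x.
  rewrite /aA cb_emb0 scaler0 addr0; move: (gb _ x) (ca _) => g' a'.
  by apply/rowP => j; rewrite !mxE; field.
by rewrite mxE aA_emb0 scalerA mxE; congr (_ * _); field.
Qed.

Lemma g0_decay (k : nat) : exists2 C, 0 <= C & forall t : idx0,
  g0 t <= C / wmx R t.2 ^+ k.
Proof.
have [_ uTv] := ltrig_unit tTv; have [Ag Ag0 HAg] := fsq_coercive uTv uTG.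
have [C [K [C1 H]]] := @exp_decay_block R L nu nu0 ('I_n * 'I_d)%type k _ Ag0.
exists C => // t; have f0 := fsq_ge0 (Tv^T *m cc0 t *m TG).
apply: le_trans (_ : expR (- fsq (Tv^T *m cc0 t *m TG)) <= _).
  by rewrite ler_expR mulNr lerN2 ler_peMl // (le_trans _ (pi_ge2 R)) // ler1n.
apply: le_trans (H (fun i => t.1.2 i.1 i.2) (fun i => t.2 i.1 i.2) 1 _ (lexx _) f0 _) _; last first.
  by rewrite expr1n mulr1 /wmx pair_big.
move=> i; rewrite expr1n mulr1; apply: le_trans (HAg _); apply: le_trans (sqr_le_fsq _ i.1 i.2).
by rewrite mxE.
Qed.

Lemma cc0_le t i j : `|cc0 t i j| <= C0 * wmx R t.2.
Proof.
rewrite mxE (le_trans (crd_le nu0 _ _)) // ler_wpM2l //.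
apply: le_trans (@le_prod1 _ (fun j => wint R (t.2 i j)) j (fun=> wint_ge1 _ _)) _.
apply: (@le_prod1 _ (fun i => \prod_j wint R (t.2 i j)) i) => l.
by apply: prodr_ge1 => ?; exact: wint_ge1.
Qed.

Lemma minors_le : exists2 D, 0 <= D & forall t,
  `|\det (K0 t)| <= D * wmx R t.2 ^+ n /\
  forall s i, 0 < s -> s <= 1 ->
    `|cofactor (border (s *: K0 t) sg 0) (rshift 1 i) (lshift n 0)| <= D * wmx R t.2 ^+ n.
Proof.
pose kap := \sum_l \sum_j `|(Gm *m Wm^T) l j|.
have kap0 : 0 <= kap by apply: sumr_ge0 => l _; apply: sumr_ge0.
pose H := 1 + \sum_j `|sg 0 j| + C0 * kap.
have sg0 : 0 <= \sum_j `|sg 0 j| by apply: sumr_ge0.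
have ck0 : 0 <= C0 * kap by apply: mulr_ge0.
have H1 : 1 <= H by rewrite /H; lra.
exists (n`!%:R * H ^+ n); first by rewrite mulr_ge0 // exprn_ge0 //; lra.
move=> t; set W := wmx R t.2; have W1 : 1 <= W by exact: wmx_ge1.
have W0 : 0 <= W by lra.
have Kle i j : `|K0 t i j| <= C0 * kap * W.
  rewrite /K0 -mulmxA mxE (le_trans (ler_norm_sum _ _ _)) // mulrAC /kap mulr_sumr.
  apply: ler_sum => l _; rewrite normrM ler_pM //; first exact: cc0_le.
  by rewrite (bigD1 j) //= lerDl sumr_ge0.
have HW : 1 + \sum_j `|sg 0 j| + C0 * kap * W <= H * W.
  have h1 : \sum_j `|sg 0 j| <= (\sum_j `|sg 0 j|) * W by rewrite ler_peMr.
  by rewrite /H !mulrDl mul1r; lra.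
have ckW : 0 <= C0 * kap * W by apply: mulr_ge0.
rewrite -mulrA -exprMn; split.
  by apply: det_bound => i j; apply: le_trans (Kle i j) _; lra.
move=> s i s0 s1; rewrite normrM normrX normrN1 expr1n mul1r.
apply: det_bound => i1 j1; rewrite !mxE.
case: fintype.split => a; rewrite !mxE; case: fintype.split => b; rewrite ?mxE.
- by case: (_ == _); rewrite ?normr1 ?normr0; lra.
- rewrite normrN; apply: le_trans HW.
  have : `|(w b).1| <= \sum_j `|sg 0 j| by rewrite (bigD1 b) //= mxE lerDl sumr_ge0.
  by lra.
- by rewrite normr0; lra.
- apply: le_trans (_ : `|K0 t a b| <= _).
    by rewrite normrM /K0 [(_ *m Wm^T) a b]mxE ler_piMl // gtr0_norm.
  by apply: le_trans (Kle a b) _; lra.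
Qed.

Lemma asum_idx0 : asum (fun t : idx0 => (wmx R t.2 ^+ 2)^-1).
Proof.
apply: asum_le (asum_prod (asum_finite (fun _ : resid0 => 1)) (asum_wmx R n d)) => t /=.
by rewrite mul1r.
Qed.

Definition Fz (x : E) : R :=
  rsum [set: idx] (fun k => if cb k == 0 then pterm qpi pw k x else 0).

(** Up to the factor Cg^n / det Tg, the limit at s = 0 of the sum over z of the terms with index
    [emb0 (t, z)]. *)
Definition bterm (t : idx0) : R := ph0 t * g0 t * \det (K0 t).

Lemma ph0_le t : `|ph0 t| <= Ph.
Proof. by rewrite -(ph_emb0 t 0). Qed.

Lemma bterm_bound : exists2 D, 0 <= D & forall t, `|bterm t| <= D * (wmx R t.2 ^+ 2)^-1.
Proof.
(* n powers of the weight for the n x n minors, two for summability over t. *)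
have [C C1 H] := g0_decay (n + 2); have [D D0 HD] := minors_le.
have Ph0 : 0 <= Ph by exact: le_trans (ph_le (((const_mx ord0, const_mx ord0), const_mx ord0), ((0, 0), 0))).
exists (Ph * C * D); first by rewrite !mulr_ge0.
move=> t; have [h1 _] := HD t.
have W0 : 0 < wmx R t.2 by exact: lt_le_trans (wmx_ge1 _ _).
rewrite /bterm !normrM (ger0_norm (expR_ge0 _)).
apply: le_trans (ler_pM _ _ (ler_pM _ _ (ph0_le t) (H t)) h1) _ => //.
- by rewrite mulr_ge0 // expR_ge0.
- exact: expR_ge0.
rewrite exprD le_eqVlt; apply/orP; left; apply/eqP; field.
by rewrite ?expf_neq0 ?gt_eqF.
Qed.

Lemma asum_bterm : asum bterm.
Proof. by have [D D0 H] := bterm_bound; apply: asum_bound (asumZ _ asum_idx0) H. Qed.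

Lemma pterm_emb0 t z x : pterm qpi pw (emb0 (t, z)) x = ph0 t * g0 t *
  (\det (K0 t) * x.1 ^+ n * expR (- x.1 ^+ 2 * nsq ((introw R z + sh t x) *m Tg)) +
   \sum_i cofactor (border (x.1 *: K0 t) sg 0) (rshift 1 i) (lshift n 0) * (- (nL / 2)) *
     ((introw R z + sh t x) 0 i * expR (- x.1 ^+ 2 * nsq ((introw R z + sh t x) *m Tg)))).
Proof.
rewrite /pterm /pw ph_emb0 qpi_emb0 det_emb0; set g := expR _; set y := introw R z + _.
rewrite -!mulrA; congr (_ * _); rewrite mulrCA; congr (_ * _).
rewrite mulrDl; congr (_ + _); first by ring.
by rewrite mulr_suml; apply: eq_bigr => i _; ring.
Qed.

Lemma flat_z Cg : gauss_const Cg ->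
  flat (fun x => Fz x - Cg ^+ n / \det Tg * rsum [set: idx0] bterm).
Proof.
move=> HC r m; have [B [s0 [B0 /andP[s00 s01] HB]]] := HC n Tg m Tg_ltrig.
have [D D0 HD] := minors_le; have [Cd Cd0 Hg0] := g0_decay (n + 2).
have [dTg uTg] := ltrig_unit Tg_ltrig.
(* [gauss_const] controls the entries of y Tg, whereas the determinant contains those of y; the
   inverse of Tg passes from one to the other. *)
pose ti i := \sum_j `|invmx Tg j i|.
have ti0 i : 0 <= ti i by apply: sumr_ge0.
have Ph0 : 0 <= Ph by exact: le_trans (ph_le (((const_mx ord0, const_mx ord0), const_mx ord0), ((0, 0), 0))).
pose tt := \sum_i ti i.
have tt0 : 0 <= tt by apply: sumr_ge0.
have nL2 : 0 <= nL / 2 by rewrite divr_ge0 // ltW.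
pose F := Ph * Cd * (D * B + D * (nL / 2) * (tt * B)).
have F0 : 0 <= F.
  apply: mulr_ge0; first exact: mulr_ge0.
  by apply: addr_ge0; apply: mulr_ge0 => //; apply: mulr_ge0.
pose S := rsum [set: idx0] (fun t => (wmx R t.2 ^+ 2)^-1).
have S0 : 0 <= S by apply: rsum_ge0 => k; rewrite invr_ge0 sqr_ge0.
exists (F * S), s0; split=> //; first exact: mulr_ge0.
move=> x x0 xs xr; have x1 : x.1 <= 1 by exact: le_trans s01.
have asP : asum (fun t => pterm qpi pw (emb0 t) x).
  exact: (asum_inj emb0_inj (asum_pterm widx_ge1 asum_widx qpi_decay pol_pw x0)).
have -> : Fz x = rsum [set: idx0] (fun t => rsum [set: 'rV[int]_n] (fun z => pterm qpi pw (emb0 (t, z)) x)).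
  rewrite -(proj2 (rsum_prod asP)) /Fz (rsum_inj_supp emb0_inj).
    by apply: eq_rsum => t _; rewrite cb_emb0 eqxx.
  by move=> k; case: ifPn => [/eqP /cb_eq0 //|_]; rewrite eqxx.
have asI := proj1 (rsum_prod asP).
rewrite -rsumZ -rsumB //; last exact: (asumZ _ asum_bterm).
rewrite mulrAC -rsumZ; apply: ler_norm_rsum; first exact: (asumZ _ asum_idx0).
move=> t; have sx : 0 < x.1 <= s0 by rewrite x0.
have [G1 G2] := HB x.1 (sh t x) sx.
pose y z := introw R z + sh t x.
pose g z := expR (- x.1 ^+ 2 * nsq (y z *m Tg)).
have asg : asum g by exact: asum_gauss.
have asl j : asum (fun z => (y z *m Tg) 0 j * g z) by exact: asum_gauss_lin.
have yE z i : y z 0 i = \sum_j (y z *m Tg) 0 j * invmx Tg j i.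
  by rewrite -{1}(mulmxK uTg (y z)) mxE.
have eY i : (fun z => y z 0 i * g z) = (fun z => \sum_j invmx Tg j i * ((y z *m Tg) 0 j * g z)).
  by apply/funext => z; rewrite yE mulr_suml; apply: eq_bigr => j _; ring.
have asy i : asum (fun z => y z 0 i * g z).
  by rewrite eY; apply: asum_sum => j _; exact: asumZ.
have Gy i : `|rsum [set: 'rV[int]_n] (fun z => y z 0 i * g z)| <= ti i * (B * x.1 ^+ m).
  rewrite eY rsum_sum; last by move=> j _; exact: asumZ.
  rewrite (le_trans (ler_norm_sum _ _ _)) // mulr_suml; apply: ler_sum => j _.
  by rewrite rsumZ normrM ler_wpM2l //; exact: G2.
pose cf i := cofactor (border (x.1 *: K0 t) sg 0) (rshift 1 i) (lshift n 0).
have -> : rsum [set: 'rV[int]_n] (fun z => pterm qpi pw (emb0 (t, z)) x) = ph0 t * g0 t *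
   (\det (K0 t) * x.1 ^+ n * rsum [set: 'rV[int]_n] g +
    \sum_i cf i * (- (nL / 2)) * rsum [set: 'rV[int]_n] (fun z => y z 0 i * g z)).
  have -> : \sum_i cf i * (- (nL / 2)) * rsum [set: 'rV[int]_n] (fun z => y z 0 i * g z) =
     rsum [set: 'rV[int]_n] (fun z => \sum_i cf i * (- (nL / 2)) * (y z 0 i * g z)).
    rewrite rsum_sum; last by move=> i _; exact: asumZ.
    by apply: eq_bigr => i _; rewrite rsumZ.
  rewrite -rsumZ -rsumD; [|exact: asumZ|by apply: asum_sum => i _; exact: asumZ].
  by rewrite -rsumZ; apply: eq_rsum => z _; rewrite pterm_emb0.
rewrite /bterm; set Sg := rsum _ g.
have -> : forall Y, ph0 t * g0 t * (\det (K0 t) * x.1 ^+ n * Sg + Y) -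
   Cg ^+ n / \det Tg * (ph0 t * g0 t * \det (K0 t)) =
   ph0 t * g0 t * (\det (K0 t) * (x.1 ^+ n * Sg - Cg ^+ n / \det Tg) + Y).
  by move=> Y; ring.
have [hK hc] := HD t; set W := wmx R t.2 in hK hc *.
have W0 : 0 < W by exact: lt_le_trans (wmx_ge1 _ _).
have Bm : 0 <= B * x.1 ^+ m by rewrite mulr_ge0 // exprn_ge0 // ltW.
have DW : 0 <= D * W ^+ n by rewrite mulr_ge0 // exprn_ge0 // ltW.
rewrite normrM normrM (ger0_norm (expR_ge0 _)).
have inner : `|\det (K0 t) * (x.1 ^+ n * Sg - Cg ^+ n / \det Tg) +
   \sum_i cf i * (- (nL / 2)) * rsum [set: 'rV[int]_n] (fun z => y z 0 i * g z)| <=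
   D * W ^+ n * (B * x.1 ^+ m) + D * W ^+ n * (nL / 2) * (tt * (B * x.1 ^+ m)).
  rewrite (le_trans (ler_normD _ _)) // lerD //.
    by rewrite normrM ler_pM.
  rewrite (le_trans (ler_norm_sum _ _ _)) // /tt mulr_suml mulr_sumr; apply: ler_sum => i _.
  rewrite 2!normrM normrN (ger0_norm nL2); apply: ler_pM => //; first exact: mulr_ge0.
  by rewrite ler_wpM2r //; exact: hc.
apply: le_trans (ler_pM _ _ (ler_pM _ _ (ph0_le t) (Hg0 t)) inner) _ => //.
- by rewrite mulr_ge0 // expR_ge0.
- exact: expR_ge0.
rewrite -/W /F exprD le_eqVlt; apply/orP; left; apply/eqP; field.
by rewrite ?expf_neq0 ?gt_eqF.
Qed.

Lemma pseries_split x : 0 < x.1 -> pseries qpi pw x = Fnz x + Fz x.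
Proof.
move=> x0; have asP := asum_pterm widx_ge1 asum_widx qpi_decay pol_pw x0.
rewrite /Fnz /Fz -rsumD.
- apply: eq_rsum => k _; case: (cb k == 0); rewrite ?add0r ?addr0 //.
- by apply: asum_le asP => k; case: ifP => // _; rewrite normr0.
- by apply: asum_le asP => k; case: ifP => // _; rewrite normr0.
Qed.

Lemma model_smooth Cg : gauss_const Cg -> smooth_open setT (fun x : E =>
  if 0 < x.1 then pseries qpi pw x else Cg ^+ n / \det Tg * rsum [set: idx0] bterm).
Proof.
move=> HC; set c := Cg ^+ n / _ * _.
(* Constants are adjoined because the flat function is the difference between the series and its
   limit. *)
pose Cl : set (E -> R) := [set f | exists P, exists c', pol widx P /\
  f = (fun x => pseries qpi P x + c')].
have tC : tame_class Cl.
  move=> f [P [c' [pP ->]]].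
  have [P' [h1 h2 h3]] := pseries_derive widx_ge1 asum_widx pol_qpi qpi_decay pP.
  exists (fun v => pseries qpi (P' v)); split=> [v|v x x0|r].
  - by exists (P' v), 0; split=> //; apply/funext => x; rewrite addr0.
  - have D := @is_derive_add R E x v _ _ _ _ (h2 v x x0) (@is_derive_const R E x v c').
    by apply: (is_derive_eq D); exact: addr0.
  - exact: (grows_pseries widx_ge1 asum_widx qpi_decay (fun v : E => normr_ge0 v) h3 r).
pose f (x : E) := pseries qpi pw x + - c.
have Cf : Cl f by exists pw, (- c); split=> //; exact: pol_pw.
have Ff : flat f.
  have := flatD flat_nz (flat_z HC) => H r m; have [C [s0 [C1 s00 h]]] := H r m.
  by exists C, s0; split=> // x x0 xs xr; rewrite /f pseries_split // -addrA; exact: h.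
have := ext0_smooth c tC Cf Ff; congr smooth_open; apply/funext => x.
by rewrite /ext0 /f; case: ifP => _; rewrite ?addr0 // addrCA subrr addr0.
Qed.

End Model.

(** * Geometry of the cusp *)

Section Bilinear.
Variables (R : comNzRingType) (k : nat) (Q : 'M[R]_k).
Implicit Types x y z : 'rV[R]_k.

Lemma bilE_mx m n (X : 'M[R]_(m, k)) (Y : 'M[R]_(n, k)) i j :
  bil Q (row i X) (row j Y) = (X *m Q *m Y^T) i j.
Proof.
rewrite /bil -!row_mul mxE [LHS]mxE [RHS]mxE; apply: eq_bigr => l _.
by congr (_ * _); rewrite !mxE.
Qed.

Lemma bilDl x y z a : bil Q (a *: x + y) z = a * bil Q x z + bil Q y z.
Proof. by rewrite /bil !mulmxDl -!scalemxAl mxE [X in X + _]mxE. Qed.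

Lemma bilDr x y z a : bil Q x (a *: y + z) = a * bil Q x y + bil Q x z.
Proof. by rewrite /bil linearD linearZ /= mulmxDr -scalemxAr mxE [X in X + _]mxE. Qed.

Lemma bilZl x y a : bil Q (a *: x) y = a * bil Q x y.
Proof. by rewrite /bil -!scalemxAl mxE. Qed.

Lemma bilZr x y a : bil Q x (a *: y) = a * bil Q x y.
Proof. by rewrite /bil linearZ /= -scalemxAr mxE. Qed.

Lemma bil_sym x y : Q^T = Q -> bil Q x y = bil Q y x.
Proof.
move=> sQ; rewrite /bil -[in LHS](trmxK (x *m Q *m y^T)) mxE !trmx_mul trmxK sQ mulmxA.
by [].
Qed.

End Bilinear.

Section ChartAlgebra.
Variables (R : realType) (n d : nat) (QR : 'M[R]_d.+2) (U U' : 'rV[R]_d.+2).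
Variables (eR : 'M[R]_(d, d.+2)) (TG M : 'M[R]_d).
Hypotheses (QR_sym : QR^T = QR) (UU : bil QR U U = 0) (U'U' : bil QR U' U' = 0)
  (UU' : bil QR U U' = - (1 / 2)) (eU : eR *m QR *m U^T = 0) (eU' : eR *m QR *m U'^T = 0)
  (eG : eR *m QR *m eR^T = Gm TG).

(** Used with m = n for the tuple X and with m = 1 for the point Z and its derivatives, so that a
    single Gram computation yields all pairings. *)
Definition cusp_vec m (a a' : 'rV[R]_m) (c : 'M[R]_(m, d)) : 'M[R]_(m, d.+2) :=
  a^T *m U + a'^T *m U' + c *m eR.

Lemma cusp_vec_gram m l (a a' : 'rV[R]_m) c (b b' : 'rV[R]_l) e :
  cusp_vec a a' c *m QR *m (cusp_vec b b' e)^T =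
  - (1 / 2) *: (a^T *m b' + a'^T *m b) + c *m Gm TG *m e^T.
Proof.
have s11 (x y : 'rV[R]_d.+2) (r : R) : bil QR x y = r -> x *m QR *m y^T = r%:M.
  by move=> <-; rewrite [LHS]mx11_scalar.
have h1 := s11 _ _ _ UU; have h2 := s11 _ _ _ U'U'; have h3 := s11 _ _ _ UU'.
have h4 : U' *m QR *m U^T = (- (1 / 2))%:M.
  by apply: s11; rewrite bil_sym.
have h5 : U *m QR *m eR^T = 0.
  by apply: (can_inj (@trmxK _ _ _)); rewrite !trmx_mul trmxK QR_sym mulmxA eU trmx0.
have h6 : U' *m QR *m eR^T = 0.
  by apply: (can_inj (@trmxK _ _ _)); rewrite !trmx_mul trmxK QR_sym mulmxA eU' trmx0.
have -> : (cusp_vec b b' e)^T = U^T *m b + U'^T *m b' + eR^T *m e^T.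
  by rewrite /cusp_vec !linearD /= !trmx_mul !trmxK.
rewrite /cusp_vec !mulmxDl !mulmxDr.
have asc p (A : 'M[R]_(m, p)) (B : 'M[R]_(p, d.+2)) q (C : 'M[R]_(d.+2, q)) D :
   A *m B *m QR *m (C *m D) = A *m (B *m QR *m C) *m D :> 'M[R]_(m, l).
  by rewrite !mulmxA.
rewrite !asc h1 h2 h3 h4 h5 h6 eU eU' eG !(mulmx0, mul0mx) !mul_mx_scalar -!scalemxAl.
by rewrite !scale0r !add0r !addr0 scalerDr.
Qed.

Definition zpt (s : R) (be : 'rV[R]_d) : 'rV[R]_d.+2 :=
  (s^-1 + s * (be *m Gm TG *m be^T) 0 0) *: U + s *: (be *m eR) + s *: U'.

Lemma zpt_cusp_vec s be : zpt s be =
  cusp_vec ((s^-1 + s * (be *m Gm TG *m be^T) 0 0)%:M) (s%:M) (s *: be).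
Proof. by rewrite /zpt /cusp_vec !tr_scalar_mx !mul_scalar_mx -scalemxAl addrAC. Qed.

Lemma bil_zpt s be : s != 0 -> bil QR (zpt s be) (zpt s be) = -1.
Proof.
move=> s0; rewrite /bil zpt_cusp_vec cusp_vec_gram !tr_scalar_mx !mul_scalar_mx.
have -> : s *: be *m Gm TG *m (s *: be)^T = s *: (s *: (be *m Gm TG *m be^T)).
  by rewrite [(s *: be)^T]linearZ /= -scalemxAr -!scalemxAl.
move: (be *m Gm TG *m be^T) => B.
by rewrite !mxE eqxx !mulr1n; field.
Qed.

Lemma XQzpt m (a a' : 'rV[R]_m) c s be i : (cusp_vec a a' c *m QR *m (zpt s be)^T) i 0 =
  - 2^-1 * (a' 0 i * s^-1 + s * (a 0 i - 2 * (be *m Gm TG *m c^T) 0 i +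
    (be *m Gm TG *m be^T) 0 0 * a' 0 i)).
Proof.
have GmT : (Gm TG)^T = Gm TG by rewrite /Gm trmx_mul trmxK.
have e1 : (c *m Gm TG *m be^T) i 0 = (be *m Gm TG *m c^T) 0 i.
  have -> : c *m Gm TG *m be^T = (be *m Gm TG *m c^T)^T.
    by rewrite trmx_mul trmxK trmx_mul GmT mulmxA.
  by rewrite mxE.
rewrite zpt_cusp_vec cusp_vec_gram !mul_mx_scalar [(s *: be)^T]linearZ /= -scalemxAr.
move: (be *m Gm TG *m be^T) (c *m Gm TG *m be^T) (be *m Gm TG *m c^T) e1 => B C D e1.
by rewrite !mxE e1; move: (s^-1) => si; field.
Qed.

(** With (x, y)_Z = (x, y) + 2 (x, Z)(y, Z), the products of a and a' in the Gram matrix cancel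
    against the cross terms of ze_i ze_j, and what they leave behind completes the square c - a'
    b. *)
Lemma majorant_trace (Tv : 'M[R]_n) (a a' : 'rV[R]_n) c s be : s != 0 ->
  let A := a - 2 *: (be *m Gm TG *m c^T) + (be *m Gm TG *m be^T) 0 0 *: a' in
  let ze i := - 2^-1 * (a' 0 i * s^-1 + s * A 0 i) in
  \tr (Tv *m Tv^T *m \matrix_(i, j)
     ((cusp_vec a a' c *m QR *m (cusp_vec a a' c)^T) i j + 2 * (ze i * ze j))) =
  fsq (Tv^T *m (c - a'^T *m be) *m TG) +
    (s^-1 ^+ 2 / 2 * nsq (a' *m Tv) + s ^+ 2 / 2 * nsq (A *m Tv)).
Proof.
move=> s0 A ze.
have GmT : (Gm TG)^T = Gm TG by rewrite /Gm trmx_mul trmxK.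
have trN (y : 'rV[R]_n) : \tr (Tv *m Tv^T *m (y^T *m y)) = nsq (y *m Tv).
  by rewrite nsqE mulmxA mxtrace_mulC mulmxA trmx_mul !mulmxA /mxtrace big_ord1.
have e : \matrix_(i, j) ((cusp_vec a a' c *m QR *m (cusp_vec a a' c)^T) i j + 2 * (ze i * ze j)) =
    (c - a'^T *m be) *m (TG *m TG^T) *m (c - a'^T *m be)^T +
    ((s^-1 ^+ 2 / 2) *: (a'^T *m a') + (s ^+ 2 / 2) *: (A^T *m A)).
  rewrite -/(Gm TG) cusp_vec_gram.
  have -> : (c - a'^T *m be) *m Gm TG *m (c - a'^T *m be)^T =
     c *m Gm TG *m c^T - (be *m Gm TG *m c^T)^T *m a' - a'^T *m (be *m Gm TG *m c^T) +
     (be *m Gm TG *m be^T) 0 0 *: (a'^T *m a').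
    rewrite [(c - _)^T]linearB /= trmx_mul trmxK !mulmxBl !mulmxBr [(_ *m c^T)^T]trmx_mul trmxK [(be *m _)^T]trmx_mul GmT.
    have -> : a'^T *m be *m Gm TG *m (be^T *m a') = a'^T *m (be *m Gm TG *m be^T) *m a'.
      by rewrite !mulmxA.
    rewrite {1}[be *m Gm TG *m be^T]mx11_scalar mul_mx_scalar -scalemxAl.
    by rewrite opprB addrA addrAC !mulmxA.
  have S11 (x y : 'rV[R]_n) i j : (x^T *m y) i j = x 0 i * y 0 j.
    by rewrite mxE big_ord1 mxE.
  have Ai l : A 0 l = a 0 l - 2 * (be *m Gm TG *m c^T) 0 l + (be *m Gm TG *m be^T) 0 0 * a' 0 l.
    rewrite /A; move: (be *m Gm TG *m c^T) ((be *m Gm TG *m be^T) 0 0) => D B.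
    by rewrite !mxE.
  apply/matrixP => i j; rewrite mxE /ze.
  have s1 := S11 a a' i j; have s2 := S11 a' a i j; have s3 := S11 a' a' i j.
  have s6 := S11 A A i j; move: s6; rewrite !Ai.
  move: (c *m Gm TG *m c^T) (be *m Gm TG *m c^T) ((be *m Gm TG *m be^T) 0 0) (A^T *m A) => C D B P6.
  have s4 := S11 D a' i j; have s5 := S11 a' D i j.
  move: (a^T *m a') (a'^T *m a) (a'^T *m a') (D^T *m a') (a'^T *m D) s1 s2 s3 s4 s5.
  move=> P1 P2 P3 P4 P5 s1 s2 s3 s4 s5 s6.
  by rewrite !mxE s1 s2 s3 s4 s5 s6; field.
rewrite e [X in \tr X]mulmxDr mxtraceD [X in _ + \tr X]mulmxDr mxtraceD.
by rewrite -!scalemxAr !mxtraceZ fsq_trace !trN.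
Qed.

End ChartAlgebra.

Section ChartDerivative.
Variables (R : realType) (d : nat) (U U' : 'rV[R]_d.+2) (eR : 'M[R]_(d, d.+2)) (TG M : 'M[R]_d).
Variable gg : 'M[R]_d.+2.
Let E : normedModType R := (R * 'rV[R]_d)%type.

Lemma is_derive_row m (F : E -> 'rV[R]_m) (x w : E) (D : 'rV[R]_m) :
  (forall j, is_derive x w (fun y => F y 0 j) (D 0 j)) -> is_derive x w F D.
Proof.
move=> H; have dF : derivable F x w.
  by apply/derivable_mxP => i j; rewrite (ord1 i); have [] := H j.
split=> //; rewrite derive_mx //; apply/rowP => j; rewrite mxE.
by have [_ ->] := H j.
Qed.

Lemma Gm_tr l m (b : 'M[R]_(l, d)) (c : 'M[R]_(m, d)) :
  (b *m Gm TG *m c^T)^T = c *m Gm TG *m b^T.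
Proof.
have GmT : (Gm TG)^T = Gm TG by rewrite /Gm trmx_mul trmxK.
by rewrite trmx_mul trmxK trmx_mul GmT mulmxA.
Qed.

Definition zchart (x : E) : 'rV[R]_d.+2 := zpt U U' eR TG x.1 (beta M x) *m gg.

Definition dzpt (x w : E) : 'rV[R]_d.+2 :=
  cusp_vec U U' eR (- (w.1 * x.1^-1 ^+ 2) + w.1 * bb TG M x +
    2 * x.1 * (beta M x *m Gm TG *m (w.2 *m M)^T) 0 0)%:M w.1%:M
    (w.1 *: beta M x + x.1 *: (w.2 *m M)).

Lemma zchart_derive (x w : E) : 0 < x.1 -> is_derive x w zchart (dzpt x w *m gg).
Proof.
move=> x0; apply: is_derive_row => j.
have D1 : is_derive x w (fun y : E => y.1) w.1 by exact: (@is_derive_linear R E fst).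
have D2 : is_derive x w (fun y : E => y.1^-1) (w.1 * - x.1 ^- 2).
  apply: is_derive_comp1 D1; split; first by apply: derivableV => //; rewrite gt_eqF.
  have := @deriveV R R id x.1 1; rewrite gt_eqF // => -> //.
  by rewrite derive_id /GRing.scale /= mulr1.
have betaD h (y z : E) : beta M (h *: y + z) = h *: beta M y + beta M z.
  by rewrite /beta /= mulmxDl -scalemxAl.
have D3 : is_derive x w (bb TG M) (2 * (beta M x *m Gm TG *m (w.2 *m M)^T) 0 0).
  apply: (@is_derive_quadratic _ _ _ _ _ _ `|bb TG M w| 1) => // h _.
  have -> : bb TG M (h *: w + x) - bb TG M x - h * (2 * (beta M x *m Gm TG *m (w.2 *m M)^T) 0 0) =
     bb TG M w * h ^+ 2.
    rewrite /bb betaD -/(beta M w) linearD linearZ /= !mulmxDl !mulmxDr -!scalemxAl -!scalemxAr.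
    have e : (beta M w *m Gm TG *m (beta M x)^T) 0 0 = (beta M x *m Gm TG *m (beta M w)^T) 0 0.
      by rewrite -Gm_tr mxE.
    move: (beta M w *m Gm TG *m (beta M w)^T) (beta M w *m Gm TG *m (beta M x)^T)
      (beta M x *m Gm TG *m (beta M w)^T) (beta M x *m Gm TG *m (beta M x)^T) e => P1 P2 P3 P4 e.
    by rewrite !mxE e; ring.
  by rewrite normrM (ger0_norm (sqr_ge0 _)).
have D4 : is_derive x w (fun y : E => (beta M y *m eR *m gg) 0 j) ((beta M w *m eR *m gg) 0 j).
  apply: (@is_derive_linear R E (fun y => (beta M y *m eR *m gg) 0 j)) => a y z.
  by rewrite betaD !mulmxDl -!scalemxAl mxE [X in X + _]mxE.
have e1 : (fun y => zchart y 0 j) = (fun y : E => (y.1^-1 + y.1 * bb TG M y) * (U *m gg) 0 j +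
    (y.1 * (beta M y *m eR *m gg) 0 j + y.1 * (U' *m gg) 0 j)).
  apply/funext => y; rewrite /zchart /zpt !mulmxDl -!scalemxAl -/(bb TG M y).
  by move: (U *m gg) (beta M y *m eR *m gg) (U' *m gg) => P1 P2 P3; rewrite !mxE addrA.
rewrite e1; apply: is_derive_eq (is_derive_add (is_derive_mulc _ (is_derive_add D2
   (is_derive_mul D1 D3))) (is_derive_add (is_derive_mul D1 D4) (is_derive_mulc _ D1))) _.
rewrite /dzpt /cusp_vec !tr_scalar_mx !mul_scalar_mx !mulmxDl -!scalemxAl -/(beta M w).
move: (U *m gg) (beta M x *m eR *m gg) (beta M w *m eR *m gg) (U' *m gg) => P1 P2 P3 P4.
by rewrite !mxE exprVn; ring.
Qed.

End ChartDerivative.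

Section RealForms.
Variables (R : realType).

Lemma toR_mul k l m (A : 'M[rat]_(k, l)) (B : 'M[rat]_(l, m)) : toR R (A *m B) = toR R A *m toR R B.
Proof. exact: map_mxM. Qed.

Lemma toR_tr k l (A : 'M[rat]_(k, l)) : toR R A^T = (toR R A)^T.
Proof. by rewrite /toR map_trmx. Qed.

Lemma toR_bil k (Q : 'M[rat]_k) x y : bil (toR R Q) (toR R x) (toR R y) = ratr (bil Q x y).
Proof. by rewrite /bil -toR_tr -!toR_mul mxE. Qed.

Lemma majorantE p (Q : 'M[rat]_p.+1) (Z x y : 'rV[R]_p.+1) : Q^T = Q -> bil (toR R Q) Z Z = -1 ->
  majorant Q Z x y = bil (toR R Q) x y + 2 * (bil (toR R Q) x Z * bil (toR R Q) y Z).
Proof.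
move=> sQ ZZ; have sR : (toR R Q)^T = toR R Q by rewrite -toR_tr sQ.
rewrite /majorant ZZ.
have e (z : 'rV[R]_p.+1) a : z - (a / -1) *: Z = a *: Z + z.
  by rewrite invrN1 mulrN1 scaleNr opprK addrC.
rewrite !e !bilDl !bilDr !bilZl !bilZr ZZ (bil_sym Z y sR).
by field.
Qed.

Lemma signature_pos p (Q : 'M[rat]_p.+1) (x z : 'rV[R]_p.+1) : Q^T = Q -> signature_p1 R Q ->
  x != 0 -> bil (toR R Q) x z = 0 -> bil (toR R Q) z z < 0 -> 0 < bil (toR R Q) x x.
Proof.
move=> sQ [P uP eP] x0 xz zz; set B := bil (toR R Q).
have sR : (toR R Q)^T = toR R Q by rewrite -toR_tr sQ.
pose ze (y : 'rV[R]_p.+1) := y *m invmx P.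
have Bze y : B y y = \sum_(i | i != ord_max) ze y 0 i ^+ 2 - ze y 0 ord_max ^+ 2.
  have -> : B y y = (ze y *m (P *m toR R Q *m P^T) *m (ze y)^T) 0 0.
    by rewrite -{1 2}(mulmxKV uP y) -/(ze y) /B /bil trmx_mul !mulmxA.
  rewrite eP mul_mx_diag mxE (bigD1 ord_max) //= addrC !mxE eqxx; congr (_ + _).
    by apply: eq_bigr => i /negbTE ni; rewrite !mxE ni mulr1 expr2.
  by rewrite mulrN1 mulNr expr2.
have zeD a (y y' : 'rV[R]_p.+1) i : ze (a *: y + y') 0 i = a * ze y 0 i + ze y' 0 i.
  by rewrite /ze mulmxDl -scalemxAl mxE [X in X + _]mxE.
have sq0 y : 0 <= \sum_(i | i != ord_max) ze y 0 i ^+ 2.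
  by apply: sumr_ge0 => i _; rewrite sqr_ge0.
rewrite ltNge; apply/negP => xx.
have [b0|b0] := eqVneq (ze x 0 ord_max) 0.
  move: xx; rewrite Bze b0 expr0n subr0 => xx.
  have s0 : \sum_(i | i != ord_max) ze x 0 i ^+ 2 = 0 by apply/eqP; rewrite eq_le xx sq0.
  case/eqP: x0; rewrite -(mulmxKV uP x) -/(ze x); suff -> : ze x = 0 by rewrite mul0mx.
  apply/rowP => i; rewrite [RHS]mxE; have [->//|ni] := eqVneq i ord_max.
  move/eqP: s0; rewrite psumr_eq0 => [/allP /(_ i)|j _]; last by rewrite sqr_ge0.
  by rewrite mem_index_enum ni sqrf_eq0 => /(_ isT) /eqP.
(* The combination a x + b z whose negative coordinate vanishes has nonnegative norm, while
   orthogonality of x and z makes that norm a^2 (x, x) + b^2 (z, z) < 0. *)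
pose a := ze z 0 ord_max; pose b := - ze x 0 ord_max.
have y0 : ze (a *: x + b *: z) 0 ord_max = 0.
  have e : ze (b *: z) 0 ord_max = b * ze z 0 ord_max by rewrite /ze -scalemxAl mxE.
  by rewrite zeD e /a /b; ring.
have : 0 <= B (a *: x + b *: z) (a *: x + b *: z).
  by rewrite Bze y0 expr0n subr0.
rewrite /B bilDl bilDr !bilZl !bilDr !bilZr (bil_sym z x sR) xz !mulr0 !addr0 !add0r.
have b2 : 0 < b ^+ 2 by rewrite exprn_even_gt0 //= oppr_eq0.
rewrite !mulrA -!expr2.
have : a ^+ 2 * B x x <= 0 by rewrite mulr_ge0_le0 // sqr_ge0.
have : b ^+ 2 * B z z < 0 by rewrite pmulr_rlt0.
by rewrite /B; lra.
Qed.

End RealForms.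

Section DetForms.
Variables (R : realType) (n : nat) (V : normedModType R).

Definition detform (ell : 'I_n -> V -> R) (w : 'I_n -> V) : R :=
  \det (\matrix_(i, j) ell i (w j)).

Variable ell : 'I_n -> V -> R.
Hypothesis ell_lin : forall i a x y, ell i (a *: x + y) = a * ell i x + ell i y.

Lemma detform_lin w i a x y : detform ell (replace_at w i (a *: x + y)) =
  a * detform ell (replace_at w i x) + detform ell (replace_at w i y).
Proof.
have E w0 : detform ell w0 = \det (\matrix_(j, l) ell l (w0 j)).
  by rewrite /detform -det_tr; congr (\det _); apply/matrixP => j l; rewrite !mxE.
rewrite !E -[X in _ = _ + X]mul1r; apply: (@determinant_multilinear _ _ _ _ _ i).
- by apply/rowP => j; rewrite !mxE /replace_at eqxx ell_lin mul1r.
- by apply/matrixP => j k; rewrite !mxE /replace_at eq_sym (negbTE (neq_lift _ _)).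
- by apply/matrixP => j k; rewrite !mxE /replace_at eq_sym (negbTE (neq_lift _ _)).
Qed.

Lemma detform_alt w i k : i != k -> w i = w k -> detform ell w = 0.
Proof.
move=> ik wik; rewrite /detform -det_tr; apply: (determinant_alternate ik) => j.
by rewrite !mxE wik.
Qed.

End DetForms.

Section AlternatingSums.
Variables (R : realType) (n : nat) (V : normedModType R) (T : choiceType).
Variables (c1 c2 : T -> R) (ell : T -> 'I_n -> V -> R).
Hypothesis ell_lin : forall t i a x y, ell t i (a *: x + y) = a * ell t i x + ell t i y.
Hypotheses (s1 : forall w, asum (fun t => c1 t * detform (ell t) w))
  (s2 : forall w, asum (fun t => c2 t * detform (ell t) w)).

Lemma alt_multilinear_sum : alt_multilinear [set: V] (fun w =>
  rsum [set: T] (fun t => c1 t * detform (ell t) w) +i*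
  rsum [set: T] (fun t => c2 t * detform (ell t) w)).
Proof.
have lin c w i a x y : (forall w, asum (fun t => c t * detform (ell t) w)) ->
   rsum [set: T] (fun t => c t * detform (ell t) (replace_at w i (a *: x + y))) =
   a * rsum [set: T] (fun t => c t * detform (ell t) (replace_at w i x)) +
   rsum [set: T] (fun t => c t * detform (ell t) (replace_at w i y)).
  move=> s; rewrite -rsumZ -rsumD //; last exact: asumZ.
  by apply: eq_rsum => t _; rewrite (detform_lin (ell_lin t)); ring.
split=> [w i a x y _ _ _|w i k _ ik wik].
  by rewrite !lin //; apply/eqP; rewrite eq_complex /= !mul0r !subr0 !addr0 !eqxx.
have z c : rsum [set: T] (fun t => c t * detform (ell t) w) = 0.
  rewrite -[RHS](rsum0 R T); apply: eq_rsum => t _.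
  by rewrite (detform_alt (ell t) ik wik) mulr0.
by rewrite !z.
Qed.

End AlternatingSums.

Lemma alt_multilinear_comp (R : realType) n (V V' : normedModType R) (T' : set V') f
    (D : V -> V') : (forall a x y, D (a *: x + y) = a *: D x + D y) -> (forall x, T' (D x)) ->
  @alt_multilinear R n V' T' f -> alt_multilinear [set: V] (fun w => f (fun i => D (w i))).
Proof.
move=> DL DT [fl fa].
have e w i x : (fun k => D (replace_at w i x k)) = replace_at (fun k => D (w k)) i (D x).
  by apply/funext => k; rewrite /replace_at; case: ifP.
split=> [w i a x y _ _ _|w i k _ ik wik]; first by rewrite !e DL fl.
by apply: (fa _ i k) => //; rewrite wik.
Qed.

Lemma alt_multilinear_sub (R : realType) n (V : normedModType R) (T T' : set V) f :
  T `<=` T' -> @alt_multilinear R n V T' f -> alt_multilinear T f.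
Proof.
move=> TT [fl fa]; split=> [w i a x y Tw Tx Ty|w i k Tw ik wik].
  by apply: fl => [k||]; exact: TT.
by apply: (fa _ i k) => // l; exact: TT.
Qed.

(** * Indexing cosets of a lattice by residues and quotients *)

Section LatticeIndex.

Definition intmx (N : nat) m n (A : 'M[rat]_(m, n)) : Prop :=
  exists B : 'M[int]_(m, n), N%:R *: A = map_mx intr B.

Lemma common_denominator m n (A : 'M[rat]_(m, n)) : exists2 N, (0 < N)%N & intmx N A.
Proof.
pose N := (\prod_i \prod_j `|denq (A i j)|)%N.
exists N.
  by rewrite prodn_gt0 // => i; rewrite prodn_gt0 // => j; rewrite absz_gt0 denq_neq0.
exists (\matrix_(i, j) (numq (A i j) * (N %/ `|denq (A i j)|)%N)).
apply/matrixP => i j; rewrite !mxE.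
have dv : (`|denq (A i j)| %| N)%N.
  by rewrite /N (bigD1 i) //= (bigD1 j) //= -mulnA dvdn_mulr.
rewrite -{1}(divnK dv) natrM rmorphM /= -pmulrn -{3}(divq_num_den (A i j)).
have e : `|denq (A i j)|%N%:R = (denq (A i j))%:~R :> rat.
  by rewrite pmulrn gez0_abs ?denq_ge0.
by rewrite e; field; rewrite intr_eq0 denq_neq0.
Qed.

Lemma intmxM N N' m n (A : 'M[rat]_(m, n)) : intmx N A -> intmx (N * N') A.
Proof.
move=> [B e]; exists (N'%:Z *: B).
by rewrite natrM mulrC -scalerA e; apply/matrixP => i j; rewrite !mxE rmorphM /= -pmulrn.
Qed.

Definition crdq (N L : nat) (rho : 'I_L.+1) (z : int) : rat :=
  N%:R^-1 * (rho%:R + L.+1%:R * z%:~R).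

Definition crdmx (N L : nat) m n (t : 'M['I_L.+1]_(m, n) * 'M[int]_(m, n)) : 'M[rat]_(m, n) :=
  \matrix_(i, j) crdq N (t.1 i j) (t.2 i j).

(* The coset is periodic under N times the coordinate lattice and contained in 1/N
   times it, which explains the modulus N * N. *)
Lemma coset_indexing n k (E : 'M[rat]_k) (L : set 'rV[rat]_k) (h : 'M[rat]_(n, k)) :
  E \in unitmx -> is_lattice L -> exists N, exists D, exists chi : pred 'M['I_D.+1]_(n, k),
  [/\ (0 < N)%N, D.+1 = (N * N)%N &
      set_bij [set t : 'M['I_D.+1]_(n, k) * 'M[int]_(n, k) | chi t.1] (coset_pow L h)
        (fun t => crdmx N t *m E)].
Proof.
move=> uE [E0 uE0 ->].
(* The first two denominators place the coset inside 1/N times the coordinate lattice; the third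
   places N times that lattice inside L. *)
have [N1 N10 I1] := common_denominator (h *m invmx E).
have [N2 N20 I2] := common_denominator (E0 *m invmx E).
have [N3 N30 I3] := common_denominator (E *m invmx E0).
pose N := (N1 * N2 * N3)%N.
have N0 : (0 < N)%N by rewrite !muln_gt0 N10 N20.
have {I1} [H1 eH1] : intmx N (h *m invmx E) by do 2 apply: intmxM.
have {I2} [H2 eH2] : intmx N (E0 *m invmx E).
  by rewrite /N [(N1 * N2)%N]mulnC -mulnA; apply: intmxM.
have {I3} [H3 eH3] : intmx N (E *m invmx E0) by rewrite /N mulnC; apply: intmxM.
pose D := (N * N).-1; have DE : D.+1 = (N * N)%N by rewrite prednK // muln_gt0 N0.
have DR : D.+1%:R = N%:R * N%:R :> rat by rewrite DE natrM.
have NR0 : N%:R != 0 :> rat by rewrite pnatr_eq0 -lt0n.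
have cosetP (X : 'M[rat]_(n, k)) :
    coset_pow [set map_mx intr z *m E0 | z in [set: 'rV[int]_k]] h X <->
    exists Z : 'M[int]_(n, k), X = h + map_mx intr Z *m E0.
  split=> [H|[Z ->] i].
    have /choice[f Hf] : forall i, exists z : 'rV[int]_k, map_mx intr z *m E0 = row i (X - h).
      by move=> i; have [z _ e] := H i; exists z.
    exists (\matrix_i f i); apply/row_matrixP => i; rewrite linearD /= row_mul -map_row rowK.
    by rewrite Hf linearB /= addrC subrK.
  by exists (row i Z) => //; rewrite addrC addKr row_mul -map_row.
pose X0 (r : 'M['I_D.+1]_(n, k)) := crdmx N (r, 0) *m E.
(* Membership is tested on the representative with quotient 0: by [Xt] the quotient changes the rows
   by elements of L only. *)
pose chi : pred 'M['I_D.+1]_(n, k) := fun r =>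
  `[< coset_pow [set map_mx intr z *m E0 | z in [set: 'rV[int]_k]] h (X0 r) >].
have Xt (t : 'M['I_D.+1]_(n, k) * 'M[int]_(n, k)) :
    crdmx N t *m E = X0 t.1 + map_mx intr (t.2 *m H3) *m E0.
  rewrite map_mxM -eH3 -!mulmxA -scalemxAl mulmxKV // -scalemxAr scalemxAl /X0 -mulmxDl; congr (_ *m _).
  apply/matrixP => i j; rewrite !mxE /crdq /= DR mulr0 addr0.
  by field.
exists N, D, chi; split=> //; split.
- move=> t /= /asboolP /cosetP[Z eZ]; apply/cosetP; exists (Z + t.2 *m H3).
  by rewrite Xt eZ -addrA -mulmxDl -map_mxD.
- move=> [r z] [r' z'] _ _ /= /(congr1 (mulmx^~ (invmx E))); rewrite !mulmxK // => e.
  have rz i j : r i j = r' i j /\ z i j = z' i j.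
    move/matrixP: e => /(_ i j); rewrite !mxE /crdq /= => /(mulfI (invr_neq0 NR0)) e.
    have {}e : (r i j : nat)%:Z + D.+1%:Z * z i j = (r' i j : nat)%:Z + D.+1%:Z * z' i j.
      by apply: (@intr_inj rat); rewrite !rmorphD !rmorphM /= -!pmulrn.
    have md (q : 'I_D.+1) (y : int) : modz ((q : nat)%:Z + D.+1%:Z * y) D.+1%:Z = q.
      by rewrite addrC mulrC modzMDl modz_small // ltz_nat ltn_ord.
    have rr : r i j = r' i j.
      by apply: val_inj; apply/eqP; rewrite -eqz_nat -(md _ (z i j)) -(md (r' i j) (z' i j)) e.
    have D0 : D.+1%:Z != 0 by [].
    by split=> //; move: e; rewrite rr => /addrI /(mulfI D0).
  by congr pair; apply/matrixP => i j; have [] := rz i j.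
- move=> X /cosetP[Z eX].
  have [Y eY] : exists Y : 'M[int]_(n, k), N%:R *: (X *m invmx E) = map_mx intr Y.
    exists (H1 + Z *m H2); rewrite map_mxD map_mxM -eH1 -eH2 eX mulmxDl scalerDr.
    by rewrite -!scalemxAr !mulmxA.
  have D0 : D.+1%:Z != 0 by [].
  pose r := \matrix_(i, j) (inord `|modz (Y i j) D.+1%:Z|%N : 'I_D.+1).
  pose z := \matrix_(i, j) divz (Y i j) D.+1%:Z.
  have eC : crdmx N (r, z) = X *m invmx E.
    apply: (scalerI NR0); rewrite eY; apply/matrixP => i j; rewrite !mxE /crdq /=.
    rewrite mulrA mulfV // mul1r inordK; last first.
      by rewrite -ltz_nat gez0_abs ?modz_ge0 // ltz_pmod.
    have -> : `|modz (Y i j) D.+1%:Z|%N%:R = (modz (Y i j) D.+1%:Z)%:~R :> rat.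
      by rewrite pmulrn gez0_abs ?modz_ge0.
    by rewrite [in RHS](divz_eq (Y i j) D.+1%:Z) [RHS]intrD intrM -pmulrn addrC mulrC.
  have eX2 : crdmx N (r, z) *m E = X by rewrite eC mulmxKV.
  exists (r, z) => //=; apply/asboolP/cosetP; exists (Z - z *m H3).
  have := Xt (r, z); rewrite eX2 eX /= => e.
  by rewrite map_mxB mulmxBl addrA e addrK.
Qed.

End LatticeIndex.

Lemma row_base_exists (F : fieldType) m n r (A : 'M[F]_(m, n)) : \rank A = r ->
  exists2 B : 'M[F]_(r, n), row_free B & (B :=: A)%MS.
Proof. by move=> <-; exists (row_base A); [exact: row_base_free|exact: eq_row_base]. Qed.

Section HyperbolicSplitting.
Variables (F : numFieldType) (d : nat) (Q : 'M[F]_d.+2) (u u' : 'rV[F]_d.+2).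
Hypotheses (Q_sym : Q^T = Q) (uu : bil Q u u = 0) (u'u' : bil Q u' u' = 0)
  (uu' : bil Q u u' = - (1 / 2)).

Let s11 (x y : 'rV[F]_d.+2) (r : F) : bil Q x y = r -> x *m Q *m y^T = r%:M.
Proof. by move=> <-; rewrite [LHS]mx11_scalar. Qed.

Let u'u : bil Q u' u = - (1 / 2). Proof. by rewrite bil_sym. Qed.

Let half : - (1 / 2) != 0 :> F. Proof. by rewrite oppr_eq0 mulf_neq0 ?invr_eq0 ?oner_neq0 ?pnatr_eq0. Qed.

Lemma perp_basis : exists eW : 'M[F]_(d, d.+2),
  [/\ row_free eW, eW *m Q *m u^T = 0, eW *m Q *m u'^T = 0 &
      (eW :=: kermx (Q *m row_mx u^T u'^T))%MS].
Proof.
set A := Q *m row_mx u^T u'^T.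
have rA : \rank A = 2.
  apply/eqP; rewrite eqn_leq rank_leq_col /=.
  (* The Gram matrix of u, u' is -1/2 times the swap, so -2 times the swap inverts it; this forces
     the rank 2. *)
  have fullP : col_mx u u' *m A *m (- 2 *: block_mx 0 1%:M 1%:M 0) = 1%:M :> 'M[F]_(1 + 1).
    rewrite /A mul_mx_row mul_col_mx !mul_mx_row !mulmxA /= (s11 uu) (s11 u'u') (s11 uu') (s11 u'u).
    rewrite -scalemxAr -/(block_mx _ _ _ _) mulmx_block !mulmx1 !mulmx0 !addr0 !add0r.
    rewrite scale_block_mx !scale_scalar_mx mulr0 !raddf0.
    by have -> : -2 * - (1 / 2) = 1 :> F; [field|rewrite -scalar_mx_block].
  have := mxrankM_maxr (col_mx u u') (A *m (- 2 *: block_mx 0 1%:M 1%:M 0)).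
  rewrite mulmxA fullP mxrank1 => /leq_trans; apply; exact: mxrankM_maxl.
have rk : \rank (kermx A) = d by rewrite mxrank_ker rA subn2.
have [eW fW eqW] := row_base_exists rk; exists eW.
have : eW *m A = 0 by apply/sub_kermxP; rewrite eqW.
rewrite /A mulmxA mul_mx_row => e.
split=> //.
  by have := congr1 lsubmx e; rewrite row_mxKl linear0.
by have := congr1 rsubmx e; rewrite row_mxKr linear0.
Qed.

Lemma splitting_unit (eW : 'M[F]_(d, d.+2)) : row_free eW -> eW *m Q *m u^T = 0 ->
  eW *m Q *m u'^T = 0 -> (col_mx u (col_mx u' eW) : 'M[F]_d.+2) \in unitmx.
Proof.
move=> fW eu eu'; rewrite -row_free_unit -kermx_eq0; apply/rowV0P => x /sub_kermxP.
have [a [b [c ->]]] : exists a : 'M[F]_1, exists b : 'M[F]_1, exists c : 'rV[F]_d,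
    x = row_mx a (row_mx b c).
  pose y := rsubmx (x : 'M[F]_(1, 1 + d.+1)).
  exists (lsubmx (x : 'M[F]_(1, 1 + d.+1))), (lsubmx (y : 'M[F]_(1, 1 + d))).
  by exists (rsubmx (y : 'M[F]_(1, 1 + d))); rewrite !hsubmxK.
rewrite (@mul_row_col _ _ 1 d.+1) (@mul_row_col _ _ 1 d) => e.
have asc k (A : 'M[F]_(1, k)) B (C : 'cV[F]_d.+2) : A *m B *m Q *m C = A *m (B *m Q *m C).
  by rewrite !mulmxA.
have h1 : b = 0.
  have := congr1 (fun z => z *m Q *m u^T) e; rewrite !mulmxDl !mul0mx !asc (s11 uu) (s11 u'u) eu.
  by rewrite !mul_mx_scalar scale0r mulmx0 add0r addr0 => /eqP; rewrite scaler_eq0 (negbTE half) => /eqP.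
have h2 : a = 0.
  have := congr1 (fun z => z *m Q *m u'^T) e; rewrite !mulmxDl !mul0mx !asc (s11 u'u') (s11 uu') eu'.
  by rewrite !mul_mx_scalar scale0r mulmx0 !addr0 => /eqP; rewrite scaler_eq0 (negbTE half) => /eqP.
move: e; rewrite h1 h2 !mul0mx !add0r => /eqP; rewrite mulmx_free_eq0 // => /eqP ->.
by rewrite !row_mx0.
Qed.

End HyperbolicSplitting.

Section CuspGeometry.
Variables (R : realType) (d : nat) (Q : 'M[rat]_d.+2) (u u' : 'rV[rat]_d.+2) (e : 'M[R]_(d, d.+2)).
Hypotheses (Q_sym : Q^T = Q) (Q_sig : signature_p1 R Q) (uu : bil Q u u = 0)
  (u'u' : bil Q u' u' = 0) (uu' : bil Q u u' = - (1 / 2)) (he : @basis_of_W R d.+1 Q u u' e).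

(** The coordinates on W(R) given by [e] are arbitrary real ones, while the summation over a lattice
    calls for a rational basis [eW]; [M] passes between them. *)
Lemma cusp_geometry : exists eW : 'M[rat]_(d, d.+2), exists M : 'M[R]_d, exists TG : 'M[R]_d,
  [/\ (col_mx u (col_mx u' eW) : 'M[rat]_d.+2) \in unitmx,
      eW *m Q *m u^T = 0 /\ eW *m Q *m u'^T = 0, e = M *m toR R eW,
      pos_def (eW *m Q *m eW^T) & ltrig TG /\ toR R (eW *m Q *m eW^T) = Gm TG].
Proof.
have [eW [fW eu eu' eK]] := perp_basis Q_sym uu u'u' uu'.
have eM : (e <= toR R eW)%MS.
  apply/row_subP => i.
  have [h1 h2] := (proj2 he (row i e)).1 (row_sub i e).
  apply: (@submx_trans _ _ _ _ _ _ (kermx (toR R (Q *m row_mx u^T u'^T)))); last first.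
    by rewrite /toR -map_kermx map_submx eK.
  apply/sub_kermxP; rewrite toR_mul mulmxA /toR map_row_mx mul_mx_row.
  rewrite -[map_mx ratr u^T]/(toR R _) -[map_mx ratr u'^T]/(toR R _) !toR_tr.
  rewrite [X in row_mx X _]mx11_scalar [X in row_mx _ X]mx11_scalar.
  by move: h1 h2; rewrite /bil => -> ->; rewrite !raddf0 row_mx0.
have [M eM'] := submxP eM.
have sG : (eW *m Q *m eW^T)^T = eW *m Q *m eW^T by rewrite !trmx_mul trmxK Q_sym mulmxA.
(* This vector has norm -1 and is orthogonal to W, so [signature_pos] makes W positive definite. *)
pose z := toR R (u + u').
have zz : bil (toR R Q) z z < 0.
  rewrite toR_bil -[u]scale1r bilDl !bilDr uu u'u' (bil_sym u' u Q_sym) uu'.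
  by rewrite ltrq0; lra.
have pR : pos_def (toR R (eW *m Q *m eW^T)).
  move=> x x0.
  have xe : bil (toR R (eW *m Q *m eW^T)) x x = bil (toR R Q) (x *m toR R eW) (x *m toR R eW).
    by rewrite /bil !toR_mul toR_tr trmx_mul !mulmxA.
  rewrite xe; apply: (signature_pos (z := z)) => //.
    by rewrite mulmx_free_eq0 // /toR row_free_map.
  rewrite /bil -mulmxA -mulmxA -toR_tr -!toR_mul mulmxA linearD /= mulmxDr eu eu' addr0 /toR.
  by rewrite map_mx0 mulmx0 mxE.
have pQ : pos_def (eW *m Q *m eW^T).
  move=> x x0; rewrite -(ltr0q R) -toR_bil; apply: pR.
  by rewrite /toR map_mx_eq0.
have sGR : (toR R (eW *m Q *m eW^T))^T = toR R (eW *m Q *m eW^T) by rewrite -toR_tr sG.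
have [TG tTG eG] := cholesky sGR pR.
exists eW, M, TG; split=> //.
exact: (splitting_unit Q_sym uu u'u' uu').
Qed.

End CuspGeometry.

Section CuspIndex.
Variables (R : realType) (n d : nat).

Definition join3 (T : Type) (a b : 'rV[T]_n) (c : 'M[T]_(n, d)) : 'M[T]_(n, d.+2) :=
  row_mx a^T (row_mx b^T c).


Definition pmx D (k : idx n d D) : 'M['I_D.+1]_(n, d.+2) * 'M[int]_(n, d.+2) :=
  (join3 k.1.1.1 k.1.1.2 k.1.2, join3 k.2.1.1 k.2.1.2 k.2.2).

Lemma join3_bij (T : Type) :
  bijective (fun t : 'rV[T]_n * 'rV[T]_n * 'M[T]_(n, d) => join3 t.1.1 t.1.2 t.2).
Proof.
exists (fun A : 'M[T]_(n, 1 + (1 + d)) => (((lsubmx A)^T, (lsubmx (rsubmx A))^T), rsubmx (rsubmx A))).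
  move=> [[a b] c] /=; rewrite /join3.
  have e1 := row_mxKl a^T (row_mx b^T c); have e2 := row_mxKr a^T (row_mx b^T c).
  by rewrite e1 e2 row_mxKl row_mxKr !trmxK.
by move=> A /=; rewrite /join3 !trmxK !hsubmxK.
Qed.

Lemma pmx_bij D : bijective (@pmx D).
Proof.
have [f fK Kf] := join3_bij 'I_D.+1; have [g gK Kg] := join3_bij int.
exists (fun t => (f t.1, g t.2) : idx n d D) => [[k1 k2]|[A B]].
  by rewrite /pmx /= (fK k1) (gK k2).
by rewrite /pmx /=; congr pair; [exact: Kf|exact: Kg].
Qed.

Definition Xq N D (k : idx n d D) : 'M[rat]_(n, d.+2) := crdmx N (pmx k).

Lemma ratr_crdq N D (rho : 'I_D.+1) z : ratr (crdq N rho z) = crd (N%:R^-1 : R) rho z.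
Proof.
by rewrite /crdq /crd rmorphM fmorphV rmorphD rmorphM /= !ratr_nat ratr_int.
Qed.

Lemma toR_Xq N D (k : idx n d D) (u u' : 'rV[rat]_d.+2) (eW : 'M[rat]_(d, d.+2)) :
  toR R (Xq N k *m col_mx u (col_mx u' eW)) =
  cusp_vec (toR R u) (toR R u') (toR R eW) (ca (N%:R^-1 : R) k) (cb (N%:R^-1 : R) k) (cc (N%:R^-1 : R) k).
Proof.
have -> : Xq N k = row_mx (\col_i crdq N (k.1.1.1 0 i) (k.2.1.1 0 i))
   (row_mx (\col_i crdq N (k.1.1.2 0 i) (k.2.1.2 0 i))
           (\matrix_(i, j) crdq N (k.1.2 i j) (k.2.2 i j))).
  apply/matrixP => i j; rewrite /Xq /pmx /join3 !mxE /=.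
  case: fintype.split => a; rewrite !mxE ?(ord1 a) //.
  by case: fintype.split => b; rewrite !mxE ?(ord1 b).
rewrite (@mul_row_col _ _ 1 d.+1) (@mul_row_col _ _ 1 d) /toR !map_mxD !map_mxM addrA.
congr (_ + _ + _); congr (_ *m _); apply/matrixP => i j; rewrite !mxE; exact: ratr_crdq.
Qed.

Lemma cusp_indexing (E : 'M[rat]_d.+2) (L : set 'rV[rat]_d.+2) (h : 'M[rat]_(n, d.+2)) :
  E \in unitmx -> is_lattice L -> exists N, exists D, exists chi : pred (resid n d D),
  [/\ (0 < N)%N, D.+1 = (N * N)%N &
      set_bij [set k : idx n d D | chi k.1] (coset_pow L h) (fun k => Xq N k *m E)].
Proof.
move=> uE lL; have [N [D [chi [N0 DN [b1 b2 b3]]]]] := coset_indexing h uE lL.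
exists N, D, (fun r => chi (pmx ((r, ((0, 0), 0)) : idx n d D)).1); split=> //.
have [f fK Kf] := pmx_bij D.
split.
- by move=> k /= ck; exact: (b1 (pmx k)).
- move=> k k' ck ck' e; apply: (can_inj fK).
  by apply: b2 => //; rewrite inE in ck ck' *.
- move=> X /b3[t ct eX]; exists (f t); last by rewrite /Xq Kf.
  by move: ct; rewrite -{1}(Kf t).
Qed.

End CuspIndex.

Lemma Re_real_mul (R : realType) (a : R) (z : R[i]) : complex.Re (a%:C * z) = a * complex.Re z.
Proof. by case: z => zr zi /=; rewrite mul0r subr0. Qed.

Lemma Im_real_mul (R : realType) (a : R) (z : R[i]) : complex.Im (a%:C * z) = a * complex.Im z.
Proof. by case: z => zr zi /=; rewrite mul0r addr0. Qed.

(** Cauchy-Binet before sorting: summing over all maps f, non-injective ones included, avoids a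
    choice of subsets. The minors are put in order later, in [minor_Theta_space]. *)
Lemma det_mulmx_colsub (F : comNzRingType) n d (A : 'M[F]_(n, d)) (B : 'M[F]_(d, n)) :
  \det (A *m B) = \sum_(f : {ffun 'I_n -> 'I_d}) (\prod_j B (f j) j) * \det (colsub f A).
Proof.
have dT (C : 'M[F]_n) : \det C = \sum_(s : 'S_n) (-1) ^+ s * \prod_j C (s j) j.
  rewrite -det_tr; apply: eq_bigr => s _; congr (_ * _); apply: eq_bigr => j _; by rewrite mxE.
rewrite dT.
transitivity (\sum_(s : 'S_n) \sum_(f : {ffun 'I_n -> 'I_d})
   (-1) ^+ s * \prod_j (A (s j) (f j) * B (f j) j)).
  apply: eq_bigr => s _; rewrite -mulr_sumr; congr (_ * _).
  by rewrite -(bigA_distr_bigA (fun j l => A (s j) l * B l j)); apply: eq_bigr => j _; rewrite mxE.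
rewrite exchange_big; apply: eq_bigr => f _; rewrite dT mulr_sumr; apply: eq_bigr => s _ /=.
rewrite big_split /= mulrA mulrC; congr (_ * (_ * _)).
by apply: eq_bigr => j _; rewrite mxE.
Qed.

Lemma increasing_perm n d (f : 'I_n -> 'I_d) : injective f ->
  exists s : 'S_n, increasing (fun i => f (s i)).
Proof.
move=> fi; pose t := [tuple f i | i < n].
pose leo := fun x y : 'I_d => (x <= y)%N.
have /tuple_permP[s es] : perm_eq (sort leo t) t by rewrite perm_sort.
exists s.
have e i : nth (f i) (sort leo t) i = f (s i).
  by rewrite es (nth_map i) ?size_enum_ord // nth_ord_enum tnth_mktuple.
have so : sorted leo (sort leo t) by apply: sort_sorted => x y; exact: leq_total.
have ss : size (sort leo t) = n by rewrite size_sort size_tuple.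
move=> i k ik.
have le : (f (s i) <= f (s k))%N.
  have := sorted_leq_nth (leT := leo) _ _ (f i) so; rewrite /leo => H.
  have := H (fun x y z => @leq_trans x y z) (fun x => leqnn x) i k.
  rewrite !inE ss !ltn_ord => /(_ isT isT (ltnW ik)).
  by rewrite e (set_nth_default (f k)) ?ss // e.
rewrite ltn_neqAle le andbT; apply/eqP => /val_inj /fi /perm_inj ik'.
by rewrite ik' ltnn in ik.
Qed.

(** * Boundary values *)

Section ThetaSpace.
Variables (R : realType) (n d : nat).
Implicit Types f : 'M[R[i]]_n -> R[i].

Lemma Theta_space_ext f f' : (forall tau, siegel_upper_half tau -> f tau = f' tau) ->
  Theta_space d f -> Theta_space d f'.
Proof.
by move=> e [k [c [F [gF eF]]]]; exists k, c, F; split=> // tau st; rewrite -e // eF.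
Qed.

Lemma Theta_space0 : Theta_space d (fun _ : 'M[R[i]]_n => 0).
Proof.
exists 0%N, (fun=> 0), (fun _ _ => 0); split=> [[]//|tau _]; by rewrite big_ord0.
Qed.

Lemma Theta_spaceZ a f : Theta_space d f -> Theta_space d (fun tau => a * f tau).
Proof.
move=> [k [c [F [gF eF]]]]; exists k, (fun i => a * c i), F; split=> // tau st.
by rewrite eF // mulr_sumr; apply: eq_bigr => i _; rewrite mulrA.
Qed.

Lemma Theta_spaceD f f' : Theta_space d f -> Theta_space d f' ->
  Theta_space d (fun tau => f tau + f' tau).
Proof.
move=> [k [c [F [gF eF]]]] [k' [c' [F' [gF' eF']]]].
exists (k + k')%N, (fun i => match fintype.split i with inl j => c j | inr j => c' j end),
  (fun i => match fintype.split i with inl j => F j | inr j => F' j end); split=> [i|tau st].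
  by case: fintype.split.
rewrite eF // eF' // big_split_ord; congr (_ + _); apply: eq_bigr => i _ /=.
  by rewrite (unsplitK (inl i)).
by rewrite (unsplitK (inr i)).
Qed.

Lemma Theta_space_sum (I : finType) (F : I -> 'M[R[i]]_n -> R[i]) : (forall i, Theta_space d (F i)) ->
  Theta_space d (fun tau => \sum_i F i tau).
Proof.
move=> H; elim: (index_enum I) => [|i r IH].
  by apply: Theta_space_ext Theta_space0 => tau _; rewrite big_nil.
by apply: Theta_space_ext (Theta_spaceD (H i) IH) => tau _; rewrite big_cons.
Qed.

Lemma csumZ (T : choiceType) (S : set T) (a : R) (F : T -> R[i]) :
  csum S (fun t => a%:C * F t) = a%:C * csum S F.
Proof.
have rZ (G : T -> R) : rsum S (fun t => a * G t) = a * rsum S G.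
  rewrite !(rsum_mkcond S) -rsumZ; apply: eq_rsum => t _; by case: ifP; rewrite ?mulr0.
rewrite /csum; apply/eqP; rewrite eq_complex Re_real_mul Im_real_mul /= -!rZ.
by apply/andP; split; apply/eqP; apply: eq_rsum => t _; rewrite ?Re_real_mul ?Im_real_mul.
Qed.

Lemma eq_csum (T : choiceType) (S : set T) (F G : T -> R[i]) :
  (forall t, S t -> F t = G t) -> csum S F = csum S G.
Proof. by move=> e; congr (_ +i* _); apply: eq_rsum => t /e ->. Qed.

Lemma csumM0 (T : choiceType) (S : set T) (F : T -> R[i]) :
  csum S (fun t => 0%:C * F t) = 0.
Proof. by rewrite csumZ mul0r. Qed.

(** Sorting the columns changes an injective minor by a sign, and a repeated column gives 0; so the
    unordered expansion stays in the span of generators with increasing columns. *)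
Lemma minor_Theta_space (Q' : 'M[rat]_d) L' h' (o : 'M[R]_d) (f : 'I_n -> 'I_d) :
  Q'^T = Q' -> pos_def Q' -> is_lattice L' -> o *m toR R Q' *m o^T = 1%:M ->
  Theta_space d (theta_series Q' L' h' o f).
Proof.
move=> sQ pQ lL oQ; case: (boolP (injectiveb f)) => [/injectiveP fi|/injectivePn[i [j ij fij]]].
  have [s s_inc] := increasing_perm fi; pose f' i := f (s i).
  have gen : Theta_space d (theta_series Q' L' h' o f').
    exists 1%N, (fun=> 1), (fun=> theta_series Q' L' h' o f'); split=> [_|tau _].
      by exists Q', L', h', o, f'; split.
    by rewrite big_ord1 mul1r.
  apply: Theta_space_ext (Theta_spaceZ (((-1) ^+ s)%:C) gen) => tau _.
  rewrite /theta_series -csumZ; apply: eq_csum => X _; rewrite mulrA -rmorphM /=; congr (_%:C * _).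
  have -> : colsub f' (toR R X *m invmx o) = col_perm s (colsub f (toR R X *m invmx o)).
    by apply/matrixP => a b; rewrite !mxE.
  by rewrite col_permE det_mulmx det_perm odd_permV mulrCA -expr2 sqrr_sign mulr1.
apply: Theta_space_ext Theta_space0 => tau _.
rewrite /theta_series -[LHS](csumM0 (coset_pow L' h') (fun=> 0)); apply: eq_csum => X _.
rewrite mulr0; have -> : \det (colsub f (toR R X *m invmx o)) = 0.
  by rewrite -det_tr; apply: (determinant_alternate ij) => l; rewrite !mxE fij.
by rewrite mul0r.
Qed.

End ThetaSpace.

Lemma phi_formE (R : realType) p n (Q : 'M[rat]_p.+1) (tau : 'M[R[i]]_n) X Z w :
  let Kv := 2 `^ (n%:R / 2) * \det (map_mx (@complex.Im R) tau) `^ (1 / 2) in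
  let A := pi * \tr (map_mx (@complex.Re R) tau *m (X *m toR R Q *m X^T)) in
  let B := expR (- pi * \tr (map_mx (@complex.Im R) tau *m
    \matrix_(i, j) majorant Q Z (row i X) (row j X))) in
  let D := detform (fun i => bil (toR R Q) (row i X)) w in
  phi_form Q tau X Z w = (Kv * cos A * B * D) +i* (Kv * sin A * B * D).
Proof.
move=> Kv A B D; rewrite /phi_form.
have -> : \matrix_(i, j) bil (toR R Q) (row i X) (row j X) = X *m toR R Q *m X^T.
  by apply/matrixP => i j; rewrite mxE bilE_mx.
rewrite -/Kv -[\det (\matrix_(i, j) bil _ _ (w j))]/D /cexp /B.
set T1 := \tr (_ *m (X *m _ *m _)) in A *; set T2 := \tr (_ *m \matrix_(i, j) _).
have -> : pi%:C * 'i%C * (T1 +i* T2) = (- pi * T2) +i* A.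
  by apply/eqP; rewrite eq_complex /= /A; apply/andP; split; apply/eqP; ring.
by apply/eqP; rewrite eq_complex /=; apply/andP; split; apply/eqP; ring.
Qed.

Section ThetaCusp.
Variables (R : realType) (n d D N : nat) (Q : 'M[rat]_d.+2) (L : set 'rV[rat]_d.+2).
Variables (h : 'M[rat]_(n, d.+2)) (u u' : 'rV[rat]_d.+2) (eW : 'M[rat]_(d, d.+2)).
Variables (M TG : 'M[R]_d) (gq : 'M[rat]_d.+2) (chi : pred (resid n d D)).
Hypotheses (Q_sym : Q^T = Q) (uu : bil Q u u = 0) (u'u' : bil Q u' u' = 0)
  (uu' : bil Q u u' = - (1 / 2)) (eu : eW *m Q *m u^T = 0) (eu' : eW *m Q *m u'^T = 0)
  (eG : toR R (eW *m Q *m eW^T) = Gm TG) (tTG : ltrig TG) (gQ : gq *m Q *m gq^T = Q)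
  (N0 : (0 < N)%N).
Hypothesis bij : set_bij [set k : idx n d D | chi k.1] (coset_pow L h)
  (fun k => Xq N k *m (col_mx u (col_mx u' eW) *m gq)).

Let nu : R := N%:R^-1.
Let nu0 : 0 < nu. Proof. by rewrite invr_gt0 ltr0n. Qed.
Let QR := toR R Q.
Let U := toR R u.
Let U' := toR R u'.
Let eR := toR R eW.
Let gg := toR R gq.
Let E : normedModType R := (R * 'rV[R]_d)%type.

Let QR_sym : QR^T = QR. Proof. by rewrite -toR_tr Q_sym. Qed.
Let UU : bil QR U U = 0. Proof. by rewrite toR_bil uu rmorph0. Qed.
Let U'U' : bil QR U' U' = 0. Proof. by rewrite toR_bil u'u' rmorph0. Qed.
Let UU' : bil QR U U' = - (1 / 2).
Proof. by rewrite toR_bil uu' rmorphN rmorphM /= fmorphV /= rmorph1 ratr_nat. Qed.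
Let toR0 k l : toR R (0 : 'M[rat]_(k, l)) = 0. Proof. exact: map_mx0. Qed.
Let eU : eR *m QR *m U^T = 0. Proof. by rewrite -toR_tr -!toR_mul eu toR0. Qed.
Let eU' : eR *m QR *m U'^T = 0. Proof. by rewrite -toR_tr -!toR_mul eu' toR0. Qed.
Let eGR : eR *m QR *m eR^T = Gm TG. Proof. by rewrite -toR_tr -!toR_mul eG. Qed.
Let ggQ : gg *m QR *m gg^T = QR. Proof. by rewrite -toR_tr -!toR_mul gQ. Qed.
Let uTG : TG \in unitmx. Proof. by have [] := ltrig_unit tTG. Qed.

Definition Xk (k : idx n d D) : 'M[R]_(n, d.+2) :=
  cusp_vec U U' eR (ca nu k) (cb nu k) (cc nu k) *m gg.

Lemma XkQ (k : idx n d D) m (Y : 'M[R]_(m, d.+2)) : Xk k *m QR *m (Y *m gg)^T =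
  cusp_vec U U' eR (ca nu k) (cb nu k) (cc nu k) *m QR *m Y^T.
Proof. by rewrite /Xk trmx_mul -!mulmxA [gg *m _]mulmxA [gg *m _ *m _]mulmxA ggQ. Qed.

Variable tau : 'M[R[i]]_n.
Variable Tv : 'M[R]_n.
Hypotheses (tTv : ltrig Tv) (vE : map_mx (@complex.Im R) tau = Tv *m Tv^T).

Definition Kv : R := 2 `^ (n%:R / 2) * \det (map_mx (@complex.Im R) tau) `^ (1 / 2).
Definition ang (k : idx n d D) : R :=
  pi * \tr (map_mx (@complex.Re R) tau *m (Xk k *m QR *m (Xk k)^T)).
Definition phase_cos (k : idx n d D) : R := if chi k.1 then Kv * cos (ang k) else 0.
Definition phase_sin (k : idx n d D) : R := if chi k.1 then Kv * sin (ang k) else 0.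
Definition ell (k : idx n d D) (i : 'I_n) : 'rV[R]_d.+2 -> R := bil QR (row i (Xk k)).

Lemma majorant_exponent k (x : E) : 0 < x.1 ->
  - pi * \tr (map_mx (@complex.Im R) tau *m \matrix_(i, j)
     majorant Q (zchart U U' eR TG M gg x) (row i (Xk k)) (row j (Xk k))) =
  qpi nu Tv TG M k x.
Proof.
move=> x0; have xn0 : x.1 != 0 by rewrite gt_eqF.
have ZZ : bil QR (zchart U U' eR TG M gg x) (zchart U U' eR TG M gg x) = -1.
  rewrite -(bil_zpt QR_sym UU U'U' UU' eU eU' eGR (beta M x) xn0) /bil /zchart.
  by rewrite trmx_mul -!mulmxA [gg *m (_ *m _)]mulmxA [gg *m _ *m _]mulmxA ggQ.
have XZ i : bil QR (row i (Xk k)) (zchart U U' eR TG M gg x) =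
   - 2^-1 * (cb nu k 0 i * x.1^-1 + x.1 * aA nu TG M k x 0 i).
  rewrite /zchart /bil -!row_mul XkQ mxE (XQzpt QR_sym UU U'U' UU' eU eU' eGR).
  rewrite /aA /gb /bb; move: (ca nu k) (cb nu k) (beta M x *m Gm TG *m (cc nu k)^T) => a b g.
  by rewrite !mxE.
rewrite /qpi vE; congr (_ * _).
have := majorant_trace QR_sym UU U'U' UU' eU eU' eGR Tv (ca nu k) (cb nu k) (cc nu k) (beta M x) xn0.
rewrite -/(bb TG M x) -/(gb nu TG M k x) -/(aA nu TG M k x) => e; rewrite /QQ /Xi -{}e.
congr (\tr (_ *m _)); apply/matrixP => i j; rewrite [LHS]mxE [RHS]mxE majorantE // -/QR !XZ.
by rewrite bilE_mx XkQ.
Qed.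

Lemma theta_cusp (x : E) w : 0 < x.1 -> theta_form Q L h tau (zchart U U' eR TG M gg x) w =
  rsum [set: idx n d D] (fun k => phase_cos k * expR (qpi nu Tv TG M k x) * detform (ell k) w) +i*
  rsum [set: idx n d D] (fun k => phase_sin k * expR (qpi nu Tv TG M k x) * detform (ell k) w).
Proof.
have XE k : toR R (Xq N k *m (col_mx u (col_mx u' eW) *m gq)) = Xk k.
  by rewrite mulmxA toR_mul toR_Xq.
have rs f : rsum (coset_pow L h) f = rsum [set: idx n d D] (fun k =>
    if chi k.1 then f (Xq N k *m (col_mx u (col_mx u' eW) *m gq)) else 0).
  rewrite (reindex_rsum _ bij) rsum_mkcond; apply: eq_rsum => k _.
  by congr (if _ then _ else _); apply/idP/idP; rewrite inE.
move=> x0; rewrite /theta_form /csum !rs.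
by congr (_ +i* _); apply: eq_rsum => k _; rewrite /phase_cos /phase_sin; case: ifP => _; rewrite ?mul0r //;
  rewrite phi_formE /= XE majorant_exponent.
Qed.

Lemma ph_bound (c : R) (b : bool) : `|c| <= 1 -> `|if b then Kv * c else 0| <= `|Kv|.
Proof. by move=> c1; case: b; rewrite ?normr0 // normrM ler_piMr. Qed.

Lemma phase_cos_le k : `|phase_cos k| <= `|Kv|.
Proof. by rewrite /phase_cos ph_bound // ler_norml cos_geN1 cos_le1. Qed.

Lemma phase_sin_le k : `|phase_sin k| <= `|Kv|.
Proof. by rewrite /phase_sin ph_bound // ler_norml sin_geN1 sin_le1. Qed.

(** Here w consists of arbitrary vectors of V(R), not only images under the chart, as alternation on
    B itself requires; the determinant is then a function of the index alone. *)
Lemma asum_theta (ph : idx n d D -> R) Ph (x : E) w : (forall k, `|ph k| <= Ph) -> 0 < x.1 ->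
  asum (fun k => ph k * expR (qpi nu Tv TG M k x) * detform (ell k) w).
Proof.
move=> ph_le x0; pose N1 := @widx_ge1 R n d D.
pose Y := gg *m QR *m (\matrix_j w j)^T.
pose P (k : idx n d D) (_ : E) := ph k * \det (cusp_vec U U' eR (ca nu k) (cb nu k) (cc nu k) *m Y).
have pP : pol (@widx R n d D) P.
  apply: pol_mul.
    by apply: (@pol_idx _ _ _ _ ph Ph) => k; rewrite (le_trans (ph_le k)) // ler_peMr ?N1 //
      (le_trans _ (ph_le k)).
  apply: pol_det; first exact: N1.
  apply: (polM_mul N1); last exact: polM_const.
  apply: polM_add; first apply: polM_add; apply: (polM_mul N1); do ?exact: polM_const.
  - by apply: polM_tr; exact: polM_ca.
  - by apply: polM_tr; exact: polM_cb.
  - exact: polM_cc.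
apply: asum_le (asum_pterm N1 (@asum_widx R n d D) (qpi_decay D nu0 M tTv uTG) pP x0) => k.
have -> // : detform (ell k) w = \det (cusp_vec U U' eR (ca nu k) (cb nu k) (cc nu k) *m Y).
  congr (\det _); apply/matrixP => i j; rewrite [LHS]mxE /ell.
  by rewrite -[w j](rowK w) bilE_mx /Y !mulmxA.
by rewrite /pterm /P mulrAC.
Qed.

Lemma ell_lin k i a (x y : 'rV[R]_d.+2) : ell k i (a *: x + y) = a * ell k i x + ell k i y.
Proof. exact: bilDr. Qed.

Lemma theta_alt (x : E) : 0 < x.1 ->
  alt_multilinear [set: 'rV[R]_d.+2] (theta_form Q L h tau (zchart U U' eR TG M gg x)).
Proof.
move=> x0; rewrite (funext (fun w => theta_cusp w x0)).
apply: alt_multilinear_sum => [|w|w]; first exact: ell_lin.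
  exact: asum_theta phase_cos_le x0.
exact: asum_theta phase_sin_le x0.
Qed.

Lemma ell_chart k (x : E) w : 0 < x.1 ->
  detform (ell k) (fun i => dzpt U U' eR TG M x (w i) *m gg) = \det (pairing_mx nu TG M w k x).
Proof.
move=> x0; rewrite /detform; congr (\det _); apply/matrixP => i j.
rewrite mxE /ell /bil -!row_mul XkQ mxE /dzpt (cusp_vec_gram QR_sym UU U'U' UU' eU eU' eGR).
have eW1 (B : 'M[R]_(1, d)) : (B *m Gm TG *m (Wm M w)^T) 0 j = (B *m Gm TG *m ((w j).2 *m M)^T) 0 0.
  by rewrite mxE [RHS]mxE; apply: eq_bigr => l _; congr (_ * _); rewrite !mxE.
have eW2 : (cc nu k *m Gm TG *m (Wm M w)^T) i j = (cc nu k *m Gm TG *m ((w j).2 *m M)^T) i 0.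
  by rewrite mxE [RHS]mxE; apply: eq_bigr => l _; congr (_ * _); rewrite !mxE.
have eg : (cc nu k *m Gm TG *m (beta M x)^T) i 0 = gb nu TG M k x 0 i.
  by rewrite /gb -Gm_tr mxE.
have S11 m (a : 'rV[R]_n) (b : 'rV[R]_m) i1 j1 : (a^T *m b) i1 j1 = a 0 i1 * b 0 j1.
  by rewrite mxE big_ord1 mxE.
have erw : rw TG M w x 0 j = - 2^-1 * ((bb TG M x - x.1^-1 ^+ 2) * (w j).1 +
    2 * x.1 * (beta M x *m Gm TG *m ((w j).2 *m M)^T) 0 0).
  rewrite /rw -(eW1 (beta M x)); move: (beta M x *m Gm TG *m (Wm M w)^T) => P.
  by rewrite !mxE.
rewrite !mul_mx_scalar [(_ + _)^T]linearD /= [(_ *: beta _ _)^T]linearZ [(_ *: (_ *m M))^T]linearZ /=.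
rewrite mulmxDr -!scalemxAr.
rewrite /pairing_mx [RHS]mxE [X in _ = X + _]mxE !S11 erw [X in _ = _ + X]mxE eW2.
move: eg; move: (cc nu k *m Gm TG *m (beta M x)^T) (cc nu k *m Gm TG *m ((w j).2 *m M)^T).
move: ((beta M x *m Gm TG *m ((w j).2 *m M)^T) 0 0) (gb nu TG M k x) (ca nu k) (cb nu k).
move=> r g a b P1 P2 eg.
by rewrite !mxE eg; field; rewrite gt_eqF.
Qed.

Lemma pullback_theta (x : E) w : 0 < x.1 ->
  pullback (zchart U U' eR TG M gg) (theta_form Q L h tau) x w =
  pseries (qpi nu Tv TG M) (pw nu TG M w phase_cos) x +i* pseries (qpi nu Tv TG M) (pw nu TG M w phase_sin) x.
Proof.
move=> x0; rewrite /pullback.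
have -> : (fun i => 'D_(w i) (zchart U U' eR TG M gg) x) = (fun i => dzpt U U' eR TG M x (w i) *m gg).
  by apply/funext => i; have [_ ->] := zchart_derive U U' eR TG M gg (w i) x0.
rewrite theta_cusp //; congr (_ +i* _); apply: eq_rsum => k _; rewrite ell_chart //;
  by rewrite /pterm /pw mulrAC.
Qed.

Lemma dzpt_lin (x : E) a (y z : E) : dzpt U U' eR TG M x (a *: y + z) *m gg =
  a *: (dzpt U U' eR TG M x y *m gg) + dzpt U U' eR TG M x z *m gg.
Proof.
rewrite scalemxAl -mulmxDl; congr (_ *m _); rewrite /dzpt /cusp_vec !tr_scalar_mx !mul_scalar_mx /=.
rewrite mulmxDl -scalemxAl; move: (y.2 *m M) (z.2 *m M) => Y Z.
have -> : (a *: Y + Z)^T = a *: Y^T + Z^T by rewrite linearD linearZ.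
rewrite mulmxDr -scalemxAr.
move: (beta M x *m Gm TG *m Y^T) (beta M x *m Gm TG *m Z^T) => P1 P2.
rewrite ?(mulmxDl, =^~ scalemxAl); move: (beta M x *m eR) (Y *m eR) (Z *m eR) => P3 P4 P5.
by rewrite -![a *: y.1]/(a * y.1); apply/rowP => i; rewrite !mxE; ring.
Qed.

Definition S0 (t : idx0 n d D) : 'M[R]_n := cc0 nu t *m Gm TG *m (cc0 nu t)^T.
Definition chi0 (t : resid0 n d D) : bool := chi ((t.1, const_mx ord0), t.2).
Definition ang0 (t : idx0 n d D) : R := pi * \tr (map_mx (@complex.Re R) tau *m S0 t).

Lemma ang_emb0 t z : ang (emb0 (t, z)) = ang0 t.
Proof.
rewrite /ang /ang0; congr (_ * \tr (_ *m _)).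
rewrite [in X in _ *m X^T]/Xk XkQ (cusp_vec_gram QR_sym UU U'U' UU' eU eU' eGR) cb_emb0 trmx0.
by rewrite mulmx0 mul0mx addr0 scaler0 add0r cc_emb0.
Qed.

Definition phase0_cos (t : idx0 n d D) : R := if chi0 t.1 then Kv * cos (ang0 t) else 0.
Definition phase0_sin (t : idx0 n d D) : R := if chi0 t.1 then Kv * sin (ang0 t) else 0.

Lemma phase_cos_emb0 t z : phase_cos (emb0 (t, z)) = phase0_cos t.
Proof. by rewrite /phase_cos ang_emb0. Qed.

Lemma phase_sin_emb0 t z : phase_sin (emb0 (t, z)) = phase0_sin t.
Proof. by rewrite /phase_sin ang_emb0. Qed.

Variable Cg : R.
Hypothesis HCg : gauss_const Cg.

(* In Kv times the Gaussian constant the factors det v ^ (1/2) cancel, so kap does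
   not depend on tau. *)
Definition kap : R := 2 `^ (n%:R / 2) * (Cg / (Num.sqrt (pi / 2) * (nu * D.+1%:R))) ^+ n.

Definition boundary_term (w : 'I_n -> E) (t : idx0 n d D) : R[i] :=
  if chi0 t.1 then (\det (K0 nu TG M w t))%:C *
    cexp (pi%:C * 'i%C * \tr (map_mx (real_complex R) (S0 t) *m tau)) else 0.

Definition boundary_form (w : 'I_n -> E) : R[i] := kap%:C * csum [set: idx0 n d D] (boundary_term w).

Lemma Kv_Tg : Cg ^+ n / \det (Tg D nu Tv) * Kv = kap.
Proof.
have [dTv _] := ltrig_unit tTv.
have -> : Kv = 2 `^ (n%:R / 2) * \det Tv.
  rewrite /Kv vE det_mulmx det_tr -expr2; congr (_ * _).
  rewrite -powR_mulrn ?(ltW dTv) // -powRrM.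
  by have -> : 2%:R * (1 / 2) = 1 :> R; [field|rewrite powRr1 // ltW].
have c0 : 0 < Num.sqrt (pi / 2) * (nu * D.+1%:R) :> R.
  by rewrite !mulr_gt0 // sqrtr_gt0 divr_gt0 // pi_gt0.
rewrite /kap /Tg detZ expr_div_n; move: c0; set c := _ * _ => c0.
have cn0 : c ^+ n != 0 by rewrite expf_neq0 // gt_eqF.
by field; rewrite cn0 gt_eqF.
Qed.

(** Stated with [Kv], which is nonzero for tau in the upper half space, so that summability can be
    carried back to [boundary_term]; nothing excludes at this point that [kap] vanishes. *)
Lemma Kv_boundary_term w t : Kv%:C * boundary_term w t =
  bterm nu Tv TG M w phase0_cos t +i* bterm nu Tv TG M w phase0_sin t.
Proof.
rewrite /boundary_term /bterm /phase0_cos /phase0_sin; case: ifP => _; last by rewrite !mulr0 !mul0r.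
have -> : g0 nu Tv TG t = expR (- pi * \tr (map_mx (@complex.Im R) tau *m S0 t)).
  by rewrite vE /S0 /Gm fsq_trace.
have -> : \tr (map_mx (real_complex R) (S0 t) *m tau) =
    \tr (map_mx (@complex.Re R) tau *m S0 t) +i* \tr (map_mx (@complex.Im R) tau *m S0 t).
  have {1}-> : tau = map_mx (real_complex R) (map_mx (@complex.Re R) tau) +
      'i%C *: map_mx (real_complex R) (map_mx (@complex.Im R) tau).
    by apply/matrixP => i j; rewrite !mxE -complexE.
  rewrite mulmxDr -scalemxAr mxtraceD mxtraceZ -!map_mxM !trace_map_mx ![\tr (S0 t *m _)]mxtrace_mulC.
  by apply/eqP; rewrite eq_complex /=; apply/andP; split; apply/eqP; ring.
rewrite /cexp /ang0; set T1 := \tr _; set T2 := \tr _.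
have -> : pi%:C * 'i%C * (T1 +i* T2) = (- pi * T2) +i* (pi * T1).
  by apply/eqP; rewrite eq_complex /=; apply/andP; split; apply/eqP; ring.
by apply/eqP; rewrite eq_complex /=; apply/andP; split; apply/eqP; ring.
Qed.

Lemma boundary_termE w t : kap%:C * boundary_term w t =
  (Cg ^+ n / \det (Tg D nu Tv) * bterm nu Tv TG M w phase0_cos t) +i*
  (Cg ^+ n / \det (Tg D nu Tv) * bterm nu Tv TG M w phase0_sin t).
Proof.
rewrite -Kv_Tg; move: (Cg ^+ n / _) => c; rewrite rmorphM /= -mulrA Kv_boundary_term.
by apply/eqP; rewrite eq_complex Re_real_mul Im_real_mul /= !eqxx.
Qed.

Lemma asum_boundary_term w : asum (fun t => complex.Re (boundary_term w t)) /\
  asum (fun t => complex.Im (boundary_term w t)).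
Proof.
have [dTv _] := ltrig_unit tTv.
have Kv0 : Kv != 0.
  rewrite /Kv vE det_mulmx det_tr gt_eqF // mulr_gt0 ?powR_gt0 //; exact: mulr_gt0.
have e t := Kv_boundary_term w t.
split.
  apply: asum_le (asumZ Kv^-1 (asum_bterm nu0 M tTv uTG w phase_cos_le phase_cos_emb0)) => t.
  by have /(congr1 (@complex.Re R)) := e t; rewrite Re_real_mul /= => <-; rewrite mulKf.
apply: asum_le (asumZ Kv^-1 (asum_bterm nu0 M tTv uTG w phase_sin_le phase_sin_emb0)) => t.
by have /(congr1 (@complex.Im R)) := e t; rewrite Im_real_mul /= => <-; rewrite mulKf.
Qed.

Lemma boundary_formE w : boundary_form w =
  (Cg ^+ n / \det (Tg D nu Tv) * rsum [set: idx0 n d D] (bterm nu Tv TG M w phase0_cos)) +i*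
  (Cg ^+ n / \det (Tg D nu Tv) * rsum [set: idx0 n d D] (bterm nu Tv TG M w phase0_sin)).
Proof.
rewrite /boundary_form; apply/eqP; rewrite eq_complex Re_real_mul Im_real_mul /= -!rsumZ.
apply/andP; split; apply/eqP; apply: eq_rsum => t _; rewrite -?Re_real_mul -?Im_real_mul boundary_termE //.
Qed.

(** The value for s <= 0 does not involve the point, so the restriction to the torus has constant
    coefficients. *)
Definition eta_cusp (x : E) (w : 'I_n -> E) : R[i] :=
  if 0 < x.1 then pullback (zchart U U' eR TG M gg) (theta_form Q L h tau) x w else boundary_form w.

Lemma eta_cusp_smooth : smooth_nform [set x : E | 0 <= x.1] eta_cusp.
Proof.
split=> [x _|w].
  rewrite /eta_cusp; case: (ltP 0 x.1) => x0.
    have -> : pullback (zchart U U' eR TG M gg) (theta_form Q L h tau) x =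
        (fun w => theta_form Q L h tau (zchart U U' eR TG M gg x)
           (fun i => dzpt U U' eR TG M x (w i) *m gg)).
      apply/funext => w; congr (theta_form _ _ _ _ _ _); apply/funext => i.
      by have [_ ->] := zchart_derive U U' eR TG M gg (w i) x0.
    apply: (@alt_multilinear_comp R n E _ _ _ (fun v => dzpt U U' eR TG M x v *m gg) _ _ (theta_alt x0)) => //.
    exact: dzpt_lin.
  change (alt_multilinear [set: E] boundary_form).
  pose ell0 (t : idx0 n d D) (i : 'I_n) (v : E) : R := (cc0 nu t *m Gm TG *m (v.2 *m M)^T) i 0.
  pose cf := Cg ^+ n / \det (Tg D nu Tv).
  have be (ph : idx0 n d D -> R) w t : cf * bterm nu Tv TG M w ph t =
      cf * (ph t * g0 nu Tv TG t) * detform (ell0 t) w.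
    rewrite /bterm !mulrA; congr (_ * \det _); apply/matrixP => i j.
    by rewrite mxE [RHS]mxE /ell0 mxE; apply: eq_bigr => l _; congr (_ * _); rewrite !mxE.
  rewrite (_ : boundary_form = fun w =>
     rsum [set: idx0 n d D] (fun t => cf * (phase0_cos t * g0 nu Tv TG t) * detform (ell0 t) w) +i*
     rsum [set: idx0 n d D] (fun t => cf * (phase0_sin t * g0 nu Tv TG t) * detform (ell0 t) w)); last first.
    by apply/funext => w; rewrite boundary_formE -!rsumZ; congr (_ +i* _); apply: eq_rsum => t _; exact: be.
  apply: alt_multilinear_sum => [t i a y z|w|w].
  - rewrite /ell0 /= mulmxDl -scalemxAl linearD linearZ /= mulmxDr -scalemxAr.
    by rewrite mxE [X in X + _]mxE.
  - rewrite -(funext (be phase0_cos w)); apply: asumZ.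
    exact: (asum_bterm nu0 M tTv uTG w phase_cos_le phase_cos_emb0).
  - rewrite -(funext (be phase0_sin w)); apply: asumZ.
    exact: (asum_bterm nu0 M tTv uTG w phase_sin_le phase_sin_emb0).
have m1 := model_smooth nu0 M tTv uTG w phase_cos_le phase_cos_emb0 HCg.
have m2 := model_smooth nu0 M tTv uTG w phase_sin_le phase_sin_emb0 HCg.
split=> x _; eexists; eexists; split; [exact: openT|by []|exact: m1| |exact: openT|by []|exact: m2|].
  by move=> y _ _; rewrite /eta_cusp; case: ifP => y0; rewrite ?pullback_theta ?boundary_formE.
by move=> y _ _; rewrite /eta_cusp; case: ifP => y0; rewrite ?pullback_theta ?boundary_formE.
Qed.

End ThetaCusp.

Section ComplexSums.
Variable R : realType.

Definition casum (T : choiceType) (F : T -> R[i]) : Prop :=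
  asum (fun t => complex.Re (F t)) /\ asum (fun t => complex.Im (F t)).

Lemma Re_sum (I : finType) (F : I -> R[i]) : complex.Re (\sum_i F i) = \sum_i complex.Re (F i).
Proof. by apply: (big_morph (@complex.Re R)) => // [[a b] [a' b']]. Qed.

Lemma Im_sum (I : finType) (F : I -> R[i]) : complex.Im (\sum_i F i) = \sum_i complex.Im (F i).
Proof. by apply: (big_morph (@complex.Im R)) => // [[a b] [a' b']]. Qed.

Lemma csum_lincomb (T : choiceType) (I : finType) (c : I -> R) (F : I -> T -> R[i]) :
  (forall i, casum (F i)) ->
  csum [set: T] (fun t => \sum_i (c i)%:C * F i t) = \sum_i (c i)%:C * csum [set: T] (F i).
Proof.
move=> sF; under [RHS]eq_bigr do rewrite -csumZ.
rewrite {1}/csum; apply/eqP; rewrite eq_complex /= Re_sum Im_sum /=.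
apply/andP; split; apply/eqP; rewrite -rsum_sum.
- by apply: eq_rsum => t _; rewrite Re_sum.
- move=> i _; apply: asum_le (asumZ (c i) (proj1 (sF i))) => t; by rewrite Re_real_mul.
- by apply: eq_rsum => t _; rewrite Im_sum.
- move=> i _; apply: asum_le (asumZ (c i) (proj2 (sF i))) => t; by rewrite Im_real_mul.
Qed.

Lemma csum_fin_prod (I : finType) (T : choiceType) (F : I * T -> R[i]) : casum F ->
  csum [set: I * T] F = \sum_i csum [set: T] (fun t => F (i, t)).
Proof.
move=> [s1 s2]; apply/eqP; rewrite eq_complex Re_sum Im_sum /=.
by rewrite (proj2 (rsum_prod s1)) (proj2 (rsum_prod s2)) !rsum_finite !eqxx.
Qed.

Lemma reindex_csum (T T' : choiceType) (S : set T) (S' : set T') (e : T -> T') (f : T' -> R[i]) :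
  set_bij S S' e -> csum S' f = csum S (fun x => f (e x)).
Proof. by move=> be; rewrite /csum !(reindex_rsum _ be). Qed.

End ComplexSums.

Section Boundary.
Variables (R : realType) (n d D N : nat) (Q : 'M[rat]_d.+2).
Variables (u u' : 'rV[rat]_d.+2) (eW : 'M[rat]_(d, d.+2)).
Variables (M TG : 'M[R]_d) (gq : 'M[rat]_d.+2) (chi : pred (resid n d D)).
Hypotheses (Q_sym : Q^T = Q) (uu : bil Q u u = 0) (u'u' : bil Q u' u' = 0)
  (uu' : bil Q u u' = - (1 / 2)) (eu : eW *m Q *m u^T = 0) (eu' : eW *m Q *m u'^T = 0)
  (pW : pos_def (eW *m Q *m eW^T))
  (eG : toR R (eW *m Q *m eW^T) = Gm TG) (tTG : ltrig TG) (gQ : gq *m Q *m gq^T = Q)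
  (N0 : (0 < N)%N) (DN : D.+1 = (N * N)%N).

Let E : normedModType R := (R * 'rV[R]_d)%type.
Let Q' := eW *m Q *m eW^T.
Let uTG : TG \in unitmx. Proof. by have [] := ltrig_unit tTG. Qed.
Let NR0 : N%:R != 0 :> rat. Proof. by rewrite pnatr_eq0 -lt0n. Qed.

(** For a fixed residue rho the coordinates N^-1 (rho + N^2 z) run over a coset of N Z; this is the
    lattice L' of the generating theta series. *)
Definition scaled_Zd : set 'rV[rat]_d := [set map_mx intr z *m (N%:R%:M : 'M[rat]_d) | z in [set: 'rV[int]_d]].

Lemma scaled_Zd_lattice : is_lattice scaled_Zd.
Proof. by exists (N%:R%:M) => //; rewrite unitmxE det_scalar unitfE expf_neq0. Qed.

Lemma cc0_toR (t : idx0 n d D) : cc0 (N%:R^-1 : R) t = toR R (crdmx N (t.1.2, t.2)).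
Proof. by apply/matrixP => i j; rewrite !mxE ratr_crdq. Qed.

Lemma crdmx_bij (r : 'M['I_D.+1]_(n, d)) :
  set_bij [set: 'M[int]_(n, d)] (coset_pow scaled_Zd (crdmx N (r, 0))) (fun z => crdmx N (r, z)).
Proof.
have DR : D.+1%:R = N%:R * N%:R :> rat by rewrite DN natrM.
have e z : crdmx N (r, z) = crdmx N (r, 0) + N%:R *: map_mx intr z.
  by apply/matrixP => i j; rewrite !mxE /crdq /= DR mulr0 addr0; field.
split=> [z _ i|z z' _ _|X HX].
- exists (row i z) => //; rewrite (e z) addrC addKr mul_mx_scalar map_row.
  by apply/rowP => j; rewrite !mxE.
- rewrite (e z) (e z') => /addrI /(scalerI NR0) /matrixP ez; apply/matrixP => i j.
  by have := ez i j; rewrite !mxE => /intr_inj.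
have /choice[f Hf] : forall i, exists z : 'rV[int]_d,
    map_mx intr z *m (N%:R%:M : 'M[rat]_d) = row i (X - crdmx N (r, 0)).
  by move=> i; have [z _ ez] := HX i; exists z.
exists (\matrix_i f i) => //; rewrite e; apply/row_matrixP => i; rewrite linearD linearZ /=.
by rewrite -map_row rowK -mul_mx_scalar Hf linearB /= addrC subrK.
Qed.

Definition wminor (f : 'I_n -> 'I_d) : 'I_n -> E := fun j => (0, delta_mx 0 (f j)).

(* For the chart matrix invmx TG the boundary terms are exactly the minors in the
   orthonormal basis invmx TG of W. *)
Lemma K0_minor (f : 'I_n -> 'I_d) (t : idx0 n d D) :
  K0 (N%:R^-1) TG (invmx TG) (wminor f) t = colsub f (cc0 (N%:R^-1) t *m TG).
Proof.
rewrite /K0 /Gm.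
have -> : (Wm (invmx TG) (wminor f))^T = colsub f (invmx TG)^T.
  apply/matrixP => i j; rewrite mxE /Wm [LHS]mxE [X in X 0 i]/= -rowE.
  by rewrite !mxE.
have mc m (A : 'M[R]_(m, d)) (B : 'M[R]_d) : A *m colsub f B = colsub f (A *m B).
  by apply/matrixP => i j; rewrite !mxE; apply: eq_bigr => l _; rewrite mxE.
by rewrite mc !mulmxA -[_ *m TG^T *m _]mulmxA -trmx_mul mulVmx // trmx1 mulmx1.
Qed.

(** Cauchy-Binet for the product of cc0 TG, the orthonormal coordinates of c, with a factor
    depending on w alone; the latter supplies the coefficients of the linear combination. *)
Lemma boundary_term_minors (tau : 'M[R[i]]_n) (w : 'I_n -> E) (t : idx0 n d D) :
  boundary_term N M TG chi tau w t = \sum_(f : {ffun 'I_n -> 'I_d})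
    (\prod_j (TG^T *m (Wm M w)^T) (f j) j)%:C * boundary_term N (invmx TG) TG chi tau (wminor f) t.
Proof.
rewrite /boundary_term; case: ifP => _; last by rewrite big1 // => f _; rewrite mulr0.
have -> : K0 (N%:R^-1) TG M w t = (cc0 (N%:R^-1) t *m TG) *m (TG^T *m (Wm M w)^T).
  by rewrite /K0 /Gm !mulmxA.
rewrite det_mulmx_colsub rmorph_sum /= mulr_suml; apply: eq_bigr => f _.
by rewrite K0_minor rmorphM /= mulrA.
Qed.

Lemma csum_minor (tau : 'M[R[i]]_n) (f : 'I_n -> 'I_d) (r : resid0 n d D) : chi0 chi r ->
  csum [set: 'M[int]_(n, d)] (fun z => boundary_term N (invmx TG) TG chi tau (wminor f) (r, z)) =
  theta_series Q' scaled_Zd (crdmx N (r.2, 0)) (invmx TG) f tau.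
Proof.
move=> cr; rewrite /theta_series (reindex_csum _ (crdmx_bij r.2)); apply: eq_csum => z _.
rewrite /boundary_term [X in if X then _ else _]cr K0_minor invmxK.
have -> : S0 N TG (r, z) = toR R (crdmx N (r.2, z) *m Q' *m (crdmx N (r.2, z))^T).
  by rewrite /S0 cc0_toR -eG -toR_tr -!toR_mul.
by rewrite cc0_toR.
Qed.

Lemma boundary_Theta_space (Cg : R) (w : 'I_n -> E) :
  Theta_space d (fun tau => boundary_form N M TG chi tau Cg w).
Proof.
apply: Theta_spaceZ.
apply: (@Theta_space_ext R n d (fun tau => \sum_(f : {ffun 'I_n -> 'I_d})
   (\prod_j (TG^T *m (Wm M w)^T) (f j) j)%:C * \sum_(r : resid0 n d D)
    (chi0 chi r)%:R * theta_series Q' scaled_Zd (crdmx N (r.2, 0)) (invmx TG) f tau)); last first.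
  apply: Theta_space_sum => f; apply: Theta_spaceZ; apply: Theta_space_sum => r; apply: Theta_spaceZ.
  apply: minor_Theta_space => //; last 2 first.
  - exact: scaled_Zd_lattice.
  - rewrite eG /Gm !mulmxA mulVmx // mul1mx -trmx_mul mulVmx // trmx1 //.
  by rewrite /Q' !trmx_mul trmxK Q_sym mulmxA.
move=> tau [stau ptau].
have vs : (map_mx (@complex.Im R) tau)^T = map_mx (@complex.Im R) tau by rewrite map_trmx stau.
(* The factor Tv varies with tau, but it enters only the proof of summability; the two sides being
   compared do not contain it. *)
have [Tv tTv vE] := cholesky vs ptau.
have as_ M' w' := asum_boundary_term M' chi Q_sym uu u'u' uu' eu eu' eG tTG gQ N0 tTv vE w'.
rewrite (eq_csum (fun t _ => boundary_term_minors tau w t)).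
rewrite csum_lincomb; last by move=> f; exact: as_.
apply: eq_bigr => f _; congr (_ * _); rewrite csum_fin_prod; last exact: as_.
apply: eq_bigr => r _; case: (boolP (chi0 chi r)) => cr; first by rewrite mul1r csum_minor.
rewrite mul0r -[LHS](csumM0 [set: 'M[int]_(n, d)] (fun=> 0)); apply: eq_csum => z _.
by rewrite mulr0 /boundary_term (negbTE cr).
Qed.

End Boundary.

(** * Extension across one cusp *)

Section CuspExtension.
Variables (R : realType) (n d : nat) (Q : 'M[rat]_d.+2) (L : set 'rV[rat]_d.+2).
Variables (h : 'M[rat]_(n, d.+2)) (u u' : 'rV[rat]_d.+2) (e : 'M[R]_(d, d.+2)).
Variable gq : 'M[rat]_d.+2.
Hypotheses (Q_sym : Q^T = Q) (Q_sig : signature_p1 R Q) (lL : is_lattice L)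
  (uu : bil Q u u = 0) (u'u' : bil Q u' u' = 0)
  (uu' : bil Q u u' = - (1 / 2)) (he : @basis_of_W R d.+1 Q u u' e)
  (gQ : gq *m Q *m gq^T = Q) (ugq : gq \in unitmx).

Let E : normedModType R := (R * 'rV[R]_d)%type.

Definition chart (x : E) : 'rV[R]_d.+2 := horo_point Q u u' x.1^-1 (x.2 *m e) *m toR R gq.

Lemma horo_pointE (eW : 'M[rat]_(d, d.+2)) (M TG : 'M[R]_d) (x : E) : e = M *m toR R eW ->
  toR R (eW *m Q *m eW^T) = Gm TG -> horo_point Q u u' x.1^-1 (x.2 *m e) =
  zpt (toR R u) (toR R u') (toR R eW) TG x.1 (beta M x).
Proof.
move=> eM eG; rewrite /horo_point /zpt invrK eM mulmxA -/(beta M x); congr (_ *: _ + _ + _).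
by rewrite /bil -eG !toR_mul toR_tr trmx_mul !mulmxA.
Qed.

Lemma chart_shift_derive (gam : 'M[R]_d.+2) (lam : 'rV[R]_d) (x w : E) :
  (forall (s : R) y, 0 < s -> chart (s, y) *m gam = chart (s, y + lam)) -> 0 < x.1 ->
  'D_w chart (x.1, x.2 + lam) = 'D_w chart x *m gam.
Proof.
have [eW [M [TG [_ _ eM _ [_ eG]]]]] := cusp_geometry Q_sym Q_sig uu u'u' uu' he.
have ce : chart = zchart (toR R u) (toR R u') (toR R eW) TG M (toR R gq).
  by apply/funext => y; rewrite /chart (horo_pointE _ eM eG).
move=> H x0.
have -> : 'D_w chart x *m gam = 'D_w (fun y => chart y *m gam) x.
  have -> : (fun y => chart y *m gam) =
      zchart (toR R u) (toR R u') (toR R eW) TG M (toR R gq *m gam).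
    by apply/funext => y; rewrite ce /zchart mulmxA.
  have [_ ->] := zchart_derive (toR R u) (toR R u') (toR R eW) TG M (toR R gq *m gam) w x0.
  rewrite ce; have [_ ->] := zchart_derive (toR R u) (toR R u') (toR R eW) TG M (toR R gq) w x0.
  by rewrite mulmxA.
transitivity ('D_w (fun y : E => chart (y + (0, lam))) x).
  have -> : (x.1, x.2 + lam) = x + (0, lam) :> E by rewrite -[X in (X, _)]addr0.
  rewrite /derive; have -> // : (fun k : R => k^-1 *: ((chart \o shift (x + (0, lam))) (k *: w) -
      chart (x + (0, lam)))) = (fun k => k^-1 *: (((fun y => chart (y + (0, lam))) \o shift x)
      (k *: w) - chart (x + (0, lam)))).
  by apply/funext => k /=; rewrite addrA.
(* The translation rule holds for s > 0 only, so the derivatives are compared on a neighbourhood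
   inside this region. *)
have Hy (y : E) : 0 < y.1 -> chart (y + (0, lam)) = chart y *m gam.
  by case: y => a b /= a0; rewrite H // -[in RHS](addr0 a).
by apply: near_eq_derive; near=> y; apply: Hy; near: y; exact: nbhs_fst_gt0.
Unshelve. all: by end_near. Qed.

Lemma pullback_shift (gam : 'M[R]_d.+2) (lam : 'rV[R]_d) (om : nform n 'rV[R]_d.+2) (x : E) w :
  (forall (s : R) y, 0 < s -> chart (s, y) *m gam = chart (s, y + lam)) ->
  (forall Z v, om (Z *m gam) (fun k => v k *m gam) = om Z v) -> 0 < x.1 ->
  pullback chart om (x.1, x.2 + lam) w = pullback chart om x w.
Proof.
move=> H omg x0; rewrite /pullback -[RHS]omg.
have -> : chart x *m gam = chart (x.1, x.2 + lam) by rewrite -H //; case: x {x0}.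
by congr (om _ _); apply/funext => i; exact: chart_shift_derive H x0.
Qed.

(** The indexing of the coset and the Gaussian constant are fixed before tau, so that for given w
    the boundary value is one function of tau, to which [Theta_space] applies; the Cholesky factor
    of Im tau is chosen afterwards, inside the proofs. *)
Lemma cusp_extension : exists eta : 'M[R[i]]_n -> nform n E,
  [/\ forall tau, siegel_upper_half tau -> smooth_nform [set x : E | 0 <= x.1] (eta tau),
      forall tau (x : E) w, 0 < x.1 -> eta tau x w = pullback chart (theta_form Q L h tau) x w,
      forall tau (x : E) y w, x.1 <= 0 -> eta tau x w = eta tau (0, y) w,
      forall w, Theta_space d (fun tau => eta tau (0, 0) w) &
      forall tau x, siegel_upper_half tau -> 0 < x.1 ->
        alt_multilinear [set: 'rV[R]_d.+2] (theta_form Q L h tau (chart x))].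
Proof.
have [eW [M [TG [uE [eu eu'] eM pW [tTG eG]]]]] := cusp_geometry Q_sym Q_sig uu u'u' uu' he.
have uE' : col_mx u (col_mx u' eW) *m gq \in unitmx by rewrite unitmx_mul uE.
have [N [D [chi [N0 DN bij]]]] := cusp_indexing h uE' lL.
have [Cg HCg] := gauss_sum R.
have ce : chart = zchart (toR R u) (toR R u') (toR R eW) TG M (toR R gq).
  by apply/funext => y; rewrite /chart (horo_pointE _ eM eG).
exists (fun tau => eta_cusp N Q L h u u' eW M TG gq chi tau Cg).
have chol tau : siegel_upper_half tau ->
    exists2 Tv : 'M[R]_n, ltrig Tv & map_mx (@complex.Im R) tau = Tv *m Tv^T.
  by move=> [st pt]; apply: cholesky pt; rewrite map_trmx st.
split=> [tau st|tau x w x0|tau x y w x0|w|tau x st x0].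
- have [Tv tTv vE] := chol _ st.
  exact: (eta_cusp_smooth M Q_sym uu u'u' uu' eu eu' eG tTG gQ N0 bij tTv vE HCg).
- by rewrite /eta_cusp x0 ce.
- by rewrite /eta_cusp /= ltxx ltNge x0.
- apply: Theta_space_ext (boundary_Theta_space M chi Q_sym uu u'u' uu' eu eu' pW eG tTG gQ N0 DN Cg w).
  by move=> tau _; rewrite /eta_cusp /= ltxx.
- have [Tv tTv vE] := chol _ st; rewrite ce.
  exact: (theta_alt M Q_sym uu u'u' uu' eu eu' eG tTG gQ N0 bij tTv vE x0).
Qed.

(** Summability of theta is known in cusp coordinates. This brings every point of B into the chart
    of the first cusp, where [gq] is the identity. *)
Lemma hyperboloid_chart (Z : 'rV[R]_d.+2) : gq = 1%:M -> bil (toR R Q) Z Z = -1 ->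
  bil (toR R Q) (toR R u) Z < 0 -> exists2 x : E, 0 < x.1 & Z = chart x.
Proof.
move=> g1 ZZ uZ; set B := bil (toR R Q) in ZZ uZ *.
pose U := toR R u; pose U' := toR R u'.
have sR : (toR R Q)^T = toR R Q by rewrite -toR_tr Q_sym.
have UU : B U U = 0 by rewrite /B toR_bil uu rmorph0.
have U'U' : B U' U' = 0 by rewrite /B toR_bil u'u' rmorph0.
have UU' : B U U' = - (1 / 2).
  by rewrite /B toR_bil uu' rmorphN rmorphM /= fmorphV /= rmorph1 ratr_nat.
have U'U : B U' U = - (1 / 2) by rewrite /B bil_sym.
(* Since (u0, u0') = -1/2, pairing Z = al u0 + s b + s u0' with u0 and u0' returns -s/2 and
   -al/2. *)
pose s := - 2 * B U Z; pose al := - 2 * B U' Z.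
have s0 : 0 < s by rewrite /s; lra.
have UZ : B U Z = - (s / 2) by rewrite /s; field.
have U'Z : B U' Z = - (al / 2) by rewrite /al; field.
have ZU : B Z U = - (s / 2) by rewrite /B bil_sym.
have ZU' : B Z U' = - (al / 2) by rewrite /B bil_sym.
pose b := s^-1 *: (- al *: U + (- s *: U' + Z)).
have bU : B b U = 0 by rewrite /B /b bilZl !bilDl -/B UU U'U ZU; field; rewrite gt_eqF.
have bU' : B b U' = 0 by rewrite /B /b bilZl !bilDl -/B UU' U'U' ZU'; field; rewrite gt_eqF.
have /submxP[y ey] : (b <= e)%MS by apply/(proj2 he).
have Zb : Z = al *: U + (s *: b + s *: U').
  rewrite /b scalerA mulfV ?gt_eqF // scale1r; apply/rowP => i; rewrite !mxE; ring.
have bb : B b b = s^-1 * (al - s^-1).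
  have : B (al *: U + (s *: b + s *: U')) Z = -1 by rewrite -Zb.
  rewrite /B bilDl bilDl (bilZl _ U') -/B UZ U'Z.
  have -> : B b Z = s * B b b.
    by rewrite [in LHS]Zb /B bilDr bilDr (bilZr _ b U') -/B bU bU'; ring.
  move=> h1; have : s * (s * B b b) = al * s - 1 by lra.
  move=> h2; have sn0 : s != 0 by rewrite gt_eqF.
  apply: (mulfI sn0); apply: (mulfI sn0); rewrite h2; by field.
exists (s, y) => //; rewrite /chart g1 /toR map_mx1 mulmx1 /horo_point /= invrK -ey -/B bb.
rewrite [in LHS]Zb addrA; congr (_ *: _ + _ + _); by field; rewrite gt_eqF.
Qed.

End CuspExtension.

Lemma lattice_add k (L : set 'rV[rat]_k) x y : is_lattice L -> L x -> L y -> L (x + y).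
Proof.
move=> [E _ ->] [z _ <-] [z' _ <-]; exists (z + z') => //.
by rewrite map_mxD mulmxDl.
Qed.

(** * Invariance of theta under Gamma *)

Section GammaInvariance.
Variables (R : realType) (p n : nat) (Q : 'M[rat]_p.+1) (L : set 'rV[rat]_p.+1).
Variables (Gamma : set 'M[rat]_p.+1) (h : 'M[rat]_(n, p.+1)).
Hypotheses (lL : is_lattice L) (hGamma : admissible_group R Q L Gamma)
  (hh : forall i, dual_lattice Q L (row i h)).

Lemma SO_component_isometry g : SO_id_component Q (toR R g) ->
  g *m Q *m g^T = Q /\ g \in unitmx.
Proof.
move=> /connected_component_sub[gQ dg]; split.
  by apply: (@map_mx_inj _ _ (ratr : {rmorphism rat -> R})); rewrite -[LHS]/(toR R _) !toR_mul toR_tr gQ.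
rewrite unitmxE unitfE; apply/eqP => d0; move: dg.
by rewrite /toR det_map_mx d0 rmorph0 => /eqP; rewrite eq_sym oner_eq0.
Qed.

(** X g - h = (X - h) g + (h g - h): the first part lies in L because g preserves L, the second
    because Gamma acts trivially on the discriminant group. *)
Lemma Gamma_coset g X : Gamma g -> coset_pow L h X -> coset_pow L h (X *m g).
Proof.
move=> Gg HX i; have [_ gL] := ag_sub hGamma Gg.
have -> : row i (X *m g - h) = row i (X - h) *m g + (row i h *m g - row i h).
  by rewrite !linearB /= mulmxBl row_mul addrA subrK.
apply: lattice_add => //; first by rewrite -gL; exists (row i (X - h)).
exact: (ag_discriminant hGamma).
Qed.

Lemma phi_form_isometry (tau : 'M[R[i]]_n) (X : 'M[R]_(n, p.+1)) g Z w :
  g *m toR R Q *m g^T = toR R Q ->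
  phi_form Q tau (X *m g) (Z *m g) (fun k => w k *m g) = phi_form Q tau X Z w.
Proof.
move=> gQ.
have bg x y : bil (toR R Q) (x *m g) (y *m g) = bil (toR R Q) x y.
  by rewrite /bil trmx_mul -!mulmxA [g *m (_ *m _)]mulmxA [g *m _ *m _]mulmxA gQ.
have mg x y : majorant Q (Z *m g) (x *m g) (y *m g) = majorant Q Z x y.
  by rewrite /majorant !bg !scalemxAl -!mulmxBl !bg.
rewrite /phi_form.
have -> : \matrix_(i, j) bil (toR R Q) (row i (X *m g)) (row j (X *m g)) =
    \matrix_(i, j) bil (toR R Q) (row i X) (row j X).
  by apply/matrixP => i j; rewrite !mxE !row_mul bg.
have -> : \matrix_(i, j) majorant Q (Z *m g) (row i (X *m g)) (row j (X *m g)) =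
    \matrix_(i, j) majorant Q Z (row i X) (row j X).
  by apply/matrixP => i j; rewrite !mxE !row_mul mg.
have -> // : \matrix_(i, j) bil (toR R Q) (row i (X *m g)) (w j *m g) =
    \matrix_(i, j) bil (toR R Q) (row i X) (w j).
by apply/matrixP => i j; rewrite !mxE !row_mul bg.
Qed.

Lemma theta_Gamma (tau : 'M[R[i]]_n) g Z w : Gamma g ->
  theta_form Q L h tau (Z *m toR R g) (fun k => w k *m toR R g) = theta_form Q L h tau Z w.
Proof.
move=> Gg; have [gSO gL] := ag_sub hGamma Gg.
have [gQ ug] := SO_component_isometry gSO.
have bij : set_bij (coset_pow L h) (coset_pow L h) (mulmx^~ g).
  split=> [X HX|X Y _ _ /(congr1 (mulmx^~ (invmx g)))|X HX]; first exact: Gamma_coset.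
    by rewrite !mulmxK.
  exists (X *m invmx g); last by rewrite mulmxKV.
  by apply: Gamma_coset => //; exact: (ag_inv hGamma).
rewrite /theta_form (reindex_csum _ bij); apply: eq_csum => X _.
by rewrite toR_mul phi_form_isometry // -toR_tr -!toR_mul gQ.
Qed.

End GammaInvariance.

Theorem theorem1p1 (R : realType) (p n : nat) (hn : (1 <= n <= p)%N)
  (Q : 'M[rat]_p.+1) (Q_sym : Q^T = Q) (Q_sig : signature_p1 R Q)
  (L : set 'rV[rat]_p.+1) (L_lattice : is_lattice L)
  (L_dual : L `<=` dual_lattice Q L)
  (Gamma : set 'M[rat]_p.+1) (hGamma : admissible_group R Q L Gamma)
  (B : set 'rV[R]_p.+1) (hB : hyperbolic_space Q B)
  (h : 'M[rat]_(n, p.+1)) (hh : forall i, dual_lattice Q L (row i h))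
  (r : nat) (u : 'I_r.+1 -> 'rV[rat]_p.+1)
  (hu : cusp_representatives Q L Gamma B u)
  (g : 'I_r.+1 -> 'M[rat]_p.+1)
  (hg : forall j, SO_id_component Q (toR R (g j)) /\ u ord0 *m g j = u j)
  (hg0 : g ord0 = 1%:M)
  (u0' : 'rV[rat]_p.+1) (hu0' : bil Q u0' u0' = 0)
  (hu00' : bil Q (u ord0) u0' = - (1 / 2))
  (e : 'M[R]_(p.-1, p.+1)) (he : basis_of_W Q (u ord0) u0' e) :
  exists eta : 'M[R[i]]_n -> 'I_r.+1 -> nform n (collar R p),
    (forall tau, siegel_upper_half tau ->
       smooth_form_on_Mbar Q Gamma u g u0' e B
         (theta_form Q L h tau) (eta tau)) /\
    (forall (j : 'I_r.+1) (I : 'I_n -> 'I_p.-1),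
       increasing I ->
       exists2 f, Theta_space p.-1 f &
         forall tau y, siegel_upper_half tau ->
           form_coef I (boundary_restriction (eta tau j)) y = f tau).
Proof.
have p0 : (0 < p)%N by case/andP: hn => n0; exact: leq_trans.
(* From 1 <= n <= p follows p = d + 1, after which [p.-1] reduces to d, the dimension of W. *)
case: p p0 hn Q Q_sym Q_sig L L_lattice L_dual Gamma hGamma B hB h hh u hu g hg hg0 u0' hu0' hu00' e he
  => [//|d] _ _ Q Q_sym Q_sig L L_lattice _ Gamma hGamma B hB h hh u hu g hg hg0 u0' hu0' hu00' e he.
have uu := cr_isotropic hu ord0.
have gQ j := proj1 (SO_component_isometry (proj1 (hg j))).
have ug j := proj2 (SO_component_isometry (proj1 (hg j))).
have /choice[eta Heta] := fun j => cusp_extension h Q_sym Q_sig L_lattice uu hu0' hu00' he (gQ j) (ug j).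
exists (fun tau j => eta j tau); split=> [tau st|j I _]; last first.
  have [_ _ H3 H4 _] := Heta j.
  exists (fun tau => eta j tau (0, 0) (fun k => (0, delta_mx 0 (I k)))); first exact: H4.
  (* The boundary form does not depend on b, so its value at b = 0 serves for all y. *)
  by move=> tau y _; rewrite /form_coef /boundary_restriction (H3 tau (0, y) 0).
split.
- move=> Z BZ; have ZZ : bil (toR R Q) Z Z = -1.
    by case: hB => Z0 _ eB; move: BZ; rewrite eB => /connected_component_sub.
  (* Condition [cr_sign] selects the sheet B, which makes the coordinate s positive. *)
  have [x x0 ->] := hyperboloid_chart Q_sym uu hu0' hu00' he hg0 ZZ (cr_sign hu ord0 BZ).
  have [_ _ _ _ H] := Heta ord0.
  exact: alt_multilinear_sub (H _ _ st x0).
- by move=> gam Z w Gg _ _; exact: (theta_Gamma L_lattice hGamma hh).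
- by move=> j; have [H _ _ _ _] := Heta j; exact: H.
- move=> j lam x w [gam [Gg _ Hg]] x0; have [_ H2 H3 _ _] := Heta j.
  (* For s > 0 the translation is induced by an element of Gamma, under which theta is invariant; at
     s = 0 the form is constant in b. *)
  have [xp|xn] := ltP 0 x.1; last by rewrite (H3 _ x x.2) // (H3 _ (x.1, x.2 + lam) x.2).
  refine (etrans (H2 tau (x.1, x.2 + lam) w xp) (etrans _ (esym (H2 tau x w xp)))).
  refine (pullback_shift Q_sym Q_sig uu hu0' hu00' he w Hg _ xp) => Z v.
  exact: (theta_Gamma L_lattice hGamma hh).
- by move=> j x w x0; have [_ H2 _ _ _] := Heta j; rewrite H2.
Qed.
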